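(* Let $\nu\ge -\frac12$ and $d_\nu=2\nu+2$. Let $0<\gamma<d_\nu$, let $\alpha,\beta\in\mathbb{R}$ satisfy $0\le \alpha+\beta\le\gamma<d_\nu$, and let $1<p\le q<\frac{d_\nu}{\gamma-\alpha-\beta}$. Assume that $s$ and $t$ satisfy $$1<s\le t<\infty,\qquad \frac1t=\frac1q-\frac{\gamma-\alpha-\beta}{d_\nu},\qquad \frac st=\frac pq,$$ and that $\alpha<\frac{d_\nu}{q'}$ and $\beta<\frac{d_\nu}{t}$, where $\frac1q+\frac1{q'}=1$. Assume in addition that $d_\nu>t$. Then there is a constant $C>0$, independent of $f$, such that $$\big\||\cdot|^{-\beta}I_\gamma^\nu f\big\|_{L^{s,t}(\mathbb{R},d\mu_\nu)}\le C\,\big\||\cdot|^{\alpha}f\big\|_{L^{p,q}(\mathbb{R},d\mu_\nu)}$$ for all $f$ with $|\cdot|^\alpha f\in L^{p,q}(\mathbb{R},d\mu_\nu)$.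
   Context: Fix a real number $\nu\ge-\frac12$ and put $d_\nu=2\nu+2$. Measure: $d\mu_\nu(x)=(2^{\nu+1}\Gamma(\nu+1))^{-1}|x|^{2\nu+1}dx$ on $\mathbb{R}$. Functions are complex-valued and measurable. Dunkl translation: for $x,y\in\mathbb{R}$, $\tau_x^\nu f(y)=\int_{\mathbb{R}}f(z)\,d\sigma_{x,y}(z)$, where $\sigma_{x,y}$ is the signed measure (with $\sigma_{x,0}=\delta_x$, $\sigma_{0,y}=\delta_y$, and, for $x,y\ne0$ and $\nu>-\frac12$, absolutely continuous with respect to $\mu_\nu$) given explicitly for $\nu>-\frac12$ by $$\tau_x^\nu f(y)=\frac{C_\nu}{2}\int_{-1}^{1}\Big[f(\rho_u)\Big(1+\frac{x+y}{\rho_u}\Big)+f(-\rho_u)\Big(1-\frac{x+y}{\rho_u}\Big)\Big](1+u)(1-u^2)^{\nu-\frac12}\,du,$$ with $\rho_u=\sqrt{x^2+y^2+2xyu}$, $C_\nu=\frac{\Gamma(\nu+1)}{\sqrt\pi\,\Gamma(\nu+\frac12)}$, and $\frac{x+y}{\rho_u}$ read as $0$ when $\rho_u=0$. For $\nu=-\frac12$, $\tau_x^\nu f(y)=f(x+y)$. For $f$ locally integrable with respect to $\mu_\nu$, $\tau_x^\nu f(y)$ is defined for almost every $y$. One has $\tau_x^\nu f(y)=\tau_y^\nu f(x)$. Dunkl fractional integral operator: for $0<\gamma<d_\nu$, $$I_\gamma^\nu f(x)=\int_{\mathbb{R}}f(y)\,\tau_y^\nu K_\gamma^\nu(x)\,d\mu_\nu(y),\qquad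 K_\gamma^\nu(x)=|x|^{\gamma-d_\nu}.$$ Dunkl Morrey space: for $1\le p\le q<\infty$, $L^{p,q}(\mathbb{R},d\mu_\nu)$ is the set of locally integrable functions $f$ on $\mathbb{R}$ with $$\|f\|_{L^{p,q}(\mathbb{R},d\mu_\nu)}=\sup_{x\in\mathbb{R},\,r>0} r^{d_\nu(\frac1q-\frac1p)}\Big(\int_{B(0,r)}\tau_x^\nu(|f|^p)(y)\,d\mu_\nu(y)\Big)^{1/p}<\infty,$$ where $B(0,r)=(-r,r)$ (the norm is $+\infty$ if $|f|^p$ is not locally integrable). Convention: when $\gamma=\alpha+\beta$, the condition $q<\frac{d_\nu}{\gamma-\alpha-\beta}$ means $q<\infty$. The notation $|\cdot|^{a}f$ denotes the function $x\mapsto|x|^{a}f(x)$. *)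

(* Defs.v *)
From HB Require Import structures.
From mathcomp Require Import all_boot all_order all_algebra.
From mathcomp Require Import all_classical all_reals all_analysis measurable_realfun.
From mathcomp Require Import complex.

Set Implicit Arguments.
Unset Strict Implicit.
Unset Printing Implicit Defensive.

Import Order.TTheory GRing.Theory Num.Theory.
Import numFieldNormedType.Exports.

Local Open Scope classical_set_scope.
Local Open Scope ring_scope.
Local Open Scope complex_scope.

(** Conventions inherited from the libraries: [0 `^ a = 0] for [a != 0], and
    [x / 0 = 0]; measurable means Borel measurable.  [normc : R[i] -> R] is
    the modulus. *)
Notation normc := ComplexField.Normc.normc.

Section complex_integration.
Context d (T : measurableType d) (R : realType).

Definition cmeasurable_fun (D : set T) (f : T -> R[i]) : Prop :=
  measurable_fun D (fun x => complex.Re (f x)) /\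
  measurable_fun D (fun x => complex.Im (f x)).

Variable mu : {measure set T -> \bar R}.

Definition cintegrable (D : set T) (f : T -> R[i]) : Prop :=
  mu.-integrable D (fun x => (complex.Re (f x))%:E) /\
  mu.-integrable D (fun x => (complex.Im (f x))%:E).

Definition cintegral (D : set T) (f : T -> R[i]) : R[i] :=
  (\int[mu]_(x in D) complex.Re (f x)) +i* (\int[mu]_(x in D) complex.Im (f x)).

End complex_integration.

Section dunkl_measure.
Context {R : realType}.
Implicit Types nu x : R.

(** Euler's Gamma function; only used at arguments [s > 0]. *)
Definition Gamma (s : R) : R :=
  \int[lebesgue_measure]_(t in `]0, +oo[) (t `^ (s - 1) * expR (- t)).

Definition dunkl_dim nu : R := 2 * nu + 2.

Definition dunkl_weight nu x : R :=
  (2 `^ (nu + 1) * Gamma (nu + 1))^-1 * `|x| `^ (2 * nu + 1).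

Definition dunkl_measure nu (A : set R) : \bar R :=
  (\int[lebesgue_measure]_(x in A) (dunkl_weight nu x)%:E)%E.

Lemma Gamma_ge0 (s : R) : 0 <= Gamma s.
Proof.
apply: fine_ge0; apply: integral_ge0 => t _.
by rewrite lee_fin mulr_ge0 ?powR_ge0 ?expR_ge0.
Qed.

Lemma dunkl_weight_ge0 nu x : 0 <= dunkl_weight nu x.
Proof. by rewrite mulr_ge0 ?invr_ge0 ?mulr_ge0 ?powR_ge0 ?Gamma_ge0. Qed.

Lemma measurable_dunkl_weight nu : measurable_fun setT (dunkl_weight nu).
Proof.
apply: measurable_funM => //; apply: (measurableT_comp (measurable_powR _)).
exact: normr_measurable.
Qed.

Section measure_instance.
Variable nu : R.

Let dunkl_measure0 : dunkl_measure nu set0 = 0%E.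
Proof. by rewrite /dunkl_measure integral_set0. Qed.

Let dunkl_measure_ge0 A : (0 <= dunkl_measure nu A)%E.
Proof. by apply: integral_ge0 => x _; rewrite lee_fin dunkl_weight_ge0. Qed.

Let dunkl_measure_sigma_additive : semi_sigma_additive (dunkl_measure nu).
Proof.
move=> A mA tA mUA; rewrite /dunkl_measure ge0_integral_bigcup//=; last 2 first.
- apply/measurable_EFinP; apply: measurable_funTS.
  exact: measurable_dunkl_weight.
- by move=> x _; rewrite lee_fin dunkl_weight_ge0.
apply: is_cvg_ereal_nneg_natsum_cond => n _ _.
by apply: integral_ge0 => x _; rewrite lee_fin dunkl_weight_ge0.
Qed.

HB.instance Definition _ := isMeasure.Build _ _ _ (dunkl_measure nu)
  dunkl_measure0 dunkl_measure_ge0 dunkl_measure_sigma_additive.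

End measure_instance.
End dunkl_measure.

Section dunkl_operators.
Context {R : realType}.
Implicit Types nu p q x y z r : R.

Definition dunkl_const nu : R :=
  Gamma (nu + 1) / (Num.sqrt pi * Gamma (nu + 1 / 2)).

(** [dunkl_translation nu x f y] is tau_x^nu f(y), for real-valued [f]: it is
    only needed for |f|^p and for the kernel |x|^(gamma - d_nu). *)
Definition dunkl_translation nu x (f : R -> R) y : R :=
  if nu == - (1 / 2) then f (x + y) else
  let rho u := Num.sqrt (x ^+ 2 + y ^+ 2 + 2 * x * y * u) in
  dunkl_const nu / 2 *
  \int[lebesgue_measure]_(u in `[-1, 1])
    ((f (rho u) * (1 + (x + y) / rho u) + f (- rho u) * (1 - (x + y) / rho u))
     * (1 + u) * (1 - u ^+ 2) `^ (nu - 1 / 2)).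

Definition riesz_kernel nu (gamma : R) x : R := `|x| `^ (gamma - dunkl_dim nu).

Definition dunkl_frac_integrand nu gamma (f : R -> R[i]) x y : R[i] :=
  f y * (dunkl_translation nu y (riesz_kernel nu gamma) x)%:C.

Definition dunkl_frac_integral nu gamma (f : R -> R[i]) x : R[i] :=
  cintegral (dunkl_measure nu) setT (dunkl_frac_integrand nu gamma f x).

(** The integral defining I_gamma^nu f converges absolutely at almost every
    point; without this [dunkl_frac_integral] would only be a default value. *)
Definition dunkl_frac_integral_defined nu gamma (f : R -> R[i]) : Prop :=
  {ae dunkl_measure nu, forall x,
    cintegrable (dunkl_measure nu) setT (dunkl_frac_integrand nu gamma f x)}.

Definition power_mul (a : R) (f : R -> R[i]) : R -> R[i] :=
  fun x => (`|x| `^ a)%:C * f x.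

Definition dunkl_locally_integrable nu (g : R -> R) : Prop :=
  measurable_fun setT g /\
  forall K : set R, compact K ->
    (dunkl_measure nu).-integrable K (fun x => (g x)%:E).

(** The translate of |f|^p may take negative values when [nu > -1/2], so the
    integral over the ball is that of a signed function; the test of local
    integrability ensures that it is a genuine Lebesgue integral. *)
Definition dunkl_morrey_norm nu p q (f : R -> R[i]) : \bar R :=
  let g := fun z => normc (f z) `^ p in
  if `[< dunkl_locally_integrable nu g >] then
    ereal_sup [set N | exists x r : R, 0 < r /\
      N = ((r `^ (dunkl_dim nu * (q^-1 - p^-1)))%R%:E *
           poweR (\int[dunkl_measure nu]_(y in ball (0%R : R) r)
                    (dunkl_translation nu x g y)%:E) p^-1%R)%E]
  else +oo%E.

Definition dunkl_morrey_space nu p q (f : R -> R[i]) : Prop :=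
  [/\ cmeasurable_fun setT f,
      dunkl_locally_integrable nu (fun x => normc (f x)) &
      (dunkl_morrey_norm nu p q f < +oo)%E].

End dunkl_operators.

(* Main.v *)
Require Import Defs.
From HB Require Import structures.
From mathcomp Require Import all_boot all_order all_algebra.
From mathcomp Require Import all_classical all_reals all_analysis.
From mathcomp Require Import measurable_realfun.
From mathcomp Require Import complex ring lra.

Set Implicit Arguments.
Unset Strict Implicit.
Unset Printing Implicit Defensive.

Import Order.TTheory GRing.Theory Num.Theory.
Import numFieldNormedType.Exports.

Local Open Scope classical_set_scope.
Local Open Scope ring_scope.

(** Write [n = 2 nu + 1], [D = n + 1], [k = D / q] and [b = D / t].

    Pairing [(y, u)] with [(- y, - u)], the average over a ball of the translate
    of some [g >= 0] becomes the integral over [0 < y < r] and the angle [u] of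
    [g rho (1 + zeta) + g (- rho) (1 - zeta)], where [rho] is the third side of
    the triangle with sides [x], [y] and [zeta] is a cosine. Exchanging the
    roles of [y] and [rho], which preserves [y ^ n dy (1 - u ^ 2) ^ (n / 2 - 1) du],
    shows that this average is comparable to [(r / (x + r)) ^ n] times the
    integral of [g z + g (- z)] against [z ^ n dz] over [`|z - x| < r]. The Morrey
    condition is thus a condition on the half-line, and the kernel of the
    fractional integral is dominated by the angular mean of [rho ^ (gamma - D)].

    On the half-line, the weighted potential is a mean of dilates of the
    function, which Jensen's inequality bounds when [gamma = alpha + beta]. If
    [gamma > alpha + beta], the part far from the diagonal is interpolated
    between this mean and the pointwise bound [C x ^ (- b)]; near the diagonal
    the weights cancel, and Hedberg's splitting at a distance [dl] is optimised
    inside the integral over the ball.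

    When [nu = - 1 / 2] the hypotheses contradict each other, since
    [1 < t < D = 1]. No estimate of [Gamma] is needed: either [dunkl_const] is
    positive, or it vanishes and so do all translations. *)

(** * Measures with a density and changes of variables *)

(** Translates of a nonnegative [g] change sign, so they cannot be bounded below pointwise. The
    pairing restores the sign because [(x + y) (1 + u) + (x - y) (1 - u) = 2 (x + y u)], and
    [(x + y u) / rho] is a cosine; integrability before pairing comes from
    [|(x + y) (1 + u)| <= 2 rho]. Where the cosine is nonnegative the paired density dominates
    [g rho]; the values [g (- rho)] are recovered from the translate at [- x]. Hedberg's argument is
    usually closed by the maximal function. Here the cutting distance depends on the local part
    itself, and once the integrals over the ball and over the source are exchanged, the cutoff
    integrates to a multiple of [H ^ (p - 1)]; multiplied by [H], this is what the Morrey condition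
    controls. The relation [s / t = p / q] enters as [b s = k p]: it balances the two pieces of the
    cutoff and removes the variable from the far interpolation. The bounds [alpha < D / q'] and
    [beta < D / t] make the dilation kernel integrable at [0] and at infinity; [gamma > 0] handles
    its singularity at [1]. *)

Section density.
Context d (T : measurableType d) (R : realType).
Variable mu : {measure set T -> \bar R}.
Variable w : T -> R.

(** The two proofs are arguments so that the measure structure can be attached to the term
    [density mu mw w0] itself. *)
Definition density of measurable_fun setT w & (forall x, 0 <= w x) :=
  fun A : set T => (\int[mu]_(x in A) (w x)%:E)%E.

Hypothesis mw : measurable_fun setT w.
Hypothesis w0 : forall x, 0 <= w x.

Let density0 : density mw w0 set0 = 0%E.
Proof. by rewrite /density integral_set0. Qed.

Let density_ge0 A : (0 <= density mw w0 A)%E.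
Proof. by apply: integral_ge0 => x _; rewrite lee_fin. Qed.

Let density_semi_sigma_additive : semi_sigma_additive (density mw w0).
Proof.
move=> A mA tA mUA; rewrite /density ge0_integral_bigcup//=; last 2 first.
- by apply/measurable_EFinP; apply: measurable_funTS.
- by move=> x _; rewrite lee_fin.
apply: is_cvg_ereal_nneg_natsum_cond => n _ _.
by apply: integral_ge0 => x _; rewrite lee_fin.
Qed.

HB.instance Definition _ := isMeasure.Build _ _ _ (density mw w0)
  density0 density_ge0 density_semi_sigma_additive.

Import HBNNSimple.
Local Open Scope ereal_scope.

(** True for indicators by definition, hence for simple functions, hence in general by monotone
    convergence; no finiteness of [mu] enters. *)
Lemma integral_density (f : T -> \bar R) : measurable_fun setT f ->
  (forall x, 0 <= f x) ->
  \int[density mw w0]_x f x = \int[mu]_x (f x * (w x)%:E).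
Proof.
move=> mf f0; pose h := nnsfun_approx measurableT mf.
have mwE : measurable_fun setT (EFin \o w) by exact/measurable_EFinP.
have mhw n : measurable_fun setT (fun x => (h n x)%:E * (w x)%:E).
  by apply: emeasurable_funM => //; exact/measurable_EFinP.
have fE x : f x = lim ((EFin \o h n) x @[n --> \oo]).
  by apply/esym/cvg_lim => //; exact: cvg_nnsfun_approx.
have fwE x : f x * (w x)%:E = lim ((h n x)%:E * (w x)%:E @[n --> \oo]).
  apply/esym/cvg_lim => //; apply: cvgeZr => //.
  exact: cvg_nnsfun_approx.
rewrite (eq_integral _ _ (fun x _ => fE x)).
rewrite [RHS](eq_integral _ _ (fun x _ => fwE x)).
rewrite monotone_convergence//; last 3 first.
- by move=> n; exact/measurable_EFinP.
- by move=> n x _; rewrite lee_fin.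
- by move=> x _ a b ab; rewrite lee_fin; exact/lefP/nd_nnsfun_approx.
rewrite monotone_convergence//; last 2 first.
- by move=> n x _; rewrite mule_ge0 ?lee_fin.
- move=> x _ a b ab; rewrite lee_wpmul2r ?lee_fin//.
  exact/lefP/nd_nnsfun_approx.
suff suf n : \int[density mw w0]_x (h n x)%:E = \int[mu]_x ((h n x)%:E * (w x)%:E).
  by apply: (f_equal (fun u : (\bar R)^nat => limn u)); apply/funext => n; exact: suf.
transitivity (\int[density mw w0]_x
   (\sum_(y \in range (h n)) (y * \1_(h n @^-1` [set y]) x)%:E)).
  by apply: eq_integral => t tE; rewrite /= fimfunE -fsumEFin.
have indich r : measurable_fun setT (fun x => (r * \1_(h n @^-1` [set r]) x)%:E).
  by apply/measurable_EFinP; exact: measurable_funM.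
rewrite ge0_integral_fsum//; last by move=> y x _; exact: nnfun_muleindic_ge0.
transitivity (\int[mu]_x (\sum_(y \in range (h n))
    (y * \1_(h n @^-1` [set y]) x)%:E * (w x)%:E)); last first.
  apply: eq_integral => x _.
  rewrite -ge0_mule_fsuml => [|y]; last exact: nnfun_muleindic_ge0.
  by rewrite fsumEFin // -(fimfunE _ x).
rewrite ge0_integral_fsum//; last 2 first.
- by move=> y; exact: emeasurable_funM.
- by move=> y x _; rewrite mule_ge0 ?lee_fin// -lee_fin; exact: nnfun_muleindic_ge0.
apply: eq_fsbigr => r rhn.
under eq_integral do rewrite EFinM.
rewrite integralZl_indic_nnsfun => //.
under [RHS]eq_integral do rewrite EFinM -muleA.
rewrite ge0_integralZl//.
- congr (_ * _); rewrite integral_indic// setIT.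
  rewrite (eq_integral ((EFin \o w) \_ (h n @^-1` [set r]))); last first.
    by move=> x xE; rewrite epatch_indic muleC.
  by rewrite -integral_mkcond.
- by apply: emeasurable_funM => //; exact/measurable_EFinP.
- by move=> t _; rewrite mule_ge0 ?lee_fin.
- by move: rhn; rewrite inE => -[t _ <-]; rewrite lee_fin.
Qed.

End density.

Section density_sigma_finite.
Context d (T : measurableType d) (R : realType).
Variable mu : {sigma_finite_measure set T -> \bar R}.
Variable w : T -> R.
Hypothesis mw : measurable_fun setT w.
Hypothesis w0 : forall x, 0 <= w x.

(** On [F n] intersected with [w <= n] the new measure is at most [n * mu (F n)]. Tonelli's theorem
    will be applied to such densities. *)
Lemma density_sigma_finite : sigma_finite setT (density mu mw w0).
Proof.
have /sigma_finiteP[F [UF ndF mF]] := sigma_finiteT mu.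
have mle n : measurable [set x | w x <= n%:R].
  rewrite -[X in measurable X]setTI.
  by apply: measurable_fun_le => //; exact: mw.
exists (fun n => F n `&` [set x | w x <= n%:R]).
  apply/seteqP; split => // x _.
  have : (\bigcup_i F i) x by rewrite -UF.
  move=> [i _ Fix]; exists (maxn i (Num.truncn (w x)).+1) => //; split.
    by have /subsetPset := ndF _ _ (leq_maxl i (Num.truncn (w x)).+1); exact.
  by rewrite /= (le_trans (ltW (truncnS_gt _)))// ler_nat leq_maxr.
move=> n; have [mFn Fn] := mF n; split; first exact: measurableI.
rewrite /density; set D := (X in (\int[mu]_(_ in X) _)%E).
apply: (@le_lt_trans _ _ (\int[mu]_(x in D) (cst n%:R%:E) x)%E).
  apply: ge0_le_integral => //.
  - exact: measurableI.
  - by move=> x _; rewrite lee_fin.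
  - by apply/measurable_EFinP; apply: measurable_funTS.
  - by move=> x [_ /=]; rewrite lee_fin.
rewrite integral_cst; last exact: measurableI.
rewrite lte_mul_pinfty// (le_lt_trans _ Fn)// le_measure ?inE//.
  exact: measurableI.
exact: subIsetl.
Qed.

HB.instance Definition _ := Measure_isSigmaFinite.Build _ _ _ (density mu mw w0)
  density_sigma_finite.

End density_sigma_finite.

Section substitution.
Context {R : realType}.
Local Notation mu := (@lebesgue_measure R).
Variables phi psi dphi : R -> R.
Hypothesis phiK : cancel psi phi.
Hypothesis phi_homo : {homo phi : x y / x < y}.
Hypothesis Dphi : forall x, is_derive x (1 : R) phi (dphi x).
Hypothesis cdphi : continuous dphi.
Hypothesis dphi0 : forall x, 0 <= dphi x.

(** The image under [phi] of the measure with density [dphi] gives []u, v]] the mass [v - u], by the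
    fundamental theorem of calculus on []psi u, psi v]]; by uniqueness it is Lebesgue measure. *)
Lemma ge0_integral_substitution (f : R -> \bar R) : measurable_fun setT f ->
  (forall x, 0 <= f x)%E ->
  (\int[mu]_x f x = \int[mu]_x (f (phi x) * (dphi x)%:E))%E.
Proof.
move=> mf f0.
have phi_mono : {mono phi : x y / x <= y} by exact: le_mono.
have cphi : continuous phi.
  by move=> x; apply: differentiable_continuous; apply/derivable1_diffP.
have mphi : measurable_fun setT (phi : measurableTypeR R -> measurableTypeR R).
  by have /= := continuous_measurable_fun cphi.
have mdphi : measurable_fun setT (dphi : measurableTypeR R -> R) by have /= := continuous_measurable_fun cdphi.
have -> : (\int[mu]_x (f (phi x) * (dphi x)%:E) =
    \int[density mu mdphi dphi0]_(x in phi @^-1` setT) (f \o phi) x)%E.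
  rewrite preimage_setT integral_density//; last by move=> x; exact: f0.
  exact: (measurableT_comp (mf : measurable_fun setT (f : measurableTypeR R -> _)) mphi).
rewrite -(ge0_integral_pushforward mphi)//.
apply: eq_measure_integral => A mA _; apply: lebesgue_measure_unique => //.
move=> _ [[u v]] _ <-; rewrite lebesgue_measure_itv/= lte_fin.
rewrite /pushforward /density.
have -> : phi @^-1` `]u, v] = `]psi u, psi v]%classic.
  apply/seteqP; split => x /=; rewrite !in_itv/=.
    by rewrite -{1}(phiK u) -{1}(phiK v) (leW_mono phi_mono) phi_mono.
  by rewrite -(leW_mono phi_mono) -phi_mono !phiK.
have := leW_mono phi_mono (psi u) (psi v); rewrite !phiK => ->.
case: ifPn => uv; last first.
  by rewrite set_itv_ge ?integral_set0// bnd_simp -leNgt leNgt.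
rewrite integral_itv_obnd_cbnd//; last first.
  by apply/measurable_EFinP; exact: measurable_funTS.
rewrite (@continuous_FTC2 _ dphi phi)//.
- by rewrite !phiK.
- exact: continuous_subspaceT.
- split => //.
  + by apply: cvg_at_right_filter; exact: cphi.
  + by apply: cvg_at_left_filter; exact: cphi.
- by move=> x _; rewrite derive1E; apply: derive_val.
Qed.

End substitution.

(** * Real powers and dyadic shells *)

Section real_powers.
Context {R : realType}.
Implicit Types x y c : R.

Lemma le0_ler_powR c x y : c <= 0 -> 0 < x -> x <= y -> y `^ c <= x `^ c.
Proof.
move=> c0 x0 xy; have y0 := lt_le_trans x0 xy.
rewrite -(opprK c) !(powRN _ (- c)) lef_pV2 ?posrE ?powR_gt0//.
by rewrite ge0_ler_powR ?oppr_ge0// nnegrE ltW.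
Qed.

Lemma powR_exprn x c k : 0 <= x -> (x ^+ k) `^ c = (x `^ c) ^+ k.
Proof. by move=> x0; rewrite -(powR_mulrn k x0) -(powR_mulrn k (powR_ge0 x c)) powRAC. Qed.

Lemma powR_comparable c x y (M : R) : 1 <= M -> 0 < x -> 0 < y ->
  x <= M * y -> y <= M * x -> x `^ c <= M `^ `|c| * y `^ c.
Proof.
move=> M1 x0 y0 xy yx; have M0 : 0 < M by exact: lt_le_trans M1.
have [c0|c0] := leP 0 c.
  rewrite ger0_norm// -powRM ?(ltW M0) ?(ltW y0)//.
  by rewrite ge0_ler_powR// nnegrE ?mulr_ge0// ltW.
rewrite ltr0_norm// powRN ler_pdivlMl ?powR_gt0//.
rewrite -powRM ?(ltW M0) ?(ltW x0)//.
by apply: le0_ler_powR => //; exact: ltW.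
Qed.

Lemma powR_ge1 c x : 0 <= c -> 1 <= x -> 1 <= x `^ c.
Proof.
move=> c0 x1; have : 1 `^ c <= x `^ c.
  by rewrite ge0_ler_powR// nnegrE// (le_trans _ x1).
by rewrite powR1.
Qed.

Lemma powR2N_lt1 c : 0 < c -> 2 `^ (- c) < 1 :> R.
Proof.
move=> c0; rewrite powRN invf_lt1 ?powR_gt0//.
have := @gt0_ltr_powR R c c0 1 2; rewrite powR1; apply; rewrite ?nnegrE//.
by rewrite ltr1n.
Qed.

Lemma halving_shell x (r : R) : 0 < x -> x < r ->
  exists k, r * 2^-1 ^+ k / 2 <= x < r * 2^-1 ^+ k.
Proof.
move=> x0 xr; have r0 := lt_trans x0 xr.
have ex : exists k, r * 2^-1 ^+ k / 2 <= x.
  exists (Num.truncn (r / x)).+1; rewrite exprVn -mulrA -invfM.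
  rewrite ler_pdivrMr ?mulr_gt0 ?exprn_gt0// mulrC -ler_pdivrMr//.
  rewrite (le_trans (ltW (truncnS_gt _)))//.
  set m := (Num.truncn _).+1.
  rewrite (le_trans (_ : m%:R <= (2 ^ m)%:R)) ?ler_nat ?(ltnW (ltn_expl _ _))//.
  by rewrite natrX ler_pMr ?exprn_gt0// ler1n.
case: (ex_minnP ex) => k kx mink; exists k; rewrite kx/=.
case: k kx mink => [|k] _ mink; first by rewrite expr0 mulr1.
rewrite ltNge; apply/negP => h; have := mink k.
by rewrite -mulrA -exprSr h ltnn => /(_ isT).
Qed.

Lemma doubling_shell x (r : R) : 0 < r -> r <= x ->
  exists k, r * 2 ^+ k.+1 / 2 <= x < r * 2 ^+ k.+1.
Proof.
move=> r0 rx; have x0 := lt_le_trans r0 rx.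
have ex : exists k, x < r * 2 ^+ k.+1.
  exists (Num.truncn (x / r)).+1; rewrite -ltr_pdivrMl// mulrC.
  rewrite (lt_le_trans (truncnS_gt _))//.
  set m := (Num.truncn _).+1.
  apply: (@le_trans _ _ (2 ^ m.+1)%:R); last by rewrite natrX.
  rewrite ler_nat.
  by rewrite ltnW// (ltn_trans (ltn_expl m (isT : (1 < 2)%N)))// ltn_exp2l.
case: (ex_minnP ex) => k kx mink; exists k; rewrite kx andbT.
rewrite exprSr mulrA mulfK//.
case: k kx mink => [|k] _ mink; first by rewrite expr0 mulr1.
rewrite leNgt; apply/negP => h; have := mink k h.
by rewrite ltnn.
Qed.

End real_powers.

Section shells.
Local Open Scope ereal_scope.
Context d (T : measurableType d) (R : realType) (mu : {measure set T -> \bar R}).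
Variables (rho : T -> R) (g : T -> \bar R) (A m : R).
Hypothesis mrho : measurable_fun setT rho.
Hypothesis mg : measurable_fun setT g.
Hypothesis g0 : forall x, 0 <= g x.
Hypothesis A0 : (0 <= A)%R.
Hypothesis gA : forall r, (0 < r)%R ->
  \int[mu]_x (if (rho x < r)%R then g x else 0) <= (A * r `^ m)%:E.

(** On the shell [r k / 2 <= rho < r k] the power [rho ^ c] is within a factor [2 ^ |c|] of
    [r k ^ c], and the mass of the shell is at most that of [rho < r k]. The shells then add up to a
    geometric series of ratio [q]. *)
Lemma integral_shells (c B q : R) (r : nat -> R) (P : T -> bool) :
  measurable_fun setT P ->
  (0 <= B)%R -> (0 <= q < 1)%R -> (forall k, 0 < r k)%R ->
  (forall k, r k `^ (c + m) <= B * q ^+ k)%R ->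
  (forall x, P x -> exists k, r k / 2 <= rho x < r k)%R ->
  \int[mu]_x (if P x then (rho x `^ c)%:E * g x else 0) <=
  (2 `^ `|c| * A * (B / (1 - q)))%:E.
Proof.
move=> mP B0 /andP[q0 q1] r0 rq Pr.
have mpow : measurable_fun setT (fun x => (rho x `^ c)%:E * g x).
  apply: emeasurable_funM => //; apply/measurable_EFinP.
  exact: (measurableT_comp (measurable_powR _)).
have mltr k : measurable_fun setT (fun x => (rho x < r k)%R).
  exact: measurable_fun_ltr.
have mshell k : measurable_fun setT (fun x => if (rho x < r k)%R then g x else 0).
  by apply: measurable_fun_ifT.
pose K : R := (2 `^ `|c|)%R.
have K0 : (0 <= K)%R by exact: powR_ge0.
pose F k x := (K * r k `^ c)%:E * (if (rho x < r k)%R then g x else 0).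
have F0 k x : 0 <= F k x.
  by rewrite mule_ge0 ?lee_fin ?mulr_ge0 ?powR_ge0//; case: ifP.
have mF k : measurable_fun setT (F k) by apply: emeasurable_funM.
apply: (@le_trans _ _ (\int[mu]_x \sum_(k <oo) F k x)).
  apply: ge0_le_integral => //.
  - by move=> x _; case: ifP => //; rewrite mule_ge0 ?lee_fin ?powR_ge0.
  - by apply: measurable_fun_ifT.
  - by apply: ge0_emeasurable_sum.
  - move=> x _; case: ifPn => [/Pr[k /andP[rkx xrk]]|_]; last first.
      by apply: nneseries_ge0 => k _ _.
    apply: (@le_trans _ _ (\sum_(0 <= i < k.+1) F i x)); last first.
      by apply: nneseries_lim_ge.
    rewrite big_nat_recr//= -[leLHS]add0e leeD ?sume_ge0//.
    rewrite /F xrk lee_wpmul2r// lee_fin; apply: powR_comparable => //.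
    + by rewrite ler1n.
    + by rewrite (lt_le_trans _ rkx)// divr_gt0.
    + by rewrite (le_trans (ltW xrk))// ler_pMl ?ler1n.
    + by rewrite mulrC -ler_pdivrMr.
rewrite integral_nneseries//.
have KA n : \int[mu]_x F n x <= ((K * A * B) * q ^+ n)%:E.
  rewrite ge0_integralZl//; last 2 first.
  - by move=> x _; case: ifP.
  - by rewrite lee_fin mulr_ge0 ?powR_ge0.
  apply: (le_trans (lee_wpmul2l _ (gA (r0 n)))).
    by rewrite lee_fin mulr_ge0 ?powR_ge0.
  rewrite -EFinM lee_fin mulrACA -powRD; last by rewrite (gt_eqF (r0 n)) implybT.
  by rewrite -[leRHS]mulrA ler_wpM2l ?mulr_ge0.
apply: (le_trans (lee_nneseries _ (fun n _ => KA n))).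
  by move=> n _ _; exact: integral_ge0.
have := @cvg_geometric_series _ (K * A * B)%R q.
rewrite ger0_norm// => /(_ q1) h.
rewrite (_ : limn _ = (K * A * B / (1 - q))%:E) ?mulrA//.
apply/cvg_lim => //; rewrite [X in X @ _ --> _](_ : _ =
  (fun n => (series (geometric (K * A * B) q) n)%:E)).
  by apply: cvg_EFin => //; exact: nearW.
by apply/funext => n; rewrite /series/= sumEFin.
Qed.

(** Shells of radii [dl * 2 ^ (- k)], ratio [2 ^ (- e)]. The points with [rho = 0] lie in no shell,
    hence the condition [0 < rho x]. *)
Lemma integral_small_shells (e : R) (dl : R) : (0 < e)%R -> (0 < dl)%R ->
  \int[mu]_x (if (0 < rho x < dl)%R then (rho x `^ (e - m))%:E * g x else 0) <=
  (2 `^ `|e - m| / (1 - 2 `^ (- e)) * A * dl `^ e)%:E.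
Proof.
move=> e0 dl0; pose q : R := (2 `^ (- e))%R.
have q1 : (q < 1)%R.
  exact: powR2N_lt1.
apply: (le_trans (@integral_shells (e - m) (dl `^ e) q
  (fun k => dl * 2^-1 ^+ k)%R _ _ _ _ _ _ _)).
- apply: measurable_and; apply: measurable_fun_ltr => //.
- exact: powR_ge0.
- by rewrite powR_ge0.
- by move=> k; rewrite mulr_gt0// exprn_gt0.
- move=> k; rewrite subrK powRM ?exprn_ge0 ?(ltW dl0)//.
  by rewrite powR_exprn// -powR_inv1// -powRrM mulN1r.
- by move=> x /andP[]; exact: halving_shell.
- by rewrite lee_fin -/q le_eqVlt; apply/orP; left; apply/eqP; ring.
Qed.

(** Shells of radii [dl * 2 ^ (k + 1)]: the exponent is one ahead because the first shell starts at
    [dl], and the radius in the growth bound is the outer one. *)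
Lemma integral_large_shells (e : R) (dl : R) : (0 < e)%R -> (0 < dl)%R ->
  \int[mu]_x (if (dl <= rho x)%R then (rho x `^ (- m - e))%:E * g x else 0) <=
  (2 `^ `|- m - e| / (1 - 2 `^ (- e)) * A * dl `^ (- e))%:E.
Proof.
move=> e0 dl0; pose q : R := (2 `^ (- e))%R.
have q0 : (0 < q)%R by rewrite powR_gt0.
have q1 : (q < 1)%R.
  exact: powR2N_lt1.
apply: (le_trans (@integral_shells (- m - e) (dl `^ (- e)) q
  (fun k => dl * 2 ^+ k.+1)%R _ _ _ _ _ _ _)).
- exact: measurable_fun_ler.
- exact: powR_ge0.
- by rewrite powR_ge0.
- by move=> k; rewrite mulr_gt0// exprn_gt0.
- move=> k; rewrite addrAC addNr add0r powRM ?exprn_ge0 ?(ltW dl0)//.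
  rewrite powR_exprn// -/q ler_wpM2l ?powR_ge0//.
  by rewrite exprS ler_piMl ?exprn_ge0 ?ltW.
- by move=> x; exact: doubling_shell.
- by rewrite lee_fin -/q le_eqVlt; apply/orP; left; apply/eqP; ring.
Qed.

End shells.

(** * Lebesgue measure on the line *)

Section measurable_compositions.
Context d (T : measurableType d) (R : realType).

Lemma measurable_fun_sqrt (f : T -> R) : measurable_fun setT f ->
  measurable_fun setT (fun x => Num.sqrt (f x)).
Proof.
move=> mf; apply: (measurableT_comp _ mf).
by apply: continuous_measurable_fun; exact: sqrt_continuous.
Qed.

Lemma measurable_fun_powR (f : T -> R) (c : R) : measurable_fun setT f ->
  measurable_fun setT (fun x => f x `^ c).
Proof. by move=> mf; exact: (measurableT_comp (measurable_powR _) mf). Qed.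

Lemma measurable_fun_poweR (f : T -> \bar R) (c : R) : measurable_fun setT f ->
  measurable_fun setT (fun x => (f x `^ c)%E).
Proof. by move=> mf; exact: (measurableT_comp (measurable_poweR _) mf). Qed.

Lemma measurable_fun_EFin (f : T -> R) : measurable_fun setT f ->
  measurable_fun setT (fun x => (f x)%:E).
Proof. by move=> mf; exact/measurable_EFinP. Qed.

Lemma measurable_fun_normr (f : T -> R) : measurable_fun setT f ->
  measurable_fun setT (fun x => `|f x|).
Proof. by move=> mf; exact: measurableT_comp. Qed.

Lemma measurable_fun_oppr (f : T -> R) : measurable_fun setT f ->
  measurable_fun setT (fun x => - f x).
Proof. by move=> mf; exact: measurableT_comp. Qed.

Lemma measurable_fun_comp1 d' (U : measurableType d') (f : R -> U) (a : T -> R) :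
  measurable_fun setT f -> measurable_fun setT a ->
  measurable_fun setT (fun x => f (a x)).
Proof. by move=> mf ma; exact: (measurableT_comp mf ma). Qed.

Lemma measurable_fun_comp2 d' (U : measurableType d') (f : R * R -> U) (a b : T -> R) :
  measurable_fun setT f -> measurable_fun setT a -> measurable_fun setT b ->
  measurable_fun setT (fun x => f (a x, b x)).
Proof.
by move=> mf ma mb; apply: (measurableT_comp mf); exact: measurable_fun_pair.
Qed.

End measurable_compositions.

(** Recursion on the head of the function, including the eta-reduced forms left by unification. The
    last case leaves the goal untouched instead of failing, so that a caller can finish it. *)
Ltac meas :=
  first [assumption | exact: measurable_cst |
  lazymatch goal with
  | |- measurable_fun _ (fun x => x) => exact: measurable_id
  | |- measurable_fun _ (@Order.lt _ _ _) => apply: measurable_fun_ltr; meas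
  | |- measurable_fun _ (@Order.le _ _ _) => apply: measurable_fun_ler; meas
  | |- measurable_fun ?D Num.sqrt =>
      refine (_ : measurable_fun D (fun x => Num.sqrt x)); meas
  | |- measurable_fun ?D (GRing.mul ?c) =>
      refine (_ : measurable_fun D (fun x => c * x)%R); meas
  | |- measurable_fun ?D (GRing.add ?c) =>
      refine (_ : measurable_fun D (fun x => c + x)%R); meas
  | |- measurable_fun ?D GRing.opp =>
      refine (_ : measurable_fun D (fun x => - x)%R); meas
  | |- measurable_fun ?D Num.norm =>
      refine (_ : measurable_fun D (fun x => `|x|)%R); meas
  | |- measurable_fun _ fst => exact: measurable_fst
  | |- measurable_fun _ snd => exact: measurable_snd
  | |- measurable_fun _ (fun x => fst x) => exact: measurable_fst
  | |- measurable_fun _ (fun x => snd x) => exact: measurable_snd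
  | |- measurable_fun _ (fun x => fst (@?a x)) =>
      apply: (measurableT_comp measurable_fst); meas
  | |- measurable_fun _ (fun x => snd (@?a x)) =>
      apply: (measurableT_comp measurable_snd); meas
  | |- measurable_fun _ (fun x => @?b x && @?c x) =>
      apply: (@measurable_and _ _ _ b c); meas
  | |- measurable_fun _ (fun x => (@?a x < @?b x)%R) =>
      apply: measurable_fun_ltr; meas
  | |- measurable_fun _ (fun x => (@?a x <= @?b x)%R) =>
      apply: measurable_fun_ler; meas
  | |- measurable_fun _ (fun x => (@?a x)%:E) =>
      apply: measurable_fun_EFin; meas
  | |- measurable_fun _ (fun x => (@?a x * @?b x)%E) =>
      apply: emeasurable_funM; meas
  | |- measurable_fun _ (fun x => ((@?a x) `^ _)%E) =>
      apply: measurable_fun_poweR; meas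
  | |- measurable_fun _ (fun x => Num.sqrt (@?a x)) =>
      apply: measurable_fun_sqrt; meas
  | |- measurable_fun _ (fun x => powR (@?a x) _) =>
      apply: measurable_fun_powR; meas
  | |- measurable_fun _ (fun x => (@?a x * @?b x)%R) =>
      apply: measurable_funM; meas
  | |- measurable_fun _ (fun x => (- @?a x)%R) =>
      apply: measurable_fun_oppr; meas
  | |- measurable_fun _ (fun x => @GRing.add _ (@?a x) (@?b x)) =>
      first [apply: measurable_funD | apply: emeasurable_funD]; meas
  | |- measurable_fun _ (fun x => (@?a x ^+ _)%R) =>
      apply: measurable_funX; meas
  | |- measurable_fun _ (fun x => `|@?a x|%R) =>
      apply: measurable_fun_normr; meas
  | |- measurable_fun ?D (fun x => ?f x) =>
      refine (_ : measurable_fun D f); assumption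
  | |- measurable_fun _ (fun x => ?f (@?a x, @?b x)) =>
      apply: (@measurable_fun_comp2 _ _ _ _ _ f); meas
  | |- measurable_fun _ (fun x => ?f (@?a x)) =>
      apply: (@measurable_fun_comp1 _ _ _ _ _ f); meas
  | |- measurable_fun _ (fun x => if _ then _ else _) =>
      apply: measurable_fun_ifT; meas
  | |- _ => idtac
  end].

Section lebesgue.
Context {R : realType}.

(* The library puts Lebesgue measure on the alias [measurableTypeR R] of [R]. *)
Definition leb (A : set R) : \bar R := @lebesgue_measure R A.

Let leb0 : leb set0 = 0%E. Proof. exact: measure0. Qed.

Let leb_ge0 A : (0 <= leb A)%E. Proof. exact: measure_ge0. Qed.

Let leb_sigma_additive : semi_sigma_additive leb.
Proof. exact: (@measure_semi_sigma_additive _ _ _ (@lebesgue_measure R)). Qed.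

HB.instance Definition _ :=
  isMeasure.Build _ _ _ leb leb0 leb_ge0 leb_sigma_additive.

Let leb_sigma_finite : sigma_finite setT leb.
Proof. exact: (@sigma_finiteT _ _ _ (@lebesgue_measure R)). Qed.

HB.instance Definition _ := Measure_isSigmaFinite.Build _ _ _ leb leb_sigma_finite.

Let measurable_unalias : measurable_fun setT (fun x : measurableTypeR R => (x : R)).
Proof. by move=> _ Y mY; rewrite setTI. Qed.

Lemma ge0_integral_leb (f : R -> \bar R) : measurable_fun setT f ->
  (forall x, 0 <= f x)%E ->
  (\int[leb]_x f x = \int[lebesgue_measure]_x f x)%E.
Proof.
move=> mf f0.
have := @ge0_integral_pushforward _ _ _ _ _ _ measurable_unalias
  (@lebesgue_measure R) setT f.
by rewrite preimage_setT => <-.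
Qed.

Lemma integral_leb (f : R -> \bar R) : measurable_fun setT f ->
  (\int[leb]_x f x = \int[lebesgue_measure]_x f x)%E.
Proof.
move=> mf; rewrite integralE [RHS]integralE.
by rewrite !ge0_integral_leb//; [exact: measurable_funeneg|exact: measurable_funepos].
Qed.

Lemma integral_leb_affine (a c : R) (f : R -> \bar R) : 0 < a ->
  measurable_fun setT f -> (forall x, 0 <= f x)%E ->
  (\int[leb]_x f x = a%:E * \int[leb]_x f (a * x + c)%R)%E.
Proof.
move=> a0 mf f0.
rewrite (ge0_integral_leb mf f0).
have D (x : R) : is_derive x (1 : R) (fun x => a * x + c) a.
  by apply: is_derive_eq; rewrite addr0 /GRing.scale/= mulr1.
have K : cancel (fun y => (y - c) / a) (fun x => a * x + c).
  by move=> y /=; rewrite mulrC divfK ?gt_eqF// subrK.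
have homo : {homo (fun x => a * x + c) : x y / x < y}.
  by move=> x y xy; rewrite ltrD2r ltr_pM2l.
rewrite (@ge0_integral_substitution _ _ _ (fun=> a) K homo D)//; last 2 first.
- by move=> x; exact: cvg_cst.
- by move=> x; exact: ltW.
rewrite -ge0_integral_leb; last 2 first.
- by apply: emeasurable_funM => //; apply: measurable_fun_comp1 => //; meas.
- by move=> x; rewrite mule_ge0// lee_fin ltW.
rewrite -ge0_integralZl//; last 2 first.
- by apply: measurable_fun_comp1 => //; meas.
- by rewrite lee_fin ltW.
by apply: eq_integral => x _; rewrite muleC.
Qed.

Lemma integral_leb_opp (f : R -> \bar R) :
  measurable_fun setT f -> (forall x, 0 <= f x)%E ->
  (\int[leb]_x f (- x)%R = \int[leb]_x f x)%E.
Proof.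
move=> mf f0.
rewrite ge0_integral_leb//; last by meas.
have moppr : measurable_fun setT (fun x : measurableTypeR R => (- x : R)).
  exact: (measurableT_comp (@oppr_measurable R setT) measurable_unalias).
have := @ge0_integral_pushforward _ _ _ _ _ _ moppr (@lebesgue_measure R) setT f.
rewrite preimage_setT => <-; [|exact: measurableT|exact: mf|by move=> x _; exact: f0].
apply: eq_measure_integral => A mA _; exact: lebesgue_measureN.
Qed.

End lebesgue.

Section square_substitution.
Context {R : realType}.

(** The function [z * |z|] is an increasing [C^1] bijection of the whole line that equals [z ^ 2]
    for [z > 0]; through it the substitution [t = z ^ 2] becomes a case of the substitution on the
    whole line. *)
Lemma is_derive_mulr_norm (x : R) :
  is_derive x (1 : R) (fun z => z * `|z|) (2 * `|x|).
Proof.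
have [x0|x0|->] := ltgtP x 0.
- have D : is_derive x (1 : R) (fun z : R => - (z * z)) (2 * `|x|).
    by apply: is_derive_eq; rewrite /GRing.scale/= ltr0_norm//; ring.
  apply: (near_eq_is_derive _ D).
  near=> z; rewrite ltr0_norm ?mulrN//.
  by near: z; exact: lt_nbhsl.
- have D : is_derive x (1 : R) (fun z : R => z * z) (2 * `|x|).
    by apply: is_derive_eq; rewrite /GRing.scale/= gtr0_norm//; ring.
  apply: (near_eq_is_derive _ D).
  near=> z; rewrite gtr0_norm//.
  by near: z; exact: lt_nbhsr.
(* At [0] the difference quotient is [|z|]. *)
- rewrite normr0 mulr0.
  have h : (fun h : R => h^-1 *: (((fun z : R => z * `|z|) \o shift 0) (h *: (1 : R)) -
      0 * `|0 : R|)) @ 0^' --> (0 : R).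
    apply: cvg_trans (_ : (fun z : R => `|z|) @ (0 : R)^' --> (0 : R)).
      apply: near_eq_cvg; near=> z.
      rewrite /= /GRing.scale/= mulr1 addr0 mul0r subr0 mulrA mulVf ?mul1r//.
      by near: z; exact: nbhs_dnbhs_neq.
    apply: cvg_within_filter; have := @norm_continuous R R (0 : R).
    by rewrite /continuous_at normr0.
  by apply: DeriveDef; [apply/cvg_ex; exists 0|exact/cvg_lim].
Unshelve. all: by end_near. Qed.

Lemma integral_leb_square (f : R -> \bar R) : measurable_fun setT f ->
  (forall x, 0 <= f x)%E ->
  (\int[leb]_t (if (0 < t)%R then f t else 0) =
   \int[leb]_z (if (0 < z)%R then f (z ^+ 2)%R * (2 * z)%:E else 0))%E.
Proof.
move=> mf f0.
pose psi (t : R) := if 0 <= t then Num.sqrt t else - Num.sqrt (- t).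
have K : cancel psi (fun z => z * `|z|).
  move=> t; rewrite /psi; case: ifPn => t0.
    by rewrite ger0_norm ?sqrtr_ge0// -expr2 sqr_sqrtr.
  rewrite normrN ger0_norm ?sqrtr_ge0// mulNr -expr2 sqr_sqrtr ?opprK//.
  by rewrite oppr_ge0 ltW// ltNge.
have homo : {homo (fun z : R => z * `|z|) : x y / x < y}.
  move=> x y xy; have [y0|y0] := leP y 0.
    have x0 : x < 0 by exact: lt_le_trans y0.
    rewrite ltr0_norm// ler0_norm//; nra.
  rewrite (gtr0_norm y0); have [x0|x0] := leP 0 x.
    by rewrite (ger0_norm x0); nra.
  by rewrite (ltr0_norm x0); nra.
have mF : measurable_fun setT (fun t : R => if 0 < t then f t else 0%E) by meas.
rewrite ge0_integral_leb//; last by move=> x; case: ifP.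
have cont : continuous (fun x : R => 2 * `|x|).
  by move=> x; apply: cvgM; [exact: cvg_cst|exact: norm_continuous].
have ge0 (x : R) : 0 <= 2 * `|x| by rewrite mulr_ge0.
have F0 (x : R) : (0 <= (if (0 < x)%R then f x else 0))%E by case: ifP.
rewrite (@ge0_integral_substitution _ _ _ _ K homo is_derive_mulr_norm cont ge0 _ mF F0).
rewrite -ge0_integral_leb; last 2 first.
- apply: emeasurable_funM; last by meas.
  by apply: (@measurable_fun_comp1 _ _ _ _ _ (fun t : R => if 0 < t then f t else 0%E)) => //; meas.
- by move=> x; rewrite mule_ge0// lee_fin.
apply: eq_integral => z _; have [z0|z0] := ltP 0 z.
  by rewrite gtr0_norm// mulr_gt0// expr2.
case: ifPn => [|_]; last by rewrite mul0e.
by rewrite ltNge mulr_le0_ge0.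
Qed.

End square_substitution.

(** * Half-line and angular measures *)

Section half_plane.
Context {R : realType}.
Implicit Types n x y z u v : R.

(* With [n = 2 nu + 1], [half n] is the Dunkl measure on the positive half-line
   up to a constant, and [ang n] the even part of the weight of the Dunkl
   translation; [rho x y u] is the paper's [rho_u]. *)
Definition half_weight n y : R := if 0 < y then y `^ n else 0.

Lemma half_weight_ge0 n y : 0 <= half_weight n y.
Proof. by rewrite /half_weight; case: ifP; rewrite ?powR_ge0. Qed.

Lemma measurable_half_weight n : measurable_fun setT (half_weight n).
Proof. by rewrite /half_weight; meas. Qed.

Definition half n : {sigma_finite_measure set R -> \bar R} :=
  density leb (measurable_half_weight n) (half_weight_ge0 n).

Definition ang_weight n u : R :=
  if 0 < 1 - u ^+ 2 then (1 - u ^+ 2) `^ (n / 2 - 1) else 0.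

Lemma ang_weight_ge0 n u : 0 <= ang_weight n u.
Proof. by rewrite /ang_weight; case: ifP; rewrite ?powR_ge0. Qed.

Lemma measurable_ang_weight n : measurable_fun setT (ang_weight n).
Proof. by rewrite /ang_weight; meas. Qed.

Definition ang n : {sigma_finite_measure set R -> \bar R} :=
  density leb (measurable_ang_weight n) (ang_weight_ge0 n).

Definition rho x y u : R := Num.sqrt (x ^+ 2 + y ^+ 2 + 2 * x * y * u).

Lemma rho_ge0 x y u : 0 <= rho x y u.
Proof. exact: sqrtr_ge0. Qed.

Lemma measurable_rho d (T : measurableType d) (a b c : T -> R) :
  measurable_fun setT a -> measurable_fun setT b -> measurable_fun setT c ->
  measurable_fun setT (fun t => rho (a t) (b t) (c t)).
Proof. by move=> ma mb mc; rewrite /rho; meas. Qed.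

(* Up to the factor depending on [x], the power of sixteen times the squared
   area of the triangle with sides [x], [y], [z]: polar coordinates around the
   two ends of the side [x] are exchanged by the symmetry in [y] and [z]. *)
Definition triangle_kernel n x y z : R :=
  let Q := ((x + y) ^+ 2 - z ^+ 2) * (z ^+ 2 - (x - y) ^+ 2) in
  if (0 < y) && ((0 < z) && (0 < Q)) then
    x^-1 * (2 * x) `^ (2 - n) * (y * z * Q `^ (n / 2 - 1)) else 0.

Lemma triangle_kernel_ge0 n x y z : 0 < x -> 0 <= triangle_kernel n x y z.
Proof.
move=> x0; rewrite /triangle_kernel; case: ifP => // /and3P[y0 z0 _].
by rewrite !mulr_ge0 ?powR_ge0// ?invr_ge0 ltW.
Qed.

Lemma triangle_kernelC n x y z : triangle_kernel n x y z = triangle_kernel n x z y.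
Proof.
rewrite /triangle_kernel andbCA [z * y]mulrC.
suff -> : ((x + y) ^+ 2 - z ^+ 2) * (z ^+ 2 - (x - y) ^+ 2) =
  ((x + z) ^+ 2 - y ^+ 2) * (y ^+ 2 - (x - z) ^+ 2) by [].
ring.
Qed.

(** By the law of cosines [u = (z ^ 2 - x ^ 2 - y ^ 2) / (2 x y)], so [1 - u ^ 2 = Q / (2 x y) ^ 2]
    and [du = 2 z dz / (2 x y)]. The power [y ^ n] of the half-line weight is absorbed by
    [(2 x y) ^ (2 - n)], which leaves a kernel symmetric in [y] and [z]. *)
Lemma ang_weight_triangle n x y z : 0 < x -> 0 < y -> 0 < z ->
  (2 * x * y)^-1 * half_weight n y *
    (ang_weight n ((z ^+ 2 - (x ^+ 2 + y ^+ 2)) / (2 * x * y)) * (2 * z)) =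
  triangle_kernel n x y z.
Proof.
move=> x0 y0 z0; rewrite /half_weight y0 /ang_weight /triangle_kernel y0 z0/=.
set Q := _ * (_ - (x - y) ^+ 2).
have xy0 : 0 < 2 * x * y by rewrite !mulr_gt0.
have -> : 1 - ((z ^+ 2 - (x ^+ 2 + y ^+ 2)) / (2 * x * y)) ^+ 2 =
    Q * ((2 * x * y) ^+ 2)^-1.
  by rewrite /Q; field; rewrite !gt_eqF.
rewrite pmulr_lgt0 ?invr_gt0 ?exprn_gt0//; case: ifPn => [Q0|_]; last first.
  by rewrite mul0r mulr0.
rewrite (@powRM _ Q) ?(ltW Q0)// ?invr_ge0 ?exprn_ge0 ?(ltW xy0)//.
have -> : ((2 * x * y) ^+ 2)^-1 `^ (n / 2 - 1) = (2 * x * y) `^ (2 - n).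
  rewrite -powR_inv1 ?exprn_ge0 ?(ltW xy0)// -powR_mulrn ?(ltW xy0)// -!powRrM.
  by congr (_ `^ _); field.
rewrite (@powRM _ (2 * x)) ?mulr_ge0 ?(ltW x0) ?(ltW y0)//.
have -> : y `^ (2 - n) = y ^+ 2 / y `^ n.
  by rewrite powRB ?powR_mulrn ?(ltW y0)// (gt_eqF y0) implybT.
by field; rewrite !gt_eqF// powR_gt0.
Qed.

Local Open Scope ereal_scope.

Lemma integral_half n (f : R -> \bar R) : measurable_fun setT f ->
  (forall x, 0 <= f x) ->
  \int[half n]_y f y = \int[leb]_y (f y * (half_weight n y)%:E).
Proof. by move=> mf f0; rewrite integral_density. Qed.

Lemma integral_ang n (f : R -> \bar R) : measurable_fun setT f ->
  (forall x, 0 <= f x) ->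
  \int[ang n]_y f y = \int[leb]_y (f y * (ang_weight n y)%:E).
Proof. by move=> mf f0; rewrite integral_density. Qed.

Lemma integral_ang_rho n x y (f : R -> \bar R) : (0 < x)%R -> (0 < y)%R ->
  measurable_fun setT f -> (forall t, 0 <= f t) ->
  (\int[ang n]_u f (rho x y u)) * (half_weight n y)%:E =
  \int[leb]_z (f z * (triangle_kernel n x y z)%:E).
Proof.
move=> x0 y0 mf f0.
have xy0 : (0 < 2 * x * y)%R by rewrite !mulr_gt0.
rewrite integral_ang//; last first.
  by apply: measurable_fun_comp1 => //; apply: measurable_rho; meas.
pose g t := f (Num.sqrt t) *
  (ang_weight n ((t - (x ^+ 2 + y ^+ 2)) / (2 * x * y)))%:E.
have mg : measurable_fun setT g.
  by rewrite /g; have mw := measurable_ang_weight n; meas.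
have g0 t : 0 <= g t by rewrite mule_ge0// lee_fin ang_weight_ge0.
(* For [t <= 0] the corresponding cosine is at most [-1], where the angular weight vanishes; so only
   [t > 0] counts and [t = z ^ 2] may be substituted. *)
have gE t : g t = if (0 < t)%R then g t else 0.
  case: ifPn => //; rewrite -leNgt => t0; rewrite /g /ang_weight.
  rewrite ifF ?mule0//; apply/negbTE; rewrite -leNgt subr_le0.
  have h : (1 <= - ((t - (x ^+ 2 + y ^+ 2)) / (2 * x * y)))%R.
    rewrite -mulNr ler_pdivlMr// mul1r.
    by have := sqr_ge0 (x - y)%R; nra.
  by rewrite -sqrrN; nra.
have := integral_leb_affine (x ^+ 2 + y ^+ 2) xy0 mg g0.
under [X in _ = _ * X]eq_integral.
  move=> u _; rewrite /g addrK [(2 * x * y * u / _)%R]mulrC mulKf ?gt_eqF//.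
  rewrite [(2 * x * y * u + _)%R]addrC -/(rho x y u); over.
move=> h; have {h}-> : \int[leb]_u (f (rho x y u) * (ang_weight n u)%:E) =
    ((2 * x * y)^-1)%:E * \int[leb]_t g t.
  by rewrite h muleA -EFinM mulVf ?mul1e// gt_eqF.
under eq_integral do rewrite gE.
rewrite integral_leb_square// muleAC -EFinM -ge0_integralZl//; last 3 first.
- by meas.
- by move=> t _; case: ifPn => // t0; rewrite mule_ge0// lee_fin mulr_ge0// ltW.
- by rewrite lee_fin mulr_ge0// ?half_weight_ge0// invr_ge0 ltW.
apply: eq_integral => z _; case: ifPn => z0; last first.
  by rewrite mule0 /triangle_kernel (negbTE z0) andbF mule0.
rewrite -(ang_weight_triangle n x0 y0 z0) /g sqrtr_sqr gtr0_norm//.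
by rewrite -muleA -EFinM muleCA -EFinM.
Qed.

Section swap.
Variables (n x : R) (f : R * R -> \bar R).
Hypothesis x0 : (0 < x)%R.
Hypothesis mf : measurable_fun setT f.
Hypothesis f0 : forall p, 0 <= f p.

Lemma integral_half_ang_triangle :
  \int[half n]_y \int[ang n]_u f (y, rho x y u) =
  \int[leb]_y \int[leb]_z (f (y, z) * (triangle_kernel n x y z)%:E).
Proof.
rewrite integral_half; last 2 first.
- apply: (measurable_fun_fubini_tonelli_F (fun p : R * R => f (p.1, rho x p.1 p.2))) => //.
  by apply: measurable_fun_comp2 => //; apply: measurable_rho; meas.
- by move=> y; exact: integral_ge0.
apply: eq_integral => y _; have [y0|y0] := ltP 0%R y.
  rewrite (@integral_ang_rho n x y (fun z => f (y, z)))//.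
  by meas.
rewrite /half_weight ltNge y0/= mule0 integral0_eq// => z _.
by rewrite /triangle_kernel ltNge y0/= mule0.
Qed.

End swap.

(** Both sides are the integral of [f] against [triangle_kernel], which is symmetric in its last two
    arguments; Tonelli's theorem exchanges the order. Every change of roles between [y] and [rho]
    goes through this identity. *)
Lemma integral_half_ang_swap n x (f : R * R -> \bar R) : (0 < x)%R ->
  measurable_fun setT f -> (forall p, 0 <= f p) ->
  \int[half n]_y \int[ang n]_u f (y, rho x y u) =
  \int[half n]_z \int[ang n]_v f (rho x z v, z).
Proof.
move=> x0 mf f0; rewrite (integral_half_ang_triangle n x0 mf f0).
have mg : measurable_fun setT (fun p : R * R => f (p.2, p.1)) by meas.
rewrite (integral_half_ang_triangle n x0 mg (fun p => f0 _)).
have mF : measurable_fun setT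
    (fun p : R * R => f p * (triangle_kernel n x p.1 p.2)%:E).
  by rewrite /triangle_kernel; meas.
have F0 p : 0 <= f p * (triangle_kernel n x p.1 p.2)%:E.
  by rewrite mule_ge0// lee_fin triangle_kernel_ge0.
have := @fubini_tonelli _ _ R R R leb leb _ mF F0.
move=> /= ->.
by do 2 (apply: eq_integral => ? _); rewrite triangle_kernelC.
Qed.

End half_plane.

(** * Angular and half-line measures of balls *)

Section volumes.
Context {R : realType}.
Implicit Types n x y z u v r c e m : R.
Local Open Scope ereal_scope.

Lemma integral_ge0_le d (T : measurableType d) (mu : {measure set T -> \bar R})
    (f g : T -> \bar R) :
  measurable_fun setT f -> measurable_fun setT g ->
  (forall t, 0 <= f t) -> (forall t, f t <= g t) ->
  \int[mu]_t f t <= \int[mu]_t g t.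
Proof. by move=> mf mg f0 fg; apply: ge0_le_integral. Qed.

Lemma integral_leb_ball c r : (0 < r)%R ->
  \int[leb]_x (if (`|x - c| < r)%R then 1 else 0 : \bar R) = (2 * r)%:E.
Proof.
move=> r0.
rewrite (_ : (fun x => _) = EFin \o \1_(ball c r)); last first.
  apply/funext => x /=; rewrite indicE -ball_normE.
  case: ifPn => h; first by rewrite mem_set//= /ball_/= distrC.
  by rewrite memNset//= /ball_/= distrC; exact/negP.
rewrite integral_indic ?setIT//; last exact: measurable_ball.
rewrite mulr_natl; exact: (lebesgue_measure_ball c (ltW r0)).
Qed.

(** The factors by which the two shell estimates multiply [A] and the power of [dl]. *)
Definition small_const m e : R := (2 `^ `|e - m| / (1 - 2 `^ (- e)))%R.
Definition large_const m e : R := (2 `^ `|- m - e| / (1 - 2 `^ (- e)))%R.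

Lemma small_const_gt0 m e : (0 < e)%R -> (0 < small_const m e)%R.
Proof. by move=> e0; rewrite divr_gt0 ?powR_gt0// subr_gt0 powR2N_lt1. Qed.

Lemma large_const_gt0 m e : (0 < e)%R -> (0 < large_const m e)%R.
Proof. by move=> e0; rewrite divr_gt0 ?powR_gt0// subr_gt0 powR2N_lt1. Qed.

Lemma integral_leb_power c e r : (0 < e)%R -> (0 < r)%R ->
  \int[leb]_x (if (0 < `|x - c| < r)%R then (`|x - c| `^ (e - 1))%:E else 0) <=
  (small_const 1 e * 2 * r `^ e)%:E.
Proof.
move=> e0 r0.
have mr : measurable_fun setT (fun x => `|x - c|)%R by meas.
have ball1 s : (0 < s)%R ->
    \int[leb]_x (if (`|x - c| < s)%R then 1 else 0) <= (2 * s `^ 1)%:E.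
  by move=> s0; rewrite integral_leb_ball// powRr1// ltW.
have := @integral_small_shells _ _ _ leb (fun x => `|x - c|)%R (cst 1) 2 1 mr
  (measurable_cst _) (fun _ => lee01) (ler0n _ _) ball1 e r e0 r0.
rewrite -/(small_const 1 e).
by under eq_integral do rewrite mule1.
Qed.

Lemma ang_weight0 n v : (1 - v ^+ 2 <= 0)%R -> ang_weight n v = 0%R.
Proof. by move=> v1; rewrite /ang_weight ltNge v1. Qed.

Lemma ang_weight_le n v : (0 < 1 - v ^+ 2)%R ->
  (ang_weight n v <= 2 `^ `|n / 2 - 1| * (1 - `|v|) `^ (n / 2 - 1))%R.
Proof.
move=> v1; rewrite /ang_weight v1.
have -> : (1 - v ^+ 2 = (1 + `|v|) * (1 - `|v|))%R.
  by rewrite -(real_normK (num_real v)); ring.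
have v2 : (`|v| < 1)%R.
  rewrite -(expr_lt1 (n := 2))// real_normK ?num_real//; lra.
rewrite powRM ?subr_ge0 ?addr_ge0 ?(ltW v2)//.
rewrite ler_wpM2r ?powR_ge0//; have v0 := normr_ge0 v.
have := @powR_comparable R (n / 2 - 1) (1 + `|v|) 1 2.
by rewrite powR1 !mulr1; apply; lra.
Qed.

Definition ang_const n : R :=
  (2 `^ `|n / 2 - 1| * (small_const 1 (n / 2) * 2) * (1 + 1))%R.

Lemma ang_const_gt0 n : (0 < n)%R -> (0 < ang_const n)%R.
Proof.
move=> n0; have c0 : (0 < small_const 1 (n / 2))%R.
  by rewrite small_const_gt0// divr_gt0.
by do 2 (apply: mulr_gt0 => //); rewrite ?powR_gt0// mulr_gt0.
Qed.

(** A point of the support with [1 + v < m] is within [m] of the endpoint of its own sign: if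
    [v >= 0], then [1 - v <= 1 + v < m]. There the weight is at most a multiple of the distance to
    that endpoint to the power [n / 2 - 1]. The last factor of [ang_const] counts the two
    endpoints. *)
Lemma integral_ang_small n m : (0 < n)%R -> (0 < m)%R ->
  \int[ang n]_v (if (1 + v < m)%R then 1 else 0) <=
  (ang_const n * m `^ (n / 2))%:E.
Proof.
rewrite /ang_const => n0 m0; set e := (n / 2)%R; have e0 : (0 < e)%R by rewrite divr_gt0.
set K := (2 `^ `|e - 1|)%R; set c := (small_const 1 e * 2)%R.
have K0 : (0 <= K)%R by exact: powR_ge0.
have c0 : (0 < c)%R by rewrite mulr_gt0// small_const_gt0.
have mw := measurable_ang_weight n.
rewrite integral_ang; [|by meas|by move=> v; case: ifP].
pose G b r v : \bar R := if (0 < `|v - b| < r)%R then (`|v - b| `^ (e - 1))%:E else 0.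
have mG b r : measurable_fun setT (G b r) by rewrite /G; meas.
have G0 b r v : 0 <= G b r v by rewrite /G; case: ifP => // _; rewrite lee_fin powR_ge0.
have bound v : (if (1 + v < m)%R then 1 else 0) * (ang_weight n v)%:E <=
    K%:E * (G (-1)%R m v + G 1%R m v).
  have Gv b : 0 <= K%:E * G b m v by rewrite mule_ge0// lee_fin.
  have [v1|v1] := leP (1 - v ^+ 2)%R 0%R.
    by rewrite ang_weight0// mule0 ge0_muleDr// adde_ge0.
  case: ifPn => [vm|_]; last by rewrite mul0e ge0_muleDr// adde_ge0.
  rewrite mul1e ge0_muleDr//.
  have [v0|v0] := ltP v 0%R.
    apply: (@le_trans _ _ (K%:E * G (-1)%R m v)); last by rewrite leeDl.
    have v2 : (0 < 1 + v)%R by nra.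
    rewrite /G opprK (addrC v) (gtr0_norm v2) v2 vm/= lee_fin.
    by have := ang_weight_le n v1; rewrite (ltr0_norm v0) opprK.
  apply: (@le_trans _ _ (K%:E * G 1%R m v)); last by rewrite leeDr.
  have v2 : (0 < 1 - v)%R by nra.
  rewrite /G distrC (gtr0_norm v2) v2/=.
  have v3 : (1 - v < m)%R.
    lra.
  rewrite v3.
  by have := ang_weight_le n v1; rewrite (ger0_norm v0).
apply: (le_trans (integral_ge0_le _ _ _ _ bound)).
- by meas.
- by apply: emeasurable_funM => //; exact: emeasurable_funD.
- by move=> v; rewrite mule_ge0 ?lee_fin ?ang_weight_ge0//; case: ifP.
have mS : measurable_fun setT (fun v => G (-1)%R m v + G 1%R m v).
  exact: emeasurable_funD.
rewrite ge0_integralZl ?lee_fin//; last by move=> v _; rewrite adde_ge0.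
rewrite ge0_integralD//.
apply: (@le_trans _ _ (K%:E * ((c * m `^ e)%:E + (c * m `^ e)%:E))).
  by rewrite lee_wpmul2l ?lee_fin// leeD//; exact: integral_leb_power.
by rewrite -EFinD -EFinM lee_fin; lra.
Qed.

Lemma integral_ang1 n : (0 < n)%R ->
  exists2 C, (0 < C)%R & \int[ang n]_v 1 <= C%:E.
Proof.
move=> n0; exists (ang_const n * 2 `^ (n / 2))%R.
  by rewrite mulr_gt0 ?powR_gt0 ?ang_const_gt0.
apply: le_trans (integral_ang_small n0 (ltr0n _ 2)).
rewrite !integral_ang//; last 2 first.
- by meas.
- by move=> v; case: ifP.
have mw := measurable_ang_weight n.
apply: integral_ge0_le; [by meas|by meas| |].
- by move=> v; rewrite mul1e lee_fin ang_weight_ge0.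
- move=> v; case: ifPn => //; rewrite -leNgt => v2.
  by rewrite ang_weight0 ?mule0//; nra.
Qed.

Lemma rho_lt x y u r : (0 < r)%R ->
  (rho x y u < r)%R = (x ^+ 2 + y ^+ 2 + 2 * x * y * u < r ^+ 2)%R.
Proof.
move=> r0; rewrite /rho -{1}(ger0_norm (ltW r0)) -sqrtr_sqr ltr_sqrt//.
by rewrite exprn_gt0.
Qed.

Lemma measurable_rho_lt x z r : measurable_fun setT (fun v => (rho x z v < r)%R).
Proof. by apply: measurable_fun_ltr => //; apply: measurable_rho; meas. Qed.

(** Since [rho >= |z - x|] on the support, nothing is left unless [|z - x| < r]. If [x <= 2 r], then
    [r / (x + r) >= 1 / 3] and the total mass suffices. If [x > 2 r], then [x <= 2 z], and [rho ^ 2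
    = (z - x) ^ 2 + 2 x z (1 + v) < r ^ 2] forces [1 + v < (r / x) ^ 2]. *)
Lemma integral_ang_ball_le n : (0 < n)%R -> exists2 C, (0 < C)%R &
  forall x z r, (0 < x)%R -> (0 < z)%R -> (0 < r)%R ->
    \int[ang n]_v (if (rho x z v < r)%R then 1 else 0) <=
    (if (`|z - x| < r)%R then C * (r / (x + r)) `^ n else 0)%:E.
Proof.
move=> n0; have [C1 C10 tot] := integral_ang1 n0.
move: (ang_const_gt0 n0) (fun m => @integral_ang_small n m n0).
move: (ang_const n) => C2 C20 small.
exists ((C1 + C2) * 3 `^ n)%R; first by rewrite mulr_gt0 ?powR_gt0// addr_gt0.
move=> x z r x0 z0 r0.
have mb := measurable_rho_lt x z r; have mw := measurable_ang_weight n.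
case: ifPn => [zx|]; last first.
  rewrite -leNgt => zx; rewrite integral_ang; [|by meas|by move=> v; case: ifP].
  rewrite integral0_eq// => v _; case: ifPn; rewrite ?mul0e// rho_lt// => h.
  rewrite ang_weight0 ?mule0//.
  have : (r ^+ 2 <= (z - x) ^+ 2)%R.
    by rewrite -[leRHS]real_normK ?num_real// ler_pXn2r// nnegrE// ltW.
  have xz : (0 < x * z)%R by exact: mulr_gt0.
  move=> h2; have : (x * z * (1 + v) < 0)%R by nra.
  by rewrite pmulr_rlt0// => h3; nra.
have rxr : (0 <= r / (x + r))%R by rewrite divr_ge0 ?addr_ge0// ltW.
have [xr|xr] := leP x (2 * r)%R.
  apply: (@le_trans _ _ C1%:E).
    apply: le_trans tot; apply: integral_ge0_le; [by meas|by meas| |].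
    - by move=> v; case: ifP.
    - by move=> v; case: ifP.
  rewrite lee_fin -mulrA -powRM//.
  rewrite (@le_trans _ _ ((C1 + C2) * 1)%R)//; first by rewrite mulr1 lerDl ltW.
  rewrite ler_wpM2l ?addr_ge0 ?(ltW C10) ?(ltW C20)//.
  rewrite powR_ge1 ?(ltW n0)//.
  by rewrite mulrA ler_pdivlMr ?addr_gt0// mul1r; lra.
have zx2 : (x <= 2 * z)%R by move: zx; rewrite ltr_norml => /andP[]; lra.
have m0 : (0 < (r / x) ^+ 2)%R by rewrite exprn_gt0// divr_gt0.
apply: (@le_trans _ _ (C2 * ((r / x) ^+ 2) `^ (n / 2))%:E).
  apply: le_trans (small _ m0).
  rewrite !integral_ang; [|by meas|by move=> v; case: ifP|by meas|by move=> v; case: ifP].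
  apply: integral_ge0_le; [by meas|by meas| |].
    by move=> v; rewrite mule_ge0 ?lee_fin ?ang_weight_ge0//; case: ifP.
  move=> v; rewrite rho_lt//; case: ifPn => h; last first.
    by rewrite mul0e mule_ge0 ?lee_fin ?ang_weight_ge0//; case: ifP.
  case: ifPn => //; rewrite -leNgt => h2.
  rewrite ang_weight0 ?mule0//.
  move: h2; rewrite expr_div_n ler_pdivrMr ?exprn_gt0// => h2.
  have h3 : ((z - x) ^+ 2 + 2 * x * z * (1 + v) < r ^+ 2)%R by nra.
  have h4 : (x ^+ 2 <= 2 * x * z)%R by nra.
  have h5 := sqr_ge0 (z - x)%R.
  have [v1|v1] := leP (1 + v)%R 0%R; first nra.
  have : (x ^+ 2 * (1 + v) <= 2 * x * z * (1 + v))%R by rewrite ler_wpM2r// ltW.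
  lra.
rewrite lee_fin -powR_mulrn ?divr_ge0 ?(ltW r0) ?(ltW x0)// -powRrM.
rewrite (_ : 2%:R * (n / 2) = n)%R; last by field.
rewrite -mulrA -powRM//; apply: ler_pM; rewrite ?powR_ge0 ?(ltW C20) ?lerDr ?(ltW C10)//.
have rx0 : (0 <= r / x)%R by rewrite divr_ge0// ltW.
apply: ge0_ler_powR; [exact: ltW|by rewrite nnegrE|by rewrite nnegrE mulr_ge0|].
by rewrite mulrA ler_pdivrMr// mulrAC ler_pdivlMr ?addr_gt0//; nra.
Qed.

Lemma ang_weight_ge n v m : (0 < m <= 1)%R -> (m / 2 <= 1 + v <= m)%R ->
  (2 `^ (- `|n / 2 - 1|) * 2 `^ (- `|n / 2 - 1|) * m `^ (n / 2 - 1) <=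
  ang_weight n v)%R.
Proof.
move=> /andP[m0 m1] /andP[v1 v2].
have v3 : (0 < 1 - v ^+ 2)%R by nra.
have v4 : (1 <= 1 - v)%R by lra.
rewrite /ang_weight v3 (_ : 1 - v ^+ 2 = (1 - v) * (1 + v))%R; last by ring.
have v5 : (0 < 1 + v)%R by lra.
rewrite powRM ?(ltW v5) ?(le_trans ler01)// -[leLHS]mulrA.
have K (y y' : R) : (0 < y)%R -> (0 < y')%R -> (y <= 2 * y')%R -> (y' <= 2 * y)%R ->
    (2 `^ (- `|n / 2 - 1|) * y `^ (n / 2 - 1) <= y' `^ (n / 2 - 1))%R.
  move=> y0 y'0 yy' y'y; rewrite powRN ler_pdivrMl ?powR_gt0//.
  by apply: powR_comparable; rewrite ?ler1n.
apply: ler_pM; rewrite ?mulr_ge0 ?powR_ge0//; last by apply: K; lra.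
by have := K 1%R (1 - v)%R; rewrite powR1 !mulr1; apply; lra.
Qed.

(** With [m = (r / (x + r)) ^ 2], an interval of length [m / 2] on which [m / 2 <= 1 + v <= m] is
    enough: [x z <= (x + r) ^ 2] gives [m x z <= r ^ 2], so [rho ^ 2 < 3 r ^ 2] there. The
    restriction [v <= 0] is kept for [disc_lower], where it becomes a sign condition on a cosine. *)
Lemma integral_ang_ball_ge n : (0 < n)%R -> exists2 c, (0 < c)%R &
  forall x z r, (0 < x)%R -> (0 < z)%R -> (0 < r)%R -> (`|z - x| < r)%R ->
    (c * (r / (x + r)) `^ n)%:E <=
    \int[ang n]_v (if (rho x z v < 2 * r)%R && (v <= 0)%R then 1 else 0).
Proof.
move=> n0; pose k := (2 `^ (- `|n / 2 - 1|) * 2 `^ (- `|n / 2 - 1|) : R)%R.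
have k0 : (0 < k)%R by rewrite mulr_gt0 ?powR_gt0.
exists (k / 2)%R; first by rewrite divr_gt0.
move=> x z r x0 z0 r0 zx.
have mb := measurable_rho_lt x z (2 * r)%R; have mw := measurable_ang_weight n.
have xz0 : (0 < x * z)%R by rewrite mulr_gt0.
have xr0 : (0 < x + r)%R by rewrite addr_gt0.
have xzr : (x * z <= (x + r) ^+ 2)%R.
  by move: zx; rewrite ltr_norml => /andP[_ h]; nra.
set m := ((r / (x + r)) ^+ 2)%R.
have m0 : (0 < m)%R by rewrite exprn_gt0// divr_gt0.
have m1 : (m <= 1)%R.
  by rewrite exprn_ile1// ?divr_ge0 ?(ltW r0) ?(ltW xr0)// ler_pdivrMr// mul1r lerDr ltW.
have mxz : (m * (x * z) <= r ^+ 2)%R.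
  rewrite /m expr_div_n mulrAC ler_pdivrMr ?exprn_gt0//.
  by rewrite ler_wpM2l ?sqr_ge0.
have mb2 : measurable_fun setT (fun v : R => (`|v - (- 1 + m * (3 / 4))| < m / 4)%R).
  by apply: measurable_fun_ltr; meas.
apply: (@le_trans _ _ (\int[leb]_v ((k * m `^ (n / 2 - 1))%:E *
    (if (`|v - (- 1 + m * (3 / 4))| < m / 4)%R then 1 else 0)))).
  rewrite ge0_integralZl//; last 3 first.
  - by meas.
  - by move=> v _; case: ifP.
  - by rewrite lee_fin mulr_ge0 ?powR_ge0// ltW.
  rewrite integral_leb_ball ?divr_gt0// -EFinM lee_fin.
  rewrite (_ : k * m `^ (n / 2 - 1) * (2 * (m / 4)) = k / 2 * (m `^ (n / 2 - 1) * m))%R; last by field.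
  rewrite mulrC [(_ * m)%R]mulrC mulr_powRB1 ?(ltW m0) ?divr_gt0//.
  rewrite mulrC /m -powR_mulrn ?divr_ge0 ?(ltW r0) ?(ltW xr0)// -powRrM.
  by rewrite (_ : 2%:R * (n / 2) = n)%R//; field.
rewrite integral_ang; [|by meas|by move=> v; case: ifP].
apply: integral_ge0_le; [by meas|by meas| |].
  move=> v; rewrite mule_ge0 ?lee_fin ?mulr_ge0 ?powR_ge0 ?(ltW k0)//.
  by case: ifP.
move=> v; case: ifPn => h; last first.
  by rewrite mule0 mule_ge0 ?lee_fin ?ang_weight_ge0//; case: ifP.
move: h; rewrite ltr_norml => /andP[h1 h2].
have v0 : (v <= 0)%R by lra.
rewrite rho_lt ?mulr_gt0// v0 andbT ifT; last first.
  have h4 : (x * z * (1 + v) <= x * z * m)%R by rewrite ler_pM2l//; lra.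
  have h5 : ((z - x) ^+ 2 < r ^+ 2)%R.
    by rewrite -[ltLHS]real_normK ?num_real// ltr_pXn2r// nnegrE// ltW.
  nra.
rewrite mule1 mul1e lee_fin; apply: ang_weight_ge; first by rewrite m0.
by apply/andP; split; lra.
Qed.

Lemma half_weight_le n x y r : (0 < n)%R -> (`|y - x| < r)%R ->
  (half_weight n y <= (x + r) `^ n)%R.
Proof.
move=> n0 yx; rewrite /half_weight; case: ifPn => y0; last exact: powR_ge0.
move: yx; rewrite ltr_norml => /andP[_ h].
by apply: ge0_ler_powR; rewrite ?nnegrE; lra.
Qed.

Lemma integral_half_ball_le n x r : (0 < n)%R -> (0 < r)%R ->
  \int[half n]_y (if (`|y - x| < r)%R then 1 else 0) <=
  (2 * r * (x + r) `^ n)%:E.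
Proof.
move=> n0 r0; have mw := measurable_half_weight n.
have mb : measurable_fun setT (fun y => (`|y - x| < r)%R).
  by apply: measurable_fun_ltr; meas.
rewrite integral_half; [|by meas|by move=> v; case: ifP].
apply: (@le_trans _ _ (\int[leb]_y (((x + r) `^ n)%:E *
    (if (`|y - x| < r)%R then 1 else 0)))).
  apply: integral_ge0_le; [by meas|by meas| |].
  - by move=> v; rewrite mule_ge0 ?lee_fin ?half_weight_ge0//; case: ifP.
  - move=> v; case: ifPn => h; last by rewrite mul0e mule0.
    by rewrite mul1e mule1 lee_fin half_weight_le.
rewrite ge0_integralZl//; last 3 first.
- by meas.
- by move=> v _; case: ifP.
- by rewrite lee_fin powR_ge0.
by rewrite integral_leb_ball// -EFinM lee_fin mulrC.
Qed.

End volumes.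

(** * Morrey functions on the half-line *)

Section morrey_density.
Context {R : realType}.
Implicit Types n x y z u v r A k : R.
Local Open Scope ereal_scope.

Lemma integral_half_le n (f g : R -> \bar R) :
  measurable_fun setT f -> measurable_fun setT g ->
  (forall y, 0 <= f y) -> (forall y, 0 <= g y) ->
  (forall y, (0 < y)%R -> f y <= g y) ->
  \int[half n]_y f y <= \int[half n]_y g y.
Proof.
move=> mf mg f0 g0 fg; rewrite !integral_half//.
have mw := measurable_half_weight n.
apply: integral_ge0_le; [by meas|by meas| |].
- by move=> y; rewrite mule_ge0// lee_fin half_weight_ge0.
- move=> y; have [y0|y0] := ltP 0%R y.
    by rewrite lee_wpmul2r ?lee_fin ?half_weight_ge0// fg.
  by rewrite /half_weight ltNge y0 !mule0.
Qed.

Lemma integral_ang_le n (f g : R -> \bar R) :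
  measurable_fun setT f -> measurable_fun setT g ->
  (forall u, 0 <= f u) -> (forall u, 0 <= g u) ->
  (forall u, (0 < 1 - u ^+ 2)%R -> f u <= g u) ->
  \int[ang n]_u f u <= \int[ang n]_u g u.
Proof.
move=> mf mg f0 g0 fg; rewrite !integral_ang//.
have mw := measurable_ang_weight n.
apply: integral_ge0_le; [by meas|by meas| |].
- by move=> y; rewrite mule_ge0// lee_fin ang_weight_ge0.
- move=> y; have [y0|y0] := ltP 0%R (1 - y ^+ 2)%R.
    by rewrite lee_wpmul2r ?lee_fin ?ang_weight_ge0// fg.
  by rewrite ang_weight0// !mule0.
Qed.

Definition pol n := (half n \x ang n)%E.

Lemma integral_pol n (f : R * R -> \bar R) : measurable_fun setT f ->
  (forall p, 0 <= f p) ->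
  \int[pol n]_p f p = \int[half n]_y \int[ang n]_u f (y, u).
Proof. by move=> mf f0; rewrite fubini_tonelli1. Qed.

Lemma measurable_fun_ang n (f : R * R -> \bar R) : measurable_fun setT f ->
  (forall p, 0 <= f p) ->
  measurable_fun setT (fun y => \int[ang n]_u f (y, u)).
Proof. by move=> mf f0; exact: measurable_fun_fubini_tonelli_F. Qed.

Lemma integral_pol_le n (f g : R * R -> \bar R) :
  measurable_fun setT f -> measurable_fun setT g ->
  (forall p, 0 <= f p) -> (forall p, 0 <= g p) ->
  (forall y u, (0 < y)%R -> (0 < 1 - u ^+ 2)%R -> f (y, u) <= g (y, u)) ->
  \int[pol n]_p f p <= \int[pol n]_p g p.
Proof.
move=> mf mg f0 g0 fg; rewrite !integral_pol//; apply: integral_half_le.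
- exact: measurable_fun_ang.
- exact: measurable_fun_ang.
- by move=> y; exact: integral_ge0.
- by move=> y; exact: integral_ge0.
- move=> y y0; apply: integral_ang_le => //; [meas|meas|].
  by move=> u u1; exact: fg.
Qed.

Lemma measurable_rho_fst x : measurable_fun setT (fun p : R * R => rho x p.1 p.2).
Proof. by apply: measurable_rho; meas. Qed.

(** The quantity [r (x + r) ^ n] is the order of the volume of the ball, so [k] measures the decay
    of the means like [r ^ (- k)]. Multiplied by the weight [(r / (x + r)) ^ n] of a translation,
    the bound becomes [A r ^ (n + 1 - k)], free of [x]. *)
Definition morrey_density n A k (g : R -> \bar R) :=
  forall x r, (0 < x)%R -> (0 < r)%R ->
    \int[half n]_y (if (`|y - x| < r)%R then g y else 0) <=
    (A * r `^ (1 - k) * (x + r) `^ n)%:E.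

(** Integrating the angle first gives at most a multiple of [(r / (x + r)) ^ n] on [|y - x| < r],
    which cancels [(x + r) ^ n]. The result is a growth bound in [r] alone, as the shell estimates
    require. *)
Lemma morrey_density_disc n : (0 < n)%R -> exists2 C, (0 < C)%R &
  forall A k (g : R -> \bar R), (0 <= A)%R ->
    measurable_fun setT g -> (forall y, 0 <= g y) -> morrey_density n A k g ->
    forall x r, (0 < x)%R -> (0 < r)%R ->
    \int[pol n]_p (if (rho x p.1 p.2 < r)%R then g p.1 else 0) <=
    (C * A * r `^ (n + 1 - k))%:E.
Proof.
move=> n0; have [C C0 ballC] := integral_ang_ball_le n0.
exists C => // A k g A0 mg g0 gA x r x0 r0.
have mr := measurable_rho_fst x.
have mrx y : measurable_fun setT (fun u => rho x y u).
  by apply: measurable_rho; meas.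
have xr0 : (0 < x + r)%R by exact: addr_gt0.
rewrite integral_pol; [|by meas|by move=> p; case: ifP].
apply: (@le_trans _ _ (\int[half n]_y ((C * (r / (x + r)) `^ n)%:E *
    (if (`|y - x| < r)%R then g y else 0)))).
  apply: integral_half_le.
  - apply: (measurable_fun_ang _ (f := fun p : R * R => if (rho x p.1 p.2 < r)%R then g p.1 else 0)).
      by meas.
    by move=> p; case: ifP.
  - by apply: emeasurable_funM; meas.
  - by move=> y; apply: integral_ge0 => u _; case: ifP.
  - move=> y; rewrite mule_ge0//; last by case: ifP.
    by rewrite lee_fin mulr_ge0 ?powR_ge0// ltW.
  - move=> y y0 /=.
    rewrite (eq_integral (fun u => g y * (if (rho x y u < r)%R then 1 else 0))); last first.
      by move=> u _; case: ifP; rewrite ?mule1 ?mule0.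
    rewrite ge0_integralZl//; last 2 first.
    - by meas.
    - by move=> u _; case: ifP.
    have := ballC x y r x0 y0 r0; case: ifPn => _ h.
      by rewrite muleC lee_wpmul2r.
    rewrite mule0; apply: le_trans (lee_wpmul2l (g0 y) h) _.
    by rewrite mule0.
rewrite ge0_integralZl//; last 3 first.
- by meas.
- by move=> y _; case: ifP.
- by rewrite lee_fin mulr_ge0 ?powR_ge0// ltW.
apply: (le_trans (lee_wpmul2l _ (gA x r x0 r0))).
  by rewrite lee_fin mulr_ge0 ?powR_ge0// ltW.
rewrite -EFinM lee_fin powRM ?invr_ge0 ?(ltW r0) ?(ltW xr0)//.
rewrite -powR_inv1 ?(ltW xr0)// powRAC powR_inv1 ?powR_ge0//.
have xrn : ((x + r) `^ n != 0)%R by rewrite gt_eqF// powR_gt0.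
have -> : (n + 1 - k = n + (1 - k))%R by ring.
rewrite powRD; last by rewrite (gt_eqF r0) implybT.
rewrite le_eqVlt; apply/orP; left; apply/eqP; field; exact: xrn.
Qed.

Lemma morrey_density1 n : (0 < n)%R -> morrey_density n 2 0 (cst 1).
Proof.
by move=> n0 x r x0 r0; rewrite subr0 powRr1 ?(ltW r0)//; exact: integral_half_ball_le.
Qed.

(** If [h > l], then [h = h ^ (1 - p) h ^ p <= l ^ (1 - p) h ^ p]. With a suitable level [l] this
    does the work of Hölder's inequality. *)
Lemma young_split (p h l : R) : (1 <= p)%R -> (0 <= h)%R -> (0 < l)%R ->
  (h <= l + l `^ (1 - p) * h `^ p)%R.
Proof.
move=> p1 h0 l0; have [hl|lh] := leP h l.
  by rewrite (le_trans hl)// lerDl mulr_ge0 ?powR_ge0.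
have hp : (0 < h)%R := lt_trans l0 lh.
rewrite (@le_trans _ _ (l `^ (1 - p) * h `^ p)%R)//; last by rewrite lerDr ltW.
rewrite -(mulr_powRB1 h0) ?(lt_le_trans _ p1)// mulrCA ler_pMr//.
rewrite -opprB powRN mulrC ler_pdivlMr ?powR_gt0// mul1r.
by rewrite ge0_ler_powR ?nnegrE ?subr_ge0 ?(ltW hp) ?(ltW l0) ?(ltW lh).
Qed.

Section function.
Variables (n p k : R).
Hypotheses (n0 : (0 < n)%R) (p1 : (1 <= p)%R).
Let D := (n + 1)%R.

(** The constant is normalised to [1], so that all later constants are uniform in [H]; homogeneity
    restores the norm at the end. *)
Definition morrey (H : R -> R) :=
  [/\ measurable_fun setT H, forall y, (0 <= H y)%R &
      morrey_density n 1 (k * p) (fun y => (H y `^ p)%:E)].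

Lemma morrey_disc : exists2 C, (0 < C)%R & forall H, morrey H ->
  forall x r, (0 < x)%R -> (0 < r)%R ->
    \int[pol n]_t (if (rho x t.1 t.2 < r)%R then (H t.1)%:E else 0) <=
    (C * r `^ (D - k))%:E.
Proof.
have [C C0 disc] := morrey_density_disc n0.
exists (C * 2 + C)%R; first by rewrite addr_gt0// mulr_gt0.
move=> H [mH H0 mor] x r x0 r0; have mr := measurable_rho_fst x.
(* This level gives both terms the size [r ^ (D - k)]: [l r ^ D] and [l ^ (1 - p) r ^ (D - k p)]. *)
pose l : R := (r `^ (- k))%R; have l0 : (0 < l)%R by exact: powR_gt0.
have m1 : measurable_fun setT (fun t : R * R => if (rho x t.1 t.2 < r)%R then 1 else 0 : \bar R).
  by meas.
have mp : measurable_fun setT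
    (fun t : R * R => if (rho x t.1 t.2 < r)%R then (H t.1 `^ p)%:E else 0).
  by meas.
apply: (@le_trans _ _ (\int[pol n]_t
    (l%:E * (if (rho x t.1 t.2 < r)%R then 1 else 0) +
     (l `^ (1 - p))%:E * (if (rho x t.1 t.2 < r)%R then (H t.1 `^ p)%:E else 0)))).
  apply: integral_ge0_le.
  - by meas.
  - by apply: emeasurable_funD; apply: emeasurable_funM.
  - by move=> t; case: ifP => // _; rewrite lee_fin.
  - move=> t; case: ifP => _; last by rewrite !mule0 adde0.
    by rewrite mule1 -EFinM -EFinD lee_fin young_split.
have L0 : 0 <= l%:E by rewrite lee_fin ltW.
have Lp0 : 0 <= (l `^ (1 - p))%:E by rewrite lee_fin powR_ge0.
rewrite ge0_integralD//; last 4 first.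
- by move=> t _; rewrite mule_ge0//; case: ifP.
- exact: emeasurable_funM.
- by move=> t _; rewrite mule_ge0//; case: ifP => // _; rewrite lee_fin powR_ge0.
- exact: emeasurable_funM.
rewrite !ge0_integralZl//; last 2 first.
- by move=> t _; case: ifP => // _; rewrite lee_fin powR_ge0.
- by move=> t _; case: ifP.
have h1 := disc 2%R 0%R (cst 1) (ler0n _ 2) (measurable_cst _) (fun=> lee01) (morrey_density1 n0) x r x0 r0.
have mHp : measurable_fun setT (fun y => (H y `^ p)%:E) by meas.
have h2 := disc 1%R (k * p)%R _ ler01 mHp (fun y => powR_ge0 _ _) mor x r x0 r0.
apply: (le_trans (leeD (lee_wpmul2l L0 h1) (lee_wpmul2l Lp0 h2))).
rewrite -!EFinM -EFinD lee_fin /l -powRrM subr0 mulr1.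
have rD q : (r `^ (D + q) = r `^ D * r `^ q)%R.
  by rewrite powRD// (gt_eqF r0) implybT.
have -> : (r `^ (- k * (1 - p)) * (C * r `^ (n + 1 - k * p)) = C * r `^ (D - k))%R.
  rewrite mulrCA -powRD; last by rewrite (gt_eqF r0) implybT.
  by congr (_ * _ `^ _)%R; rewrite /D; ring.
rewrite -/D (rD (- k))%R mulrDl le_eqVlt; apply/orP; left; apply/eqP; ring.
Qed.

Lemma morrey_tail (b : R) : (0 < b)%R -> exists2 C, (0 < C)%R & forall H, morrey H ->
  forall x r, (0 < x)%R -> (0 < r)%R ->
    \int[pol n]_t (if (r <= rho x t.1 t.2)%R then
      (rho x t.1 t.2 `^ (k - b - D))%:E * (H t.1)%:E else 0) <=
    (C * r `^ (- b))%:E.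
Proof.
move=> b0; have [C C0 disc] := morrey_disc.
exists (large_const (D - k) b * C)%R; first by rewrite mulr_gt0// large_const_gt0.
move=> H mH x r x0 r0; have [mH1 H0 _] := mH.
have mHf : measurable_fun setT (fun t : R * R => (H t.1)%:E) by meas.
have Hf0 (t : R * R) : 0 <= (H t.1)%:E by rewrite lee_fin.
have := @integral_large_shells _ _ _ (pol n) _ _ C (D - k)%R (measurable_rho_fst x)
  mHf Hf0 (ltW C0) (fun s s0 => disc H mH x s x0 s0) b r b0 r0.
rewrite -/(large_const (D - k) b).
by have -> : (- (D - k) - b = k - b - D)%R by ring.
Qed.

End function.

Lemma integral_pol_small n (a : R) : (0 < n)%R -> (0 < a)%R ->
  exists2 C, (0 < C)%R & forall x r, (0 < x)%R -> (0 < r)%R ->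
    \int[pol n]_t (if (0 < rho x t.1 t.2 < r)%R then
      (rho x t.1 t.2 `^ (a - (n + 1)))%:E else 0) <= (C * r `^ a)%:E.
Proof.
move=> n0 a0; have [C C0 disc] := morrey_density_disc n0.
exists (small_const (n + 1) a * (C * 2))%R.
  by apply: mulr_gt0; [exact: small_const_gt0|exact: mulr_gt0].
move=> x r x0 r0.
have C20 : (0 <= C * 2)%R by rewrite mulr_ge0// ltW.
have disc1 s : (0 < s)%R -> \int[pol n]_t (if (rho x t.1 t.2 < s)%R then cst 1 t else 0) <=
    (C * 2 * s `^ (n + 1))%:E.
  move=> s0; have := disc 2%R 0%R (cst 1) (ler0n _ 2) (measurable_cst _) (fun=> lee01)
    (morrey_density1 n0) x s x0 s0.
  by rewrite subr0.
have := @integral_small_shells _ _ _ (pol n) _ (cst 1) _ _ (measurable_rho_fst x)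
  (measurable_cst _) (fun=> lee01) C20 disc1 a r a0 r0.
by under eq_integral do rewrite mule1.
Qed.

Lemma integral_pol_large n (e : R) : (0 < n)%R -> (0 < e)%R ->
  exists2 C, (0 < C)%R & forall x r, (0 < x)%R -> (0 < r)%R ->
    \int[pol n]_t (if (r <= rho x t.1 t.2)%R then
      (rho x t.1 t.2 `^ (- (n + 1) - e))%:E else 0) <= (C * r `^ (- e))%:E.
Proof.
move=> n0 e0; have [C C0 disc] := morrey_density_disc n0.
exists (large_const (n + 1) e * (C * 2))%R.
  by apply: mulr_gt0; [exact: large_const_gt0|exact: mulr_gt0].
move=> x r x0 r0.
have C20 : (0 <= C * 2)%R by rewrite mulr_ge0// ltW.
have disc1 s : (0 < s)%R -> \int[pol n]_t (if (rho x t.1 t.2 < s)%R then cst 1 t else 0) <=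
    (C * 2 * s `^ (n + 1))%:E.
  move=> s0; have := disc 2%R 0%R (cst 1) (ler0n _ 2) (measurable_cst _) (fun=> lee01)
    (morrey_density1 n0) x s x0 s0.
  by rewrite subr0.
have := @integral_large_shells _ _ _ (pol n) _ (cst 1) _ _ (measurable_rho_fst x)
  (measurable_cst _) (fun=> lee01) C20 disc1 e r e0 r0.
by under eq_integral do rewrite mule1.
Qed.

End morrey_density.

(** * The fractional integral near the diagonal *)

Section fractional_integral.
Context {R : realType}.
Variables n p k b s : R.
Hypothesis n0 : 0 < n.
Hypothesis p1 : 1 < p.
Hypothesis b0 : 0 < b.
Hypothesis bk : b < k.
Hypothesis kbD : k - b < n + 1.
Hypothesis s1 : 1 < s.
Hypothesis bs : b * s = k * p.
Local Notation D := (n + 1).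
Local Notation a := (k - b).
Implicit Types (H : R -> R) (x y z u h r dl : R).

Let k0 : 0 < k. Proof. exact: lt_trans bk. Qed.
Let a0 : 0 < a. Proof. by rewrite subr_gt0. Qed.
Let s0 : 0 < s. Proof. exact: lt_trans s1. Qed.
Let aD0 : a - D != 0. Proof. by rewrite lt_eqF// subr_lt0. Qed.

Lemma rhoC x y u : rho x y u = rho y x u.
Proof. by rewrite /rho; congr Num.sqrt; ring. Qed.

Lemma dist_le_rho x y u : 0 <= x -> 0 <= y -> -1 <= u -> `|x - y| <= rho x y u.
Proof.
move=> x0 y0 u1; rewrite /rho -sqrtr_sqr ler_wsqrtr//.
have : 0 <= x * y by rewrite mulr_ge0.
by nra.
Qed.

Lemma ang_support u : 0 < 1 - u ^+ 2 -> -1 <= u.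
Proof.
move=> u1; have [//|h] := leP (-1) u.
have h2 : 0 < 1 - u by lra.
by have h3 : 0 < (1 - u) * (-1 - u); [rewrite mulr_gt0//; lra|nra].
Qed.

(* The cutoff makes [local_part] independent of the distance [dl] at which
   [frac_integral_split] cuts, so that [dl] can be chosen pointwise. *)
Definition cutoff h r : R := Num.min (h `^ (b / k)) (r `^ (- b)) `^ (s - 1).

Lemma cutoff_ge0 h r : 0 <= cutoff h r.
Proof. exact: powR_ge0. Qed.

Lemma measurable_cutoff d (T : measurableType d) (f g : T -> R) :
  measurable_fun setT f -> measurable_fun setT g ->
  measurable_fun setT (fun t => cutoff (f t) (g t)).
Proof.
move=> mf mg; rewrite /cutoff; apply: measurable_fun_powR.
by apply: measurable_minr; meas.
Qed.

(** Each entry of the minimum is at least [dl ^ (- b)]: the first because [h] is large, the second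
    because [r] is small. *)
Lemma cutoff_ge dl h r : 0 < dl -> 0 < r -> r <= dl -> dl `^ (- k) <= h ->
  dl `^ (- (b * (s - 1))) <= cutoff h r.
Proof.
move=> dl0 r0 rdl dlh; rewrite -mulNr powRrM /cutoff.
have s10 : 0 <= s - 1 by rewrite subr_ge0 ltW.
have hb : dl `^ (- b) <= h `^ (b / k).
  have -> : dl `^ (- b) = (dl `^ (- k)) `^ (b / k).
    by rewrite -powRrM; congr (_ `^ _); field; exact: lt0r_neq0.
  apply: ge0_ler_powR => //; rewrite ?nnegrE ?powR_ge0//.
    by rewrite divr_ge0// ltW.
  by rewrite (le_trans _ dlh)// powR_ge0.
apply: ge0_ler_powR => //; rewrite ?nnegrE ?le_min ?powR_ge0// hb.
by apply: le0_ler_powR => //; rewrite oppr_le0 ltW.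
Qed.

Local Open Scope ereal_scope.

Definition frac_integral H x :=
  \int[pol n]_t (rho x t.1 t.2 `^ (a - D) * H t.1)%:E.

Definition local_part H r x :=
  \int[pol n]_t (if (rho x t.1 t.2 < r)%R then
    (rho x t.1 t.2 `^ (a - D) * H t.1 * cutoff (H t.1) (rho x t.1 t.2))%:E else 0).

(* Split at [rho = dl], and below [dl] at the height [H = dl `^ (- k)]. *)
Lemma frac_integral_split : exists2 C, (0 < C)%R & forall H, morrey n p k H ->
  forall x r dl, (0 < x)%R -> (0 < dl)%R -> (dl <= r)%R ->
    frac_integral H x <=
    (C * dl `^ (- b))%:E + (dl `^ (b * (s - 1)))%:E * local_part H r x.
Proof.
have [C1 C10 tail] := morrey_tail k n0 (ltW p1) b0.
have [C2 C20 small] := integral_pol_small n0 a0.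
exists (C1 + C2)%R; first exact: addr_gt0.
move=> H mH x r dl x0 dl0 dlr; have [mH1 H0 _] := mH.
have mr := measurable_rho_fst x.
have mc : measurable_fun setT (fun t : R * R => cutoff (H t.1) (rho x t.1 t.2)).
  by apply: measurable_cutoff; meas.
pose f1 (t : R * R) : \bar R := if (dl <= rho x t.1 t.2)%R then
  (rho x t.1 t.2 `^ (k - b - D))%:E * (H t.1)%:E else 0.
pose f2 (t : R * R) : \bar R := if (0 < rho x t.1 t.2 < dl)%R then
  (rho x t.1 t.2 `^ (a - D))%:E else 0.
pose f3 (t : R * R) : \bar R := if (rho x t.1 t.2 < r)%R then
    (rho x t.1 t.2 `^ (a - D) * H t.1 * cutoff (H t.1) (rho x t.1 t.2))%:E else 0.
have mf1 : measurable_fun setT f1 by rewrite /f1; meas.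
have mf2 : measurable_fun setT f2 by rewrite /f2; meas.
have mf3 : measurable_fun setT f3.
  by rewrite /f3; apply: measurable_fun_ifT; [meas|apply: measurable_fun_EFin; apply: measurable_funM; meas|meas].
have f10 t : 0 <= f1 t.
  by rewrite /f1; case: ifP => // _; rewrite mule_ge0 ?lee_fin ?powR_ge0.
have f20 t : 0 <= f2 t by rewrite /f2; case: ifP => // _; rewrite lee_fin powR_ge0.
have f30 t : 0 <= f3 t.
  by rewrite /f3; case: ifP => // _; rewrite lee_fin !mulr_ge0 ?powR_ge0.
have c2 : 0 <= (dl `^ (- k))%:E by rewrite lee_fin powR_ge0.
have c3 : 0 <= (dl `^ (b * (s - 1)))%:E by rewrite lee_fin powR_ge0.
have bound t : (rho x t.1 t.2 `^ (a - D) * H t.1)%:E <=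
    f1 t + (dl `^ (- k))%:E * f2 t + (dl `^ (b * (s - 1)))%:E * f3 t.
  have [h|h] := leP dl (rho x t.1 t.2).
    rewrite {1}/f1 h EFinM -[leLHS]adde0 -addeA leeD// adde_ge0 ?mule_ge0//.
  (* At [rho = 0] the kernel has the value [0], since its exponent is nonzero; the shells may
     therefore ignore this point. *)
  have [r1|r1] := leP (rho x t.1 t.2) 0%R.
    have -> : rho x t.1 t.2 = 0%R by apply/eqP; rewrite eq_le r1 rho_ge0.
    by rewrite powR0// mul0r !adde_ge0 ?mule_ge0.
  have [h1|h1] := leP (H t.1) (dl `^ (- k))%R.
    rewrite -[leLHS]adde0 leeD ?mule_ge0// -[leLHS]add0e leeD//.
    by rewrite /f2 r1 h/= -EFinM lee_fin mulrC ler_wpM2r ?powR_ge0.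
  (* What remains has [rho < dl] and [H > dl ^ (- k)], where [dl ^ (b (s - 1))] times the cutoff is
     at least [1]. *)
  rewrite -[leLHS]add0e leeD ?adde_ge0 ?mule_ge0//.
  rewrite /f3 (lt_le_trans h dlr) -EFinM lee_fin mulrCA ler_peMr ?mulr_ge0 ?powR_ge0//.
  rewrite -ler_pdivrMl ?powR_gt0// mulr1 -powRN.
  by apply: cutoff_ge; rewrite ?(ltW h) ?(ltW h1).
apply: (le_trans (integral_ge0_le _ _ _ _ bound)).
- by meas.
- by apply: emeasurable_funD; [apply: emeasurable_funD => //|]; apply: emeasurable_funM; meas.
- by move=> t; rewrite lee_fin mulr_ge0 ?powR_ge0.
have mc2 : measurable_fun setT (fun t => (dl `^ (- k))%:E * f2 t) by apply: emeasurable_funM; meas.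
have mc3 : measurable_fun setT (fun t => (dl `^ (b * (s - 1)))%:E * f3 t) by apply: emeasurable_funM; meas.
rewrite ge0_integralD//; last 3 first.
- by move=> t _; rewrite adde_ge0// mule_ge0.
- exact: emeasurable_funD.
- by move=> t _; rewrite mule_ge0.
rewrite ge0_integralD//; last by move=> t _; rewrite mule_ge0.
rewrite !ge0_integralZl//.
apply: leeD => //; rewrite mulrDl EFinD; apply: leeD; first exact: tail.
(* The low values of [H] contribute [dl ^ (- k)] times [dl ^ (k - b)], the same order as the
   tail. *)
apply: (le_trans (lee_wpmul2l c2 (small x dl x0 dl0))).
rewrite -EFinM lee_fin mulrCA -powRD; last by rewrite (gt_eqF dl0) implybT.
by rewrite addrA addNr add0r.
Qed.

(** Put [M = r ^ (- b s) + local_part H r x] and [dl = M ^ (- 1 / (b s))]. Then [dl ^ (- b)] and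
    [dl ^ (b (s - 1)) M] both equal [M ^ (1 / s)], and the summand [r ^ (- b s)] of [M] guarantees
    [dl <= r]. An infinite local part makes the claim trivial. *)
Lemma frac_integral_pow : exists2 C, (0 < C)%R & forall H, morrey n p k H ->
  forall x r, (0 < x)%R -> (0 < r)%R ->
    frac_integral H x `^ s <= C%:E * ((r `^ (- (b * s)))%:E + local_part H r x).
Proof.
have [C C0 split] := frac_integral_split.
exists ((C + 1) `^ s)%R; first by rewrite powR_gt0// addr_gt0.
move=> H mH x r x0 r0; have [mH1 H0 _] := mH.
have : 0 <= local_part H r x.
  apply: integral_ge0 => t _; case: ifP => // _.
  by rewrite lee_fin !mulr_ge0 ?powR_ge0.
have := split H mH x r _ x0.
case: (local_part H r x) => [l| |] //; last first.
  by rewrite addey// gt0_muley ?leey// lte_fin powR_gt0// addr_gt0.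
rewrite lee_fin => spl l0; rewrite -EFinD -EFinM.
pose M : R := (r `^ (- (b * s)) + l)%R.
have rM : (r `^ (- (b * s)) <= M)%R by rewrite lerDl.
have M0 : (0 < M)%R by rewrite (lt_le_trans _ rM)// powR_gt0.
have bs0 : (0 < b * s)%R by rewrite mulr_gt0.
pose dl : R := (M `^ (- (b * s)^-1))%R.
have dl0 : (0 < dl)%R by rewrite powR_gt0.
have dlr : (dl <= r)%R.
  rewrite -[leRHS]powRr1 ?(ltW r0)// (_ : 1 = - (b * s) * - (b * s)^-1)%R; last first.
    by rewrite mulrNN divff// gt_eqF.
  rewrite powRrM; apply: le0_ler_powR => //; last by rewrite powR_gt0.
  by rewrite oppr_le0 invr_ge0 ltW.
have := spl dl dl0 dlr.
have -> : (dl `^ (- b) = M `^ s^-1)%R.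
  by rewrite /dl -powRrM; congr (_ `^ _)%R; field; rewrite !gt_eqF.
rewrite -EFinM -EFinD => le1.
have le2 : frac_integral H x <= ((C + 1) * M `^ s^-1)%:E.
  apply: (le_trans le1); rewrite lee_fin mulrDl lerD2l mul1r.
  have -> : (M `^ s^-1 = dl `^ (b * (s - 1)) * M)%R.
    rewrite /dl -powRrM -[X in (_ = _ * X)%R](powRr1 (ltW M0)) -powRD; last first.
      by rewrite (gt_eqF M0) implybT.
    by congr (_ `^ _)%R; field; rewrite !gt_eqF.
  by rewrite ler_wpM2l ?powR_ge0// lerDr powR_ge0.
have I0 : 0 <= frac_integral H x.
  by apply: integral_ge0 => t _; rewrite lee_fin mulr_ge0 ?powR_ge0.
apply: (le_trans (gt0_ler_poweR (ltW s0) _ _ le2)).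
- by rewrite in_itv/= I0 leey.
- by rewrite in_itv/= leey lee_fin mulr_ge0 ?powR_ge0// ltW// addr_gt0.
rewrite poweR_EFin lee_fin powRM ?powR_ge0 ?addr_ge0 ?(ltW C0)//.
by rewrite -powRrM mulVf ?gt_eqF// powRr1 ?(ltW M0).
Qed.

(** The minimum in the cutoff switches at [rho = h ^ (- 1 / k)]. Inside, the kernel is integrable
    because [k > b]; outside, the cutoff supplies decay, and by [bs] the total exponent is
    [- D - k (p - 1)]. Both pieces are of order [h ^ (p - 1)]. *)
Lemma integral_cutoff : exists2 C, (0 < C)%R & forall h y, (0 < h)%R -> (0 < y)%R ->
  \int[pol n]_t (rho y t.1 t.2 `^ (a - D) * cutoff h (rho y t.1 t.2))%:E <=
  (C * h `^ (p - 1))%:E.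
Proof.
have e0 : (0 < k * (p - 1))%R by rewrite mulr_gt0// subr_gt0.
have [C1 C10 small] := integral_pol_small n0 a0.
have [C2 C20 large] := integral_pol_large n0 e0.
exists (C1 + C2)%R; first exact: addr_gt0.
move=> h y h0 y0; have mr := measurable_rho_fst y.
have s10 : (0 <= s - 1)%R by rewrite subr_ge0 ltW.
have mc : measurable_fun setT (fun t : R * R => cutoff h (rho y t.1 t.2)).
  by apply: measurable_cutoff; meas.
pose r := (h `^ (- k^-1))%R; have r0 : (0 < r)%R by rewrite powR_gt0.
pose c := (h `^ (b / k * (s - 1)))%R.
have c0 : 0 <= c%:E by rewrite lee_fin powR_ge0.
pose f1 (t : R * R) : \bar R := if (0 < rho y t.1 t.2 < r)%R then
  (rho y t.1 t.2 `^ (a - D))%:E else 0.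
pose f2 (t : R * R) : \bar R := if (r <= rho y t.1 t.2)%R then
  (rho y t.1 t.2 `^ (- D - k * (p - 1)))%:E else 0.
have mf1 : measurable_fun setT f1 by rewrite /f1; meas.
have mf2 : measurable_fun setT f2 by rewrite /f2; meas.
have f10 t : 0 <= f1 t by rewrite /f1; case: ifP => // _; rewrite lee_fin powR_ge0.
have f20 t : 0 <= f2 t by rewrite /f2; case: ifP => // _; rewrite lee_fin powR_ge0.
have min0 t : (0 <= Num.min (h `^ (b / k)) (rho y t.1 t.2 `^ (- b)))%R.
  by rewrite le_min !powR_ge0.
have bound t : (rho y t.1 t.2 `^ (a - D) * cutoff h (rho y t.1 t.2))%:E <=
    c%:E * f1 t + f2 t.
  have [h1|h1] := leP r (rho y t.1 t.2).
    rewrite -[leLHS]add0e leeD ?mule_ge0// /f2 h1 lee_fin.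
    have rh0 : (0 < rho y t.1 t.2)%R by exact: lt_le_trans h1.
    have -> : (- D - k * (p - 1) = (a - D) + (- b) * (s - 1))%R.
      by rewrite mulNr mulrBr mulrBr -bs; ring.
    rewrite (@powRD _ _ (a - D)); last by rewrite (gt_eqF rh0) implybT.
    rewrite ler_wpM2l ?powR_ge0// powRrM.
    by apply: ge0_ler_powR; rewrite ?nnegrE ?powR_ge0// ge_min lexx orbT.
  have [r1|r1] := leP (rho y t.1 t.2) 0%R.
    have -> : rho y t.1 t.2 = 0%R by apply/eqP; rewrite eq_le r1 rho_ge0.
    by rewrite powR0// mul0r adde_ge0 ?mule_ge0.
  rewrite -[leLHS]adde0 leeD// /f1 r1 h1 -EFinM lee_fin mulrC ler_wpM2r ?powR_ge0//.
  rewrite /c powRrM.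
  by apply: ge0_ler_powR; rewrite ?nnegrE ?powR_ge0// ge_min lexx.
apply: (le_trans (integral_ge0_le _ _ _ _ bound)).
- by apply: measurable_fun_EFin; apply: measurable_funM; meas.
- by apply: emeasurable_funD => //; apply: emeasurable_funM; meas.
- by move=> t; rewrite lee_fin mulr_ge0 ?powR_ge0 ?cutoff_ge0.
rewrite ge0_integralD//; last 2 first.
- by move=> t _; rewrite mule_ge0.
- by apply: emeasurable_funM; meas.
rewrite ge0_integralZl//.
apply: (le_trans (leeD (lee_wpmul2l c0 (small y r y0 r0)) (large y r y0 r0))).
rewrite -EFinM -EFinD lee_fin mulrDl lerD//.
  rewrite mulrCA ler_pM2l// /c /r -powRrM -powRD; last by rewrite (gt_eqF h0) implybT.
  rewrite (_ : b / k * (s - 1) + - k^-1 * a = p - 1)%R//.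
  have -> : (b / k * (s - 1) = b * s / k - b / k)%R by ring.
  by rewrite bs; field; exact: lt0r_neq0.
rewrite ler_pM2l// /r -powRrM (_ : - k^-1 * - (k * (p - 1)) = p - 1)%R//.
by field; exact: lt0r_neq0.
Qed.

End fractional_integral.

Section fractional_integral_bound.
Context {R : realType}.
Variables n p k b s : R.
Hypothesis n0 : 0 < n.
Hypothesis p1 : 1 < p.
Hypothesis b0 : 0 < b.
Hypothesis bk : b < k.
Hypothesis kbD : k - b < n + 1.
Hypothesis s1 : 1 < s.
Hypothesis bs : b * s = k * p.
Local Notation D := (n + 1).
Local Notation a := (k - b).
Implicit Types (H : R -> R) (x y z u h r : R).
Local Open Scope ereal_scope.

(** Regrouping [(x, (y, u))] as [((x, y), u)] lets the measurability part of Tonelli's theorem be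
    applied twice. *)
Lemma measurable_pol_section (f : R * (R * R) -> \bar R) : measurable_fun setT f ->
  (forall t, 0 <= f t) -> measurable_fun setT (fun x => \int[pol n]_t f (x, t)).
Proof.
move=> mf f0.
have mg : measurable_fun setT (fun q : (R * R) * R => f (q.1.1, (q.1.2, q.2))).
  apply: (measurableT_comp mf); apply: measurable_fun_pair; first by meas.
  by apply: measurable_fun_pair; meas.
have mG := @measurable_fun_fubini_tonelli_F _ _ _ _ R (ang n) _ mg (fun q => f0 _).
have G0 (q : R * R) : 0 <= \int[ang n]_u f (q.1, (q.2, u)) by exact: integral_ge0.
have := @measurable_fun_fubini_tonelli_F _ _ _ _ R (half n) _ mG G0.
congr (measurable_fun _ _); apply/funext => x.
rewrite integral_pol//; apply: (measurableT_comp mf).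
by apply: measurable_fun_pair; [exact: measurable_cst|exact: measurable_id].
Qed.

Lemma measurable_frac_integral H : measurable_fun setT H -> (forall y, 0 <= H y)%R ->
  measurable_fun setT (frac_integral n k b H).
Proof.
move=> mH H0; apply: (measurable_pol_section (f := fun q : R * (R * R) =>
  (rho q.1 q.2.1 q.2.2 `^ (a - D) * H q.2.1)%:E)).
  have mr : measurable_fun setT (fun q : R * (R * R) => rho q.1 q.2.1 q.2.2).
    by apply: measurable_rho; meas.
  by meas.
by move=> t; rewrite lee_fin mulr_ge0 ?powR_ge0.
Qed.

Lemma measurable_local_part H r : measurable_fun setT H -> (forall y, 0 <= H y)%R ->
  measurable_fun setT (local_part n k b s H r).
Proof.
move=> mH H0; apply: (measurable_pol_section (f := fun q : R * (R * R) =>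
  if (rho q.1 q.2.1 q.2.2 < r)%R then (rho q.1 q.2.1 q.2.2 `^ (a - D) * H q.2.1 *
    cutoff k b s (H q.2.1) (rho q.1 q.2.1 q.2.2))%:E else 0)).
  have mr : measurable_fun setT (fun q : R * (R * R) => rho q.1 q.2.1 q.2.2).
    by apply: measurable_rho; meas.
  apply: measurable_fun_ifT; [by meas| |by meas].
  apply: measurable_fun_EFin; apply: measurable_funM; first by meas.
  by apply: measurable_cutoff; meas.
by move=> t; case: ifP => // _; rewrite lee_fin !mulr_ge0 ?powR_ge0.
Qed.

(** This takes the place of a maximal inequality. With [y] fixed, the integral over [z] and the
    angle is one around [y], as [rho] is symmetric in its two sides, and [integral_cutoff] turns
    [H y] into a multiple of [H y ^ p]. The conditions [|z - x| < r] and [rho < r] force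
    [|y - x| < 2 r], so the Morrey condition is used at radius [2 r]. *)
Lemma local_part_ball : exists2 C, (0 < C)%R & forall H, morrey n p k H ->
  forall x r, (0 < x)%R -> (0 < r)%R ->
    \int[half n]_z (if (`|z - x| < r)%R then local_part n k b s H r z else 0) <=
    (C * r `^ (1 - k * p) * (x + r) `^ n)%:E.
Proof.
have [C C0 cut] := integral_cutoff n0 p1 b0 bk kbD s1 bs.
exists (C * (2 `^ (1 - k * p) * 2 `^ n))%R; first by rewrite !mulr_gt0 ?powR_gt0.
move=> H [mH H0 mor] x r x0 r0.
pose g z y u := (rho z y u `^ (a - D) * H y * cutoff k b s (H y) (rho z y u))%R.
pose G z y u : \bar R :=
  if (`|z - x| < r)%R && (rho z y u < r)%R then (g z y u)%:E else 0.
have g0 z y u : (0 <= g z y u)%R by rewrite !mulr_ge0 ?powR_ge0.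
have G0 z y u : 0 <= G z y u by rewrite /G; case: ifP => // _; rewrite lee_fin.
have mG d (T : measurableType d) (c e f : T -> R) : measurable_fun setT c ->
    measurable_fun setT e -> measurable_fun setT f ->
    measurable_fun setT (fun t => G (c t) (e t) (f t)).
  move=> mc me mf; have mr : measurable_fun setT (fun t => rho (c t) (e t) (f t)).
    exact: measurable_rho.
  rewrite /G; apply: measurable_fun_ifT; [by meas| |by meas].
  apply: measurable_fun_EFin; apply: measurable_funM; first by meas.
  by apply: measurable_cutoff; meas.
rewrite (eq_integral (fun z => \int[half n]_y \int[ang n]_u G z y u)); last first.
  move=> z _; rewrite -(@integral_pol _ n (fun t => G z t.1 t.2)); last 2 first.
  - by apply: mG; meas.
  - by move=> t; exact: G0.
  rewrite /G; case: ifPn => // _.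
  by rewrite integral0_eq.
have mF : measurable_fun setT (fun q : R * R => \int[ang n]_u G q.1 q.2 u).
  apply: (@measurable_fun_fubini_tonelli_F _ _ _ _ R (ang n)
    (fun q : (R * R) * R => G q.1.1 q.1.2 q.2)); last by move=> q; exact: G0.
  by apply: mG; meas.
have F0 (q : R * R) : 0 <= \int[ang n]_u G q.1 q.2 u by exact: integral_ge0.
have /= -> := @fubini_tonelli _ _ R R R (half n) (half n) _ mF F0.
have mHp : measurable_fun setT (fun y => (H y `^ p)%:E) by meas.
have mball c : measurable_fun setT (fun y => (`|y - x| < c)%R).
  by apply: measurable_fun_ltr; meas.
apply: (@le_trans _ _ (\int[half n]_y (C%:E *
    (if (`|y - x| < 2 * r)%R then (H y `^ p)%:E else 0)))).
  apply: integral_half_le.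
  - exact: (@measurable_fun_fubini_tonelli_G _ _ _ _ R (half n) _ mF).
  - by apply: emeasurable_funM; meas.
  - by move=> y; apply: integral_ge0 => z _; exact: (F0 (z, y)).
  - move=> y; rewrite mule_ge0// ?lee_fin ?(ltW C0)//; case: ifP => // _.
    by rewrite lee_fin powR_ge0.
  - move=> y y0; rewrite -(@integral_pol _ n (fun t => G t.1 y t.2)); last 2 first.
    - by apply: mG; meas.
    - by move=> t; exact: G0.
    pose K (t : R * R) := (rho y t.1 t.2 `^ (a - D) * cutoff k b s (H y) (rho y t.1 t.2))%:E.
    have mK : measurable_fun setT K.
      have mr := measurable_rho_fst y.
      apply: measurable_fun_EFin; apply: measurable_funM; first by meas.
      by apply: measurable_cutoff; meas.
    have K0 t : 0 <= K t by rewrite lee_fin mulr_ge0 ?powR_ge0.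
    apply: (@le_trans _ _ (\int[pol n]_t
        (if (`|y - x| < 2 * r)%R then (H y)%:E * K t else 0))).
      apply: integral_pol_le.
      - by apply: mG; meas.
      - by apply: measurable_fun_ifT; [meas|apply: emeasurable_funM; meas|meas].
      - by move=> t; exact: G0.
      - by move=> t; case: ifP => // _; rewrite mule_ge0// lee_fin.
      - move=> z u z0 u0; rewrite /G/=; case: ifPn => [/andP[zx rr]|_]; last first.
          by case: ifP => // _; rewrite mule_ge0// lee_fin.
        rewrite ifT.
          by rewrite /K/= /g (rhoC z) -EFinM lee_fin le_eqVlt; apply/orP; left; apply/eqP; ring.
        have yz : (`|z - y| <= rho z y u)%R.
          by apply: dist_le_rho; [exact: ltW|exact: ltW|exact: ang_support].
        rewrite (_ : y - x = (z - x) - (z - y))%R; last by ring.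
        by rewrite (le_lt_trans (ler_normB _ _))//; lra.
    case: ifPn => yx; last by rewrite integral0 mule0.
    rewrite ge0_integralZl ?lee_fin//.
    have [Hy0|Hy0] := leP (H y) 0%R.
      have -> : H y = 0%R by apply/eqP; rewrite eq_le Hy0 H0.
      by rewrite mul0e mule_ge0// lee_fin ?powR_ge0 ?ltW.
    apply: (le_trans (lee_wpmul2l _ (cut _ _ Hy0 y0))); first by rewrite lee_fin.
    by rewrite -!EFinM lee_fin mulrCA mulr_powRB1// (lt_trans _ p1).
rewrite ge0_integralZl//; last 3 first.
- by meas.
- by move=> y _; case: ifP => // _; rewrite lee_fin powR_ge0.
- by rewrite lee_fin ltW.
have r20 : (0 < 2 * r)%R by rewrite mulr_gt0.
apply: (le_trans (lee_wpmul2l _ (mor x (2 * r)%R x0 r20))); first by rewrite lee_fin ltW.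
rewrite -EFinM lee_fin mul1r powRM ?(ltW r0)// -!mulrA ler_pM2l// ler_wpM2l ?powR_ge0//.
rewrite [leRHS]mulrCA ler_wpM2l ?powR_ge0// -powRM ?addr_ge0 ?(ltW x0) ?(ltW r0)//.
by apply: ge0_ler_powR; rewrite ?nnegrE ?(ltW n0)//; lra.
Qed.

Lemma frac_integral_ball : exists2 C, (0 < C)%R & forall H, morrey n p k H ->
  forall x r, (0 < x)%R -> (0 < r)%R ->
    \int[half n]_z (if (`|z - x| < r)%R then frac_integral n k b H z `^ s else 0) <=
    (C * r `^ (1 - k * p) * (x + r) `^ n)%:E.
Proof.
have [C1 C10 pw] := frac_integral_pow n0 p1 b0 bk kbD s1.
have [C2 C20 loc] := local_part_ball.
exists (C1 * (2 + C2))%R; first by rewrite mulr_gt0// addr_gt0.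
move=> H mH x r x0 r0; have [mH1 H0 mor] := mH.
have mball c : measurable_fun setT (fun y => (`|y - x| < c)%R).
  by apply: measurable_fun_ltr; meas.
have mfrac := measurable_frac_integral mH1 H0.
have mloc := measurable_local_part r mH1 H0.
have loc0 z : 0 <= local_part n k b s H r z.
  apply: integral_ge0 => t _; case: ifP => // _.
  by rewrite lee_fin !mulr_ge0 ?powR_ge0.
pose f1 z : \bar R := if (`|z - x| < r)%R then 1 else 0.
pose f2 z : \bar R := if (`|z - x| < r)%R then local_part n k b s H r z else 0.
have mf1 : measurable_fun setT f1 by rewrite /f1; meas.
have mf2 : measurable_fun setT f2.
  by rewrite /f2; apply: measurable_fun_ifT => //; meas.
have f10 z : 0 <= f1 z by rewrite /f1; case: ifP.
have f20 z : 0 <= f2 z by rewrite /f2; case: ifP.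
have c0 : 0 <= C1%:E by rewrite lee_fin ltW.
have d0 : 0 <= (r `^ (- (b * s)))%:E by rewrite lee_fin powR_ge0.
have ms : measurable_fun setT (fun z => (r `^ (- (b * s)))%:E * f1 z + f2 z).
  by apply: emeasurable_funD => //; apply: emeasurable_funM; meas.
apply: (@le_trans _ _ (\int[half n]_z
    (C1%:E * ((r `^ (- (b * s)))%:E * f1 z + f2 z)))).
  apply: integral_half_le.
  - by apply: measurable_fun_ifT; [meas|exact: measurable_fun_poweR|meas].
  - by apply: emeasurable_funM; meas.
  - by move=> z; case: ifP => // _; rewrite poweR_ge0.
  - by move=> z; rewrite mule_ge0// adde_ge0// mule_ge0.
  - move=> z z0; rewrite /f1 /f2; case: ifP => _; last by rewrite mule0 adde0 mule0.
    by rewrite mule1; exact: pw.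
rewrite ge0_integralZl//; last by move=> z _; rewrite adde_ge0// mule_ge0.
rewrite ge0_integralD//; last 2 first.
- by move=> z _; rewrite mule_ge0.
- by apply: emeasurable_funM; meas.
rewrite ge0_integralZl//.
have h1 := integral_half_ball_le x n0 r0.
apply: (le_trans (lee_wpmul2l c0 (leeD (lee_wpmul2l d0 h1) (loc H mH x r x0 r0)))).
rewrite -(EFinM (r `^ (- (b * s)))) -EFinD -EFinM lee_fin bs.
have -> : (r `^ (1 - k * p) = r * r `^ (- (k * p)))%R.
  by rewrite powRD ?powRr1 ?(ltW r0)// (gt_eqF r0) implybT.
rewrite le_eqVlt; apply/orP; left; apply/eqP; ring.
Qed.

End fractional_integral_bound.

(** * Dilation means and weighted potentials *)

Section jensen.
Context d (T : measurableType d) {R : realType} (mu : {measure set T -> \bar R}).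
Variables (w : T -> \bar R) (f : T -> R) (p M : R).
Hypothesis mw : measurable_fun setT w.
Hypothesis w0 : forall x, (0 <= w x)%E.
Hypothesis mf : measurable_fun setT f.
Hypothesis f0 : forall x, 0 <= f x.
Hypothesis p1 : 1 <= p.
Hypothesis M0 : 0 < M.
Hypothesis wM : (\int[mu]_x w x <= M%:E)%E.
Local Open Scope ereal_scope.

Lemma integral_young l : (0 < l)%R ->
  \int[mu]_x (w x * (f x)%:E) <=
  (l * M)%:E + (l `^ (1 - p))%:E * \int[mu]_x (w x * (f x `^ p)%:E).
Proof.
move=> l0.
have l0' : 0 <= l%:E by rewrite lee_fin ltW.
have lp0 : 0 <= (l `^ (1 - p))%:E by rewrite lee_fin powR_ge0.
apply: (@le_trans _ _ (\int[mu]_x (l%:E * w x + (l `^ (1 - p))%:E * (w x * (f x `^ p)%:E)))).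
  apply: integral_ge0_le.
  - by meas.
  - by meas.
  - by move=> x; rewrite mule_ge0// lee_fin.
  - move=> x; rewrite [l%:E * _]muleC muleCA -EFinM.
    rewrite -ge0_muleDr ?lee_fin ?mulr_ge0 ?powR_ge0 ?(ltW l0)//.
    by rewrite -EFinD lee_wpmul2l// lee_fin young_split.
rewrite ge0_integralD//; last 4 first.
- by move=> x _; rewrite mule_ge0.
- by meas.
- by move=> x _; rewrite mule_ge0// mule_ge0// lee_fin powR_ge0.
- by meas.
rewrite !ge0_integralZl//; last 2 first.
- by meas.
- by move=> x _; rewrite mule_ge0// lee_fin powR_ge0.
by rewrite leeD// EFinM lee_wpmul2l.
Qed.

(** Minimising [integral_young] over the level [l]: with [J] the integral on the right,
    [l = (J / M) ^ (1 / p)] makes its two terms equal, whence the factor [2 ^ p]. *)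
Lemma integral_jensen : (\int[mu]_x (w x * (f x)%:E)) `^ p <=
  (2 `^ p * M `^ (p - 1))%:E * \int[mu]_x (w x * (f x `^ p)%:E).
Proof.
have p0 : (0 < p)%R by exact: lt_le_trans p1.
have I0 : 0 <= \int[mu]_x (w x * (f x)%:E).
  by apply: integral_ge0 => x _; rewrite mule_ge0// lee_fin.
have J0 : 0 <= \int[mu]_x (w x * (f x `^ p)%:E).
  by apply: integral_ge0 => x _; rewrite mule_ge0// lee_fin powR_ge0.
have C0 : (0 < 2 `^ p * M `^ (p - 1))%R by rewrite mulr_gt0 ?powR_gt0.
have := integral_young.
move: J0; case: (\int[mu]_x (w x * (f x `^ p)%:E)) => [j| |] //; last first.
  by rewrite gt0_muley ?leey// lte_fin.
(* When the integral on the right is [0] the optimal level would be [0]; arbitrarily small positive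
   levels [e / M] are used instead. *)
rewrite lee_fin le_eqVlt => /predU1P[<-|j0] young.
  have I00 : \int[mu]_x (w x * (f x)%:E) <= 0.
    apply/lee_addgt0Pr => e e0; rewrite add0e.
    have := young (e / M)%R; rewrite mule0 adde0 divfK ?gt_eqF//; apply.
    exact: divr_gt0.
  have -> : \int[mu]_x (w x * (f x)%:E) = 0 by apply/eqP; rewrite eq_le I00.
  by rewrite poweR0r ?gt_eqF// mule0.
pose l : R := ((j / M) `^ p^-1)%R.
have jM : (0 < j / M)%R by exact: divr_gt0.
have l0 : (0 < l)%R by rewrite powR_gt0.
have lp : (l `^ p = j / M)%R by rewrite /l -powRrM mulVf ?gt_eqF// powRr1// ltW.
have le1 : \int[mu]_x (w x * (f x)%:E) <= (2 * (l * M))%:E.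
  apply: (le_trans (young _ l0)).
  rewrite -EFinM -EFinD lee_fin mulrDl mul1r lerD2l.
  rewrite powRD ?(gt_eqF l0) ?implybT// powRr1 ?(ltW l0)// powRN lp.
  by rewrite le_eqVlt; apply/orP; left; apply/eqP; field; rewrite !gt_eqF.
apply: (le_trans (gt0_ler_poweR (ltW p0) _ _ le1)).
- by rewrite in_itv/= I0 leey.
- by rewrite in_itv/= leey lee_fin mulr_ge0// mulr_ge0// ltW.
rewrite poweR_EFin -EFinM lee_fin !powRM ?mulr_ge0 ?(ltW l0) ?(ltW M0)// lp.
rewrite -[leRHS]mulrA ler_wpM2l ?powR_ge0// -(mulr_powRB1 (ltW M0) p0).
by rewrite le_eqVlt; apply/orP; left; apply/eqP; field; rewrite gt_eqF.
Qed.

End jensen.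

Section dilation.
Context {R : realType}.
Implicit Types (n x y z u l r c : R).

Lemma rho_dilate z l u : 0 < z -> rho z (z * l) u = z * rho 1 l u.
Proof.
move=> z0; rewrite /rho -[X in _ = X * _](gtr0_norm z0) -sqrtr_sqr -sqrtrM ?sqr_ge0//.
by congr Num.sqrt; ring.
Qed.

Local Open Scope ereal_scope.

Lemma integral_half_dilate n c (g : R -> \bar R) : (0 < c)%R ->
  measurable_fun setT g -> (forall y, 0 <= g y) ->
  \int[half n]_y g y = (c `^ (n + 1))%:E * \int[half n]_y g (c * y)%R.
Proof.
move=> c0 mg g0; have mw := measurable_half_weight n.
have mgc : measurable_fun setT (fun y => g (c * y)%R) by meas.
rewrite !integral_half// (integral_leb_affine 0 c0); last 2 first.
- by meas.
- by move=> y; rewrite mule_ge0// lee_fin half_weight_ge0.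
have -> : (c `^ (n + 1) = c * c `^ n)%R.
  by rewrite powRD ?(gt_eqF c0) ?implybT// powRr1 ?(ltW c0)// mulrC.
rewrite EFinM -muleA; congr (_ * _).
rewrite -ge0_integralZl//; last 3 first.
- by meas.
- by move=> y _; rewrite mule_ge0// lee_fin half_weight_ge0.
- by rewrite lee_fin powR_ge0.
apply: eq_integral => y _; rewrite addr0 muleCA -EFinM; congr (_ * _%:E).
rewrite /half_weight pmulr_rgt0//; case: ifPn => y0; last by rewrite mulr0.
by rewrite powRM// ltW.
Qed.

Variables (n p k : R) (w : R -> \bar R) (M : R).
Hypothesis n0 : (0 < n)%R.
Hypothesis p1 : (1 < p)%R.
Hypothesis mw : measurable_fun setT w.
Hypothesis w0 : forall l, 0 <= w l.
Hypothesis M0 : (0 < M)%R.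
Hypothesis wM : \int[half n]_l (w l * (l `^ (- k))%:E) <= M%:E.

Definition dilation_mean (H : R -> R) z := \int[half n]_l (w l * (H (z * l)%R)%:E).

Lemma measurable_dilation_mean (H : R -> R) : measurable_fun setT H ->
  (forall y, 0 <= H y)%R -> measurable_fun setT (dilation_mean H).
Proof.
move=> mH H0; apply: (@measurable_fun_fubini_tonelli_F _ _ _ _ R (half n)
  (fun q : R * R => w q.2 * (H (q.1 * q.2)%R)%:E)); first by meas.
by move=> q; rewrite mule_ge0// lee_fin.
Qed.

(** Jensen's inequality is applied to [l ^ k H (z l)] with the weight [w l l ^ (- k)], whose mass is
    at most [M]. This normalisation makes every dilate equally large: substituting [y = l z], the
    powers [k p], [- (n + 1)], [1 - k p] and [n] of [l] add up to [0]. *)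
Lemma dilation_mean_ball (H : R -> R) x r : morrey n p k H ->
  (0 < x)%R -> (0 < r)%R ->
  \int[half n]_z (if (`|z - x| < r)%R then dilation_mean H z `^ p else 0) <=
  (2 `^ p * M `^ p * r `^ (1 - k * p) * (x + r) `^ n)%:E.
Proof.
move=> [mH H0 mor] x0 r0; have p0 : (0 < p)%R by exact: lt_trans p1.
have mball c : measurable_fun setT (fun y => (`|y - x| < c)%R).
  by apply: measurable_fun_ltr; meas.
pose v l := w l * (l `^ (- k))%:E.
have mv : measurable_fun setT v by rewrite /v; meas.
have v0 l : 0 <= v l by rewrite mule_ge0// lee_fin powR_ge0.
have K0 : (0 <= 2 `^ p * M `^ (p - 1))%R by rewrite mulr_ge0 ?powR_ge0.
have mpow : measurable_fun setT (fun q : R * R => v q.2 * ((q.2 `^ k * H (q.1 * q.2)) `^ p)%:E).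
  by meas.
have pw z : dilation_mean H z `^ p <= (2 `^ p * M `^ (p - 1))%:E *
    \int[half n]_l (v l * ((l `^ k * H (z * l)) `^ p)%:E).
  have -> : dilation_mean H z = \int[half n]_l (v l * (l `^ k * H (z * l))%:E).
    rewrite /dilation_mean !integral_half; last 4 first.
    - by meas.
    - by move=> l; rewrite mule_ge0// lee_fin mulr_ge0 ?powR_ge0.
    - by meas.
    - by move=> l; rewrite mule_ge0// lee_fin.
    apply: eq_integral => l _; have [l0|l0] := ltP 0%R l; last first.
      by rewrite /half_weight ltNge l0 !mule0.
    congr (_ * _); rewrite /v -muleA; congr (_ * _).
    by rewrite -EFinM mulrA -powRD ?addNr ?powRr0 ?mul1r// eqxx gt_eqF.
  apply: integral_jensen => //; [by meas| |exact: ltW].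
  by move=> l; rewrite mulr_ge0 ?powR_ge0.
pose G z l : \bar R :=
  if (`|z - x| < r)%R then v l * ((l `^ k * H (z * l)) `^ p)%:E else 0.
have mG : measurable_fun setT (fun q : R * R => G q.1 q.2) by rewrite /G; meas.
have G0 (q : R * R) : 0 <= G q.1 q.2.
  by rewrite /G; case: ifP => // _; rewrite mule_ge0// lee_fin powR_ge0.
have mGF := @measurable_fun_fubini_tonelli_F _ _ _ _ R (half n) _ mG G0.
apply: (@le_trans _ _ ((2 `^ p * M `^ (p - 1))%:E *
    \int[half n]_z \int[half n]_l G z l)).
  rewrite -ge0_integralZl//; last by move=> z _; apply: integral_ge0 => l _; exact: (G0 (z, l)).
  apply: integral_ge0_le.
  - apply: measurable_fun_ifT; [by meas| |by meas].
    by apply: measurable_fun_poweR; exact: measurable_dilation_mean.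
  - by apply: emeasurable_funM; meas.
  - by move=> z; case: ifP => // _; rewrite poweR_ge0.
  - move=> z; rewrite /G; case: ifP => _; first exact: pw.
    by rewrite integral0 mule0.
have /= -> := @fubini_tonelli _ _ R R R (half n) (half n) _ mG G0.
pose B := (r `^ (1 - k * p) * (x + r) `^ n)%R.
have B0 : (0 <= B)%R by rewrite mulr_ge0 ?powR_ge0.
have xr0 : (0 < x + r)%R by exact: addr_gt0.
have inner l : (0 < l)%R -> \int[half n]_z G z l <= B%:E * v l.
  move=> l0; pose F y : \bar R := if (`|y - l * x| < l * r)%R then (H y `^ p)%:E else 0.
  have mF : measurable_fun setT F.
    by rewrite /F; apply: measurable_fun_ifT; [apply: measurable_fun_ltr; meas|meas|meas].
  have F0 y : 0 <= F y by rewrite /F; case: ifP => // _; rewrite lee_fin powR_ge0.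
  have mFl : measurable_fun setT (fun z => F (l * z)%R).
    by apply: (measurable_fun_comp1 mF); meas.
  rewrite (eq_integral (fun z => v l * (l `^ (k * p))%:E * F (l * z)%R)); last first.
    move=> z _; rewrite /G /F -mulrBr normrM (gtr0_norm l0) ltr_pM2l//.
    case: ifP => _; last by rewrite mule0.
    by rewrite [(z * l)%R]mulrC powRM ?powR_ge0// -powRrM EFinM muleA.
  have c0 : 0 <= v l * (l `^ (k * p))%:E by rewrite mule_ge0// lee_fin powR_ge0.
  rewrite ge0_integralZl// [leRHS]muleC -muleA lee_wpmul2l//.
  have lr0 : (0 < l * r)%R by exact: mulr_gt0.
  have lx0 : (0 < l * x)%R by exact: mulr_gt0.
  have := mor _ _ lx0 lr0; rewrite -[X in X <= _]/(\int[half n]_y F y).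
  rewrite (integral_half_dilate n l0 mF F0) -lee_pdivlMl ?powR_gt0// => h.
  apply: (le_trans (lee_wpmul2l _ h)); first by rewrite lee_fin powR_ge0.
  rewrite -!EFinM lee_fin /B mul1r -mulrDr !powRM ?(ltW l0) ?(ltW r0) ?(ltW xr0)//.
  have e1 : (l `^ (k * p) * (l `^ (n + 1))^-1 * (l `^ (1 - k * p) * l `^ n) = 1)%R.
    rewrite -powRN -!powRD ?(gt_eqF l0) ?implybT//.
    by rewrite (_ : _ + _ = 0)%R ?powRr0//; ring.
  rewrite le_eqVlt; apply/orP; left; apply/eqP.
  transitivity ((l `^ (k * p) * (l `^ (n + 1))^-1 * (l `^ (1 - k * p) * l `^ n)) *
    (r `^ (1 - k * p) * (x + r) `^ n))%R; first by ring.
  by rewrite e1 mul1r.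
apply: (@le_trans _ _ ((2 `^ p * M `^ (p - 1))%:E * (B%:E * M%:E))).
  apply: lee_wpmul2l; first by rewrite lee_fin.
  apply: (@le_trans _ _ (\int[half n]_l (B%:E * v l))).
    apply: integral_half_le.
    - exact: (@measurable_fun_fubini_tonelli_G _ _ _ _ R (half n) _ mG).
    - by apply: emeasurable_funM; meas.
    - by move=> l; apply: integral_ge0 => z _; exact: (G0 (z, l)).
    - by move=> l; rewrite mule_ge0// lee_fin.
    - exact: inner.
  by rewrite ge0_integralZl ?lee_fin// lee_wpmul2l// lee_fin.
rewrite -!EFinM lee_fin -(mulr_powRB1 (ltW M0) p0) /B.
by rewrite le_eqVlt; apply/orP; left; apply/eqP; ring.
Qed.

End dilation.

(** * Potentials with power weights on the half-line *)

Section weighted_potential.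
Context {R : realType}.
Variables n gam alp bet p k b s : R.
Hypothesis n0 : 0 < n.
Hypothesis gam0 : 0 < gam.
Hypothesis gamD : gam < n + 1.
Hypothesis ab0 : 0 <= alp + bet.
Hypothesis kb : k - b = gam - alp - bet.
Hypothesis bk : b <= k.
Hypothesis b0 : 0 < b.
Hypothesis p1 : 1 < p.
Hypothesis s1 : 1 < s.
Hypothesis bs : b * s = k * p.
Hypothesis alpk : alp < n + 1 - k.
Hypothesis betb : bet < b.
Local Notation D := (n + 1).
Implicit Types (H : R -> R) (x y z u h r l : R).

Let k0 : 0 < k. Proof. exact: lt_le_trans bk. Qed.
Let e1 : 0 < D - k - alp. Proof. by rewrite subr_gt0. Qed.
Let e2 : 0 < b - bet. Proof. by rewrite subr_gt0. Qed.
Let gD : gam - D <= 0. Proof. by rewrite subr_le0 ltW. Qed.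
Let gD0 : gam - D != 0. Proof. by rewrite lt_eqF// subr_lt0. Qed.

Lemma ang_support_le u : 0 < 1 - u ^+ 2 -> u <= 1.
Proof. by move=> u1; have := @ang_support R (- u); rewrite sqrrN lerNl opprK; apply. Qed.

Lemma rho_le_add x y u : 0 <= x -> 0 <= y -> u <= 1 -> rho x y u <= x + y.
Proof.
move=> x0 y0 u1; rewrite /rho -[leRHS]ger0_norm ?addr_ge0// -sqrtr_sqr ler_wsqrtr//.
have : 0 <= x * y by rewrite mulr_ge0.
by nra.
Qed.

(* The kernel [rho x y u `^ (gam - D)] away from the diagonal. *)
Lemma rho_pow_far x y u : 0 < x -> 0 < y -> -1 <= u -> y <= x / 2 ->
  rho x y u `^ (gam - D) <= 2 `^ (D - gam) * x `^ (gam - D).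
Proof.
move=> x0 y0 u1 yx.
have rx : x / 2 <= rho x y u.
  by rewrite (le_trans _ (dist_le_rho (ltW x0) (ltW y0) u1))// ger0_norm; lra.
rewrite (le_trans (le0_ler_powR gD _ rx)) ?divr_gt0//.
rewrite powRM ?(ltW x0)// mulrC -powR_inv1// -powRrM.
by rewrite (_ : -1 * (gam - D) = D - gam) //; ring.
Qed.

Local Open Scope ereal_scope.

(** Centres must be positive in [morrey_density], so []0, r[] is covered by the ball of centre and
    radius [r], where [(x + r) ^ n = 2 ^ n r ^ n]. *)
Lemma morrey_density_init A q (g : R -> \bar R) r : morrey_density n A q g ->
  measurable_fun setT g -> (forall y, 0 <= g y) -> (0 < r)%R ->
  \int[half n]_y (if (y < r)%R then g y else 0) <=
  (2 `^ n * A * r `^ (D - q))%:E.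
Proof.
move=> mor mg g0 r0.
apply: (@le_trans _ _ (\int[half n]_y (if (`|y - r| < r)%R then g y else 0))).
  apply: integral_half_le.
  - by meas.
  - by apply: measurable_fun_ifT; [apply: measurable_fun_ltr; meas|meas|meas].
  - by move=> y; case: ifP.
  - by move=> y; case: ifP.
  - move=> y y0; case: ifPn => yr; last by case: ifP.
    by rewrite ifT// ltr_norml; apply/andP; split; lra.
apply: (le_trans (mor r r r0 r0)).
rewrite lee_fin -mulr2n -[(r *+ 2)%R]mulr_natl powRM ?(ltW r0)//.
have -> : (D - q = (1 - q) + n)%R by ring.
rewrite (@powRD _ r (1 - q) n) ?(gt_eqF r0) ?implybT//.
by rewrite le_eqVlt; apply/orP; left; apply/eqP; ring.
Qed.

Lemma morrey_init : exists2 C, (0 < C)%R & forall H, morrey n p k H ->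
  forall r, (0 < r)%R ->
  \int[half n]_y (if (y < r)%R then (H y)%:E else 0) <= (C * r `^ (D - k))%:E.
Proof.
exists (2 `^ n * 2 + 2 `^ n)%R; first by rewrite addr_gt0// ?mulr_gt0 ?powR_gt0.
move=> H [mH H0 mor] r r0.
have m1 : measurable_fun setT (fun y => if (y < r)%R then 1 else 0 : \bar R) by meas.
have M0 : (0 < 2 `^ n * 2 * r `^ D)%R by rewrite !mulr_gt0 ?powR_gt0.
have wM : \int[half n]_y (if (y < r)%R then 1 else 0 : \bar R) <= (2 `^ n * 2 * r `^ D)%:E.
  have := morrey_density_init (morrey_density1 n0) (measurable_cst _) (fun=> lee01) r0.
  by rewrite subr0.
have w0 y : 0 <= (if (y < r)%R then 1 else 0 : \bar R) by case: ifP.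
pose l : R := (r `^ (- k))%R; have l0 : (0 < l)%R by exact: powR_gt0.
have := integral_young m1 w0 mH H0 (ltW p1) wM l0.
rewrite (eq_integral (fun y => if (y < r)%R then (H y)%:E else 0)); last first.
  by move=> y _; case: ifP; rewrite ?mul1e ?mul0e.
rewrite [X in _ <= _ + _ * X](eq_integral (fun y => if (y < r)%R then (H y `^ p)%:E else 0)); last first.
  by move=> y _; case: ifP; rewrite ?mul1e ?mul0e.
move=> /le_trans; apply.
have mHp : measurable_fun setT (fun y => (H y `^ p)%:E) by meas.
have Hp0 y : 0 <= (H y `^ p)%:E by rewrite lee_fin powR_ge0.
have lp0 : 0 <= (l `^ (1 - p))%:E by rewrite lee_fin powR_ge0.
have h := morrey_density_init mor mHp Hp0 r0.
apply: (le_trans (leeD2l _ (lee_wpmul2l lp0 h))).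
rewrite -EFinM -EFinD lee_fin /l -powRrM mulr1.
have -> : (r `^ (- k * (1 - p)) * (2 `^ n * r `^ (D - k * p)) = 2 `^ n * r `^ (D - k))%R.
  rewrite mulrCA -powRD; last by rewrite (gt_eqF r0) implybT.
  by congr (_ * _ `^ _)%R; ring.
rewrite (@powRD _ r D) ?(gt_eqF r0) ?implybT//.
by rewrite le_eqVlt; apply/orP; left; apply/eqP; ring.
Qed.

Lemma integral_pol_fst (g : R -> \bar R) : measurable_fun setT g ->
  (forall y, 0 <= g y) ->
  \int[pol n]_t g t.1 = (\int[ang n]_u 1) * \int[half n]_y g y.
Proof.
move=> mg g0; rewrite integral_pol//; last first.
  by apply: measurable_fun_comp1 => //; meas.
rewrite -ge0_integralZl//; last by apply: integral_ge0.
apply: eq_integral => y _.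
by rewrite -ge0_integralZr//; apply: eq_integral => u _; rewrite mul1e.
Qed.

(** The angular mean of the weighted kernel seen from the point [1]. By homogeneity it governs every
    point [z], with [l = y / z]. *)
Definition dilation_kernel l : \bar R :=
  \int[ang n]_u (l `^ (- alp) * rho 1 l u `^ (gam - D))%:E.

Lemma dilation_kernel_ge0 l : 0 <= dilation_kernel l.
Proof. by apply: integral_ge0 => u _; rewrite lee_fin mulr_ge0 ?powR_ge0. Qed.

Lemma measurable_dilation_kernel : measurable_fun setT dilation_kernel.
Proof.
have mr := measurable_rho_fst (1 : R).
apply: (measurable_fun_ang _ (f := fun t : R * R =>
  (t.1 `^ (- alp) * rho 1 t.1 t.2 `^ (gam - D))%:E)); first by meas.
by move=> t; rewrite lee_fin mulr_ge0 ?powR_ge0.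
Qed.

(** For [l < 1 / 2] the factor in [rho] is bounded and [l ^ (- alp - k)] is integrable because
    [alp < D - k]. For [l >= 2] one has [rho >= l / 2], and by [kb] the integrand is of order
    [l ^ (- D - (b - bet))], integrable because [bet < b]. In between the powers of [l] are bounded,
    [rho < 4], and [rho ^ (gam - D)] is integrable because [gam > 0]. *)
Lemma dilation_kernel_integrable : exists2 M, (0 < M)%R &
  \int[half n]_l (dilation_kernel l * (l `^ (- k))%:E) <= M%:E.
Proof.
have [C1 C10 tot] := integral_ang1 n0.
have [C2 C20 small] := integral_pol_small n0 gam0.
pose G := (2 `^ (D - gam) : R)%R.
have G0 : (0 < G)%R by exact: powR_gt0.
pose K := (2 `^ `|- alp - k| : R)%R.
have K0 : (0 < K)%R by exact: powR_gt0.
have mr := measurable_rho_fst (1 : R).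
have init r : (0 < r)%R -> \int[half n]_y (if (y < r)%R then cst 1 y else 0) <=
    (2 `^ n * 2 * r `^ D)%:E.
  move=> r0; have := morrey_density_init (morrey_density1 n0) (measurable_cst _) (fun=> lee01) r0.
  by rewrite subr0.
have A0 : (0 <= 2 `^ n * 2 :> R)%R by rewrite mulr_ge0 ?powR_ge0.
have half0 : (0 < 2^-1 :> R)%R by rewrite invr_gt0.
have two0 : (0 < 2 :> R)%R by [].
have near0 := @integral_small_shells _ _ _ (half n) id (cst 1) _ _ (@measurable_id _ _ setT)
  (measurable_cst _) (fun=> lee01) A0 init _ _ e1 half0.
have nearoo := @integral_large_shells _ _ _ (half n) id (cst 1) _ _ (@measurable_id _ _ setT)
  (measurable_cst _) (fun=> lee01) A0 init _ _ e2 two0.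
set B1 := (X in _ <= X%:E) in near0; set B2 := (X in _ <= X%:E) in nearoo.
clearbody B1 B2.
pose f1 y : \bar R := if (0 < y < 2^-1)%R then (y `^ (D - k - alp - D))%:E * 1 else 0.
pose f2 y : \bar R := if (2 <= y)%R then (y `^ (- D - (b - bet)))%:E * 1 else 0.
pose f3 (t : R * R) : \bar R := if (0 < rho 1 t.1 t.2 < 4)%R then
  (rho 1 t.1 t.2 `^ (gam - D))%:E else 0.
have mf1 : measurable_fun setT f1 by rewrite /f1; meas.
have mf2 : measurable_fun setT f2 by rewrite /f2; meas.
have mf3 : measurable_fun setT f3 by rewrite /f3; meas.
have f10 y : 0 <= f1 y.
  by rewrite /f1; case: ifP => // _; rewrite mule1 lee_fin powR_ge0.
have f20 y : 0 <= f2 y.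
  by rewrite /f2; case: ifP => // _; rewrite mule1 lee_fin powR_ge0.
have f30 t : 0 <= f3 t by rewrite /f3; case: ifP => // _; rewrite lee_fin powR_ge0.
pose f12 y := G%:E * (f1 y + f2 y).
have mf12 : measurable_fun setT f12 by rewrite /f12; meas.
have f120 y : 0 <= f12 y by rewrite mule_ge0 ?adde_ge0// lee_fin ltW.
pose T (t : R * R) :=
  (t.1 `^ (- alp) * rho 1 t.1 t.2 `^ (gam - D) * t.1 `^ (- k))%:E.
have mT : measurable_fun setT T by rewrite /T; meas.
have T0 t : 0 <= T t by rewrite lee_fin !mulr_ge0 ?powR_ge0.
have TE : \int[half n]_l (dilation_kernel l * (l `^ (- k))%:E) = \int[pol n]_t T t.
  rewrite integral_pol//; apply: eq_integral => l _.
  rewrite /dilation_kernel -ge0_integralZr//.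
  - have mrl : measurable_fun setT (fun u => rho 1 l u) by apply: measurable_rho; meas.
    by meas.
  - by move=> u _; rewrite lee_fin mulr_ge0 ?powR_ge0.
  - by rewrite lee_fin powR_ge0.
have bound l u : (0 < l)%R -> (0 < 1 - u ^+ 2)%R ->
    T (l, u) <= f12 l + K%:E * f3 (l, u).
  move=> l0 u1; have u2 := ang_support u1; have u3 := ang_support_le u1.
  have Kf0 : 0 <= K%:E * f3 (l, u) by rewrite mule_ge0// lee_fin ltW.
  have akl : (l `^ (- alp) * l `^ (- k) = l `^ (- alp - k))%R.
    by rewrite -powRD// (gt_eqF l0) implybT.
  rewrite /T/= mulrAC akl.
  have [l1|l1] := ltP l (2^-1)%R.
    rewrite -[leLHS]adde0 leeD// /f12 ge0_muleDr// -[leLHS]adde0 leeD//; last first.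
      by rewrite mule_ge0// lee_fin ltW.
    rewrite /f1 l0 l1/= mule1 -EFinM lee_fin mulrC.
    rewrite (_ : D - k - alp - D = - alp - k)%R; last by ring.
    rewrite ler_wpM2r ?powR_ge0//.
    have := @rho_pow_far 1 l u ltr01 l0 u2; rewrite powR1 mulr1; apply.
    by rewrite div1r ltW.
  have [l2|l2] := leP 2%R l.
    rewrite -[leLHS]adde0 leeD// /f12 ge0_muleDr// -[leLHS]add0e leeD//.
      by rewrite mule_ge0// lee_fin ltW.
    rewrite /f2 l2/= mule1 -EFinM lee_fin.
    rewrite (_ : - D - (b - bet) = (gam - D) + (- alp - k))%R; last by have := kb; lra.
    rewrite (@powRD _ l (gam - D)) ?(gt_eqF l0) ?implybT// mulrA [leLHS]mulrC ler_wpM2r ?powR_ge0//.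
    by rewrite rhoC rho_pow_far//; lra.
  have [r1|r1] := leP (rho 1 l u) 0%R.
    have -> : rho 1 l u = 0%R by apply/eqP; rewrite eq_le r1 rho_ge0.
    by rewrite powR0// mulr0 adde_ge0.
  rewrite -[leLHS]add0e leeD// /f3/= r1/= ifT; last first.
    by rewrite (le_lt_trans (rho_le_add ler01 (ltW l0) u3))//; lra.
  rewrite -EFinM lee_fin ler_wpM2r ?powR_ge0//.
  have := @powR_comparable R (- alp - k) l 1 2.
  by rewrite powR1 !mulr1; apply => //; lra.
(* Only [B1, B2 >= 0] is recovered from the integrals they bound; the final [+ 1] makes the
   positivity strict. *)
exists (C1 * (G * (B1 + B2)) + K * (C2 * 4 `^ gam) + 1)%R.
  have B10 : (0 <= B1)%R.
    by rewrite -lee_fin; apply: le_trans near0; apply: integral_ge0 => y _; exact: f10.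
  have B20 : (0 <= B2)%R.
    by rewrite -lee_fin; apply: le_trans nearoo; apply: integral_ge0 => y _; exact: f20.
  by rewrite ltr_wpDl// addr_ge0 ?mulr_ge0 ?addr_ge0 ?powR_ge0 ?(ltW C10) ?(ltW G0) ?(ltW K0) ?(ltW C20).
rewrite TE.
apply: (@le_trans _ _ (\int[pol n]_t (f12 t.1 + K%:E * f3 t))).
  apply: integral_pol_le => //.
  - apply: emeasurable_funD; last by meas.
    by apply: measurable_fun_comp1 => //; meas.
  - by move=> t; rewrite adde_ge0// mule_ge0// lee_fin ltW.
rewrite ge0_integralD//; last 3 first.
- by apply: measurable_fun_comp1 => //; meas.
- by move=> t _; rewrite mule_ge0// lee_fin ltW.
- by meas.
rewrite ge0_integralZl//; last by rewrite lee_fin ltW.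
have I12 : \int[half n]_y f12 y = G%:E * (\int[half n]_y f1 y + \int[half n]_y f2 y).
  have GE0 : 0 <= G%:E by rewrite lee_fin ltW.
  rewrite /f12 (ge0_integralZl (half n) measurableT (emeasurable_funD mf1 mf2)
    (fun y _ => adde_ge0 (f10 y) (f20 y)) GE0).
  by rewrite (ge0_integralD (half n) measurableT (fun y _ => f10 y) mf1 (fun y _ => f20 y) mf2).
rewrite (integral_pol_fst mf12 f120) I12.
apply: (@le_trans _ _ (C1%:E * (G%:E * (B1%:E + B2%:E)) + K%:E * (C2 * 4 `^ gam)%:E)).
  apply: leeD.
    apply: lee_pmul => //.
    - exact: integral_ge0.
    - by rewrite mule_ge0 ?lee_fin ?(ltW G0)// adde_ge0//; exact: integral_ge0.
    - by rewrite lee_wpmul2l ?lee_fin ?(ltW G0)// leeD.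
  by rewrite lee_wpmul2l ?lee_fin ?(ltW K0)// small.
by rewrite -(EFinD B1) -(EFinM G) -(EFinM C1) -(EFinM K) -EFinD lee_fin lerDl.
Qed.

End weighted_potential.

Section weighted_potential_bound.
Context {R : realType}.
Variables n gam alp bet p k b s : R.
Hypothesis n0 : 0 < n.
Hypothesis gam0 : 0 < gam.
Hypothesis gamD : gam < n + 1.
Hypothesis ab0 : 0 <= alp + bet.
Hypothesis kb : k - b = gam - alp - bet.
Hypothesis bk : b <= k.
Hypothesis b0 : 0 < b.
Hypothesis p1 : 1 < p.
Hypothesis s1 : 1 < s.
Hypothesis bs : b * s = k * p.
Hypothesis alpk : alp < n + 1 - k.
Hypothesis betb : bet < b.
Local Notation D := (n + 1).
Implicit Types (H : R -> R) (x y z u h r l : R).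

Let p0 : 0 < p. Proof. exact: lt_trans p1. Qed.
Let s0 : 0 < s. Proof. exact: lt_trans s1. Qed.
Let k0 : 0 < k. Proof. exact: lt_le_trans bk. Qed.
Let e1 : 0 < D - k - alp. Proof. by rewrite subr_gt0. Qed.
Let e2 : 0 < b - bet. Proof. by rewrite subr_gt0. Qed.
Let gD0 : gam - D != 0. Proof. by rewrite lt_eqF// subr_lt0. Qed.
Local Open Scope ereal_scope.

Lemma eq_integral_half (m : R) (f g : R -> \bar R) :
  measurable_fun setT f -> measurable_fun setT g ->
  (forall y, 0 <= f y) -> (forall y, 0 <= g y) ->
  (forall y, (0 < y)%R -> f y = g y) -> \int[half m]_y f y = \int[half m]_y g y.
Proof.
move=> mf mg f0 g0 fg; apply/eqP; rewrite eq_le.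
by apply/andP; split; apply: integral_half_le => // y y0; rewrite fg.
Qed.

Lemma poweR_addr_le (x y : \bar R) (q : R) : (0 <= q)%R -> 0 <= x -> 0 <= y ->
  (x + y) `^ q <= (2 `^ q)%:E * (x `^ q + y `^ q).
Proof.
move=> q0; wlog xy : x y / x <= y.
  move=> h x0' y0'; have [xy|yx] := leP x y; first exact: h.
  by rewrite addeC [X in _ * X]addeC; apply: h => //; exact: ltW.
move=> x0' y0'; have pq : 0 <= (2 `^ q)%:E :> \bar R by rewrite lee_fin powR_ge0.
apply: (@le_trans _ _ ((2%:E * y) `^ q)).
  apply: gt0_ler_poweR => //.
  - by rewrite in_itv/= leey adde_ge0.
  - by rewrite in_itv/= leey mule_ge0.
  - by rewrite mule_natl mule2n leeD.
by rewrite poweRM// poweR_EFin lee_wpmul2l// leeDr// poweR_ge0.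
Qed.

Definition potential_density H z (t : R * R) : \bar R :=
  (t.1 `^ (- alp) * H t.1 * rho z t.1 t.2 `^ (gam - D))%:E.

Definition weighted_potential H z : \bar R :=
  (z `^ (- bet))%:E * \int[pol n]_t potential_density H z t.

Lemma measurable_potential_density H : measurable_fun setT H ->
  measurable_fun setT (fun q : R * (R * R) => potential_density H q.1 q.2).
Proof.
move=> mH; rewrite /potential_density.
have mr : measurable_fun setT (fun q : R * (R * R) => rho q.1 q.2.1 q.2.2).
  by apply: measurable_rho; meas.
by meas.
Qed.

Lemma measurable_potential_section H z : measurable_fun setT H ->
  measurable_fun setT (potential_density H z).
Proof.
by move=> mH; rewrite /potential_density; have mr := measurable_rho_fst z; meas.
Qed.

Lemma potential_density_ge0 H z t : (forall y, 0 <= H y)%R ->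
  0 <= potential_density H z t.
Proof. by move=> H0; rewrite lee_fin !mulr_ge0 ?powR_ge0. Qed.

Lemma measurable_weighted_potential H : measurable_fun setT H ->
  (forall y, 0 <= H y)%R -> measurable_fun setT (weighted_potential H).
Proof.
move=> mH H0; apply: emeasurable_funM; first by meas.
apply: (@measurable_pol_section R n (fun q : R * (R * R) => potential_density H q.1 q.2)).
  exact: measurable_potential_density.
by move=> t; exact: potential_density_ge0.
Qed.

Lemma weighted_potential_ge0 H z : (forall y, 0 <= H y)%R ->
  0 <= weighted_potential H z.
Proof.
move=> H0; rewrite mule_ge0 ?lee_fin ?powR_ge0//; apply: integral_ge0 => t _.
exact: potential_density_ge0.
Qed.

(** Substituting [y = z l] brings out the powers [- bet], [n + 1], [- alp] and [gam - D] of [z],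
    which add up to [k - b]. For [b = k] the potential is exactly a mean of dilates. *)
Lemma weighted_potentialE H z : measurable_fun setT H -> (forall y, 0 <= H y)%R ->
  (0 < z)%R -> weighted_potential H z =
  (z `^ (k - b))%:E * dilation_mean n (dilation_kernel n gam alp) H z.
Proof.
move=> mH H0 z0; rewrite /weighted_potential.
have mP : measurable_fun setT (potential_density H z).
  exact: measurable_potential_section.
have P0 t := potential_density_ge0 z t H0.
rewrite integral_pol// (integral_half_dilate n z0); last 2 first.
- exact: measurable_fun_ang.
- by move=> y; apply: integral_ge0.
have mK := measurable_dilation_kernel n gam alp.
have K0 := dilation_kernel_ge0 n gam alp.
have mKH : measurable_fun setT (fun l => dilation_kernel n gam alp l * (H (z * l)%R)%:E).
  by meas.
have KH0 l : 0 <= dilation_kernel n gam alp l * (H (z * l)%R)%:E.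
  by rewrite mule_ge0// lee_fin.
rewrite (_ : \int[half n]_y _ = (z `^ (gam - D - alp))%:E *
    dilation_mean n (dilation_kernel n gam alp) H z).
  rewrite !muleA -!EFinM -!powRD ?(gt_eqF z0) ?implybT//.
  by congr ((_ `^ _)%:E * _); rewrite kb; ring.
rewrite -ge0_integralZl//; last by rewrite lee_fin powR_ge0.
have mzl : measurable_fun setT (fun y => \int[ang n]_u potential_density H z ((z * y)%R, u)).
  by apply: (measurable_fun_comp1 (measurable_fun_ang n mP P0)); meas.
have zl0 y : 0 <= \int[ang n]_u potential_density H z ((z * y)%R, u).
  exact: integral_ge0.
pose c := (z `^ (gam - D - alp))%:E.
have c0 : 0 <= c by rewrite lee_fin powR_ge0.
have mc : measurable_fun setT (fun l => c * (dilation_kernel n gam alp l * (H (z * l)%R)%:E)).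
  by apply: emeasurable_funM; meas.
have cK0 l : 0 <= c * (dilation_kernel n gam alp l * (H (z * l)%R)%:E).
  exact: mule_ge0.
apply: (eq_integral_half n mzl mc zl0 cK0) => l l0.
have mr : measurable_fun setT (fun u => rho 1 l u) by apply: measurable_rho; meas.
rewrite muleCA /dilation_kernel.
rewrite -ge0_integralZr//; last 3 first.
- by meas.
- by move=> u _; rewrite lee_fin mulr_ge0 ?powR_ge0.
- by rewrite -EFinM lee_fin mulr_ge0 ?powR_ge0.
apply: eq_integral => u _; rewrite /potential_density/= -!EFinM; congr (_%:E).
rewrite rho_dilate// !powRM ?(ltW z0) ?(ltW l0) ?rho_ge0//.
rewrite (@powRD _ z (gam - D)) ?(gt_eqF z0) ?implybT//; ring.
Qed.

Definition near_diagonal z y := (z / 2 <= y)%R && (y < 2 * z)%R.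

Definition far_potential H z : \bar R :=
  (z `^ (- bet))%:E * \int[pol n]_t
    (if near_diagonal z t.1 then 0 else potential_density H z t).

(** Near the diagonal [y ^ (- alp)] is comparable to [z ^ (- alp)], and [rho <= 3 z] allows
    [rho ^ (gam - D)] to be split as [rho ^ (alp + bet) rho ^ (k - b - D)] with the first factor at
    most [(3 z) ^ (alp + bet)], since [alp + bet >= 0]. The powers of [z] cancel against
    [z ^ (- bet)]. *)
Lemma weighted_potential_near : (b < k)%R -> exists2 K, (0 < K)%R & forall H,
  measurable_fun setT H -> (forall y, 0 <= H y)%R -> forall z, (0 < z)%R ->
  weighted_potential H z <= K%:E * frac_integral n k b H z + far_potential H z.
Proof.
move=> bk'; exists (2 `^ `|- alp| * 3 `^ (alp + bet))%R; first by rewrite mulr_gt0 ?powR_gt0.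
set K := (_ * _)%R; have K0 : (0 <= K)%R by rewrite mulr_ge0 ?powR_ge0.
move=> H mH H0 z z0.
have mr := measurable_rho_fst z.
have mP : measurable_fun setT (potential_density H z).
  exact: measurable_potential_section.
have P0 t := potential_density_ge0 z t H0.
have mnear : measurable_fun setT (fun t : R * R => near_diagonal z t.1).
  by rewrite /near_diagonal; meas.
pose F (t : R * R) : \bar R := (rho z t.1 t.2 `^ (k - b - D) * H t.1)%:E.
have mF : measurable_fun setT F by rewrite /F; meas.
have F0 t : 0 <= F t by rewrite lee_fin mulr_ge0 ?powR_ge0.
pose L := (K * z `^ bet)%R.
have L0 : 0 <= L%:E by rewrite lee_fin mulr_ge0 ?powR_ge0.
have zb0 : 0 <= (z `^ (- bet))%:E by rewrite lee_fin powR_ge0.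
have mfar : measurable_fun setT (fun t => if near_diagonal z t.1 then 0 else potential_density H z t).
  by apply: measurable_fun_ifT => //; meas.
have far0 t : 0 <= (if near_diagonal z t.1 then 0 else potential_density H z t).
  by case: ifP.
apply: (@le_trans _ _ ((z `^ (- bet))%:E * \int[pol n]_t
  (L%:E * F t + (if near_diagonal z t.1 then 0 else potential_density H z t)))).
  apply: lee_wpmul2l => //; apply: integral_pol_le => //.
  - by apply: emeasurable_funD => //; apply: emeasurable_funM; meas.
  - by move=> t; rewrite adde_ge0// mule_ge0.
  move=> y u y0 u1; have u2 := ang_support_le u1.
  case: ifPn => [/andP[/= zy yz]|_]; last by rewrite leeDr// mule_ge0.
  rewrite adde0 /potential_density /F/= -EFinM lee_fin.
  have [r1|r1] := leP (rho z y u) 0%R.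
    have -> : rho z y u = 0%R by apply/eqP; rewrite eq_le r1 rho_ge0.
    by rewrite powR0// mulr0 !mulr_ge0 ?powR_ge0.
  have -> : (gam - D = (alp + bet) + (k - b - D))%R by rewrite kb; ring.
  rewrite powRD ?(gt_eqF r1) ?implybT//.
  rewrite (_ : _ * _ * _ = (y `^ (- alp) * rho z y u `^ (alp + bet)) *
    (rho z y u `^ (k - b - D) * H y))%R; last by ring.
  rewrite ler_wpM2r ?mulr_ge0 ?powR_ge0// /L /K.
  have h1 : (y `^ (- alp) <= 2 `^ `|- alp| * z `^ (- alp))%R.
    by apply: powR_comparable => //; lra.
  have h2 : (rho z y u `^ (alp + bet) <= (3 * z) `^ (alp + bet))%R.
    apply: ge0_ler_powR; rewrite ?nnegrE ?rho_ge0//; first by lra.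
    by apply: (le_trans (rho_le_add (ltW z0) (ltW y0) u2)); lra.
  apply: (le_trans (ler_pM (powR_ge0 _ _) (powR_ge0 _ _) h1 h2)).
  rewrite powRM ?(ltW z0)// (_ : z `^ bet = z `^ (- alp) * z `^ (alp + bet))%R.
    by rewrite le_eqVlt; apply/orP; left; apply/eqP; ring.
  by rewrite -powRD ?(gt_eqF z0) ?implybT//; congr (_ `^ _)%R; ring.
rewrite ge0_integralD//; last 2 first.
- by move=> t _; rewrite mule_ge0.
- by apply: emeasurable_funM; meas.
have I0 : 0 <= \int[pol n]_t F t by apply: integral_ge0.
have J0 : 0 <= \int[pol n]_t (if near_diagonal z t.1 then 0 else potential_density H z t).
  by apply: integral_ge0.
rewrite ge0_integralZl// ge0_muleDr ?mule_ge0//; apply: leeD => //.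
rewrite muleA -EFinM /L mulrCA -powRD ?(gt_eqF z0) ?implybT// addNr powRr0 mulr1.
by [].
Qed.

(** For [y < z / 2] the kernel is at most a multiple of [z ^ (gam - D)], and the shells at [0] give
    [z ^ (D - k - alp)]. For [y >= 2 z] it is at most a multiple of [y ^ (gam - D)], and the shells
    at infinity give [z ^ (bet - b)]. By [kb] both are [z ^ (bet - b)]. *)
Lemma far_potential_le : exists2 C, (0 < C)%R & forall H, morrey n p k H ->
  forall z, (0 < z)%R -> far_potential H z <= (C * z `^ (- b))%:E.
Proof.
have [C1 C10 tot] := integral_ang1 n0.
have [C2 C20 init] := @morrey_init R n p k n0 p1.
pose G := (2 `^ (D - gam) : R)%R.
have G0 : (0 < G)%R by exact: powR_gt0.
pose A1 := (small_const (D - k) (D - k - alp) * C2 * 2^-1 `^ (D - k - alp))%R.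
pose A2 := (large_const (D - k) (b - bet) * C2 * 2 `^ (- (b - bet)))%R.
have A10 : (0 < A1)%R.
  by apply: mulr_gt0; [apply: mulr_gt0 => //; exact: small_const_gt0|rewrite powR_gt0].
have A20 : (0 < A2)%R.
  by apply: mulr_gt0; [apply: mulr_gt0 => //; exact: large_const_gt0|rewrite powR_gt0].
exists (C1 * (G * (A1 + A2)))%R; first by rewrite !mulr_gt0// addr_gt0.
move=> H mor z z0; have [mH H0 _] := mor.
have mr := measurable_rho_fst z.
have mHE : measurable_fun setT (fun y => (H y)%:E) by meas.
have HE0 y : 0 <= (H y)%:E by rewrite lee_fin.
have z20 : (0 < 2^-1 * z)%R by rewrite mulr_gt0// invr_gt0.
have z21 : (0 < 2 * z)%R by rewrite mulr_gt0.
have near0 := @integral_small_shells _ _ _ (half n) id _ _ _ (@measurable_id _ _ setT)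
  mHE HE0 (ltW C20) (init H mor) _ _ e1 z20.
have nearoo := @integral_large_shells _ _ _ (half n) id _ _ _ (@measurable_id _ _ setT)
  mHE HE0 (ltW C20) (init H mor) _ _ e2 z21.
rewrite -/(small_const (D - k) (D - k - alp)) in near0.
rewrite -/(large_const (D - k) (b - bet)) in nearoo.
pose f1 y : \bar R := if (0 < y < 2^-1 * z)%R then (y `^ (D - k - alp - (D - k)))%:E * (H y)%:E else 0.
pose f2 y : \bar R := if (2 * z <= y)%R then (y `^ (- (D - k) - (b - bet)))%:E * (H y)%:E else 0.
have mf1 : measurable_fun setT f1 by rewrite /f1; meas.
have mf2 : measurable_fun setT f2 by rewrite /f2; meas.
have f10 y : 0 <= f1 y.
  by rewrite /f1; case: ifP => // _; rewrite mule_ge0// lee_fin powR_ge0.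
have f20 y : 0 <= f2 y.
  by rewrite /f2; case: ifP => // _; rewrite mule_ge0// lee_fin powR_ge0.
pose S := (z `^ (gam - D))%R.
have S0 : 0 <= S%:E by rewrite lee_fin powR_ge0.
have GE0 : 0 <= G%:E by rewrite lee_fin ltW.
pose f12 y := G%:E * (S%:E * f1 y + f2 y).
have msf1 : measurable_fun setT (fun y => S%:E * f1 y) by apply: emeasurable_funM; meas.
have ms : measurable_fun setT (fun y => S%:E * f1 y + f2 y) by apply: emeasurable_funD; meas.
have mf12 : measurable_fun setT f12 by rewrite /f12; apply: emeasurable_funM; meas.
have f120 y : 0 <= f12 y by rewrite mule_ge0// adde_ge0// mule_ge0.
have mP : measurable_fun setT (potential_density H z).
  exact: measurable_potential_section.
have P0 t := potential_density_ge0 z t H0.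
have mnear : measurable_fun setT (fun t : R * R => near_diagonal z t.1).
  by rewrite /near_diagonal; meas.
have zb0 : 0 <= (z `^ (- bet))%:E by rewrite lee_fin powR_ge0.
apply: (@le_trans _ _ ((z `^ (- bet))%:E * \int[pol n]_t f12 t.1)).
  apply: lee_wpmul2l => //; apply: integral_pol_le => //.
  - by apply: measurable_fun_ifT => //; meas.
  - by apply: measurable_fun_comp1 => //; meas.
  - by move=> t; case: ifP.
  move=> y u y0 u1; have u2 := ang_support u1; rewrite /near_diagonal/=.
  have [zy|yz] := leP (z / 2)%R y => /=; last first.
    rewrite /f12 ge0_muleDr ?mule_ge0// -[leLHS]adde0 leeD ?mule_ge0//.
    rewrite /f1 y0 [(2^-1 * z)%R]mulrC yz/= /potential_density/= -!EFinM lee_fin.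
    rewrite (_ : D - k - alp - (D - k) = - alp)%R; last by ring.
    rewrite [leRHS]mulrA mulrC ler_wpM2r ?mulr_ge0 ?powR_ge0//.
    by rewrite /G /S rho_pow_far//; exact: ltW.
  case: ifPn => [_|]; first exact: f120.
  rewrite -leNgt => yz; rewrite /f12 ge0_muleDr ?mule_ge0// -[leLHS]add0e leeD ?mule_ge0//.
  rewrite /f2 yz /potential_density/= -!EFinM lee_fin.
  rewrite (_ : - (D - k) - (b - bet) = (gam - D) - alp)%R; last by have := kb; lra.
  rewrite (@powRD _ y (gam - D)) ?(gt_eqF y0) ?implybT//.
  rewrite (_ : G * _ = y `^ (- alp) * H y * (G * y `^ (gam - D)))%R; last by ring.
  rewrite ler_wpM2l ?mulr_ge0 ?powR_ge0//.
  by rewrite rhoC rho_pow_far//; lra.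
have I12 : \int[half n]_y f12 y = G%:E * (S%:E * \int[half n]_y f1 y + \int[half n]_y f2 y).
  rewrite /f12 ge0_integralZl//; last by move=> y _; rewrite adde_ge0// mule_ge0.
  congr (_ * _); rewrite ge0_integralD//; last by move=> y _; rewrite mule_ge0.
  by congr (_ + _); rewrite ge0_integralZl.
rewrite (integral_pol_fst n mf12 f120) I12.
have I10 : 0 <= \int[half n]_y f1 y by apply: integral_ge0.
have I20 : 0 <= \int[half n]_y f2 y by apply: integral_ge0.
have Z0 : 0 <= \int[ang n]_u (1 : \bar R) by apply: integral_ge0.
(* The integrals are replaced by variables; what is left is arithmetic with their bounds. *)
suff key (I1 I2 Z : \bar R) : 0 <= I1 -> 0 <= I2 -> 0 <= Z -> Z <= C1%:E ->
    I1 <= (small_const (D - k) (D - k - alp) * C2 * (2^-1 * z) `^ (D - k - alp))%:E ->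
    I2 <= (large_const (D - k) (b - bet) * C2 * (2 * z) `^ (- (b - bet)))%:E ->
    (z `^ (- bet))%:E * (Z * (G%:E * (S%:E * I1 + I2))) <=
    (C1 * (G * (A1 + A2)) * z `^ (- b))%:E.
  exact (key _ _ _ I10 I20 Z0 tot near0 nearoo).
move=> J10 J20 Zp ZC J1 J2.
apply: (@le_trans _ _ ((z `^ (- bet))%:E * (C1%:E * (G%:E * (A1 * z `^ (bet - b) + A2 * z `^ (bet - b))%:E)))).
  apply: lee_wpmul2l => //; apply: lee_pmul => //.
    by rewrite mule_ge0// adde_ge0// mule_ge0.
  apply: lee_wpmul2l => //; rewrite EFinD; apply: leeD.
    apply: (le_trans (lee_wpmul2l S0 J1)); rewrite -EFinM lee_fin /A1 /S.
    rewrite powRM ?invr_ge0 ?(ltW z0)//.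
    rewrite (_ : bet - b = (gam - D) + (D - k - alp))%R; last by have := kb; lra.
    rewrite (@powRD _ z (gam - D)) ?(gt_eqF z0) ?implybT//.
    by rewrite le_eqVlt; apply/orP; left; apply/eqP; ring.
  apply: (le_trans J2); rewrite lee_fin /A2 powRM ?(ltW z0)//.
  rewrite (_ : bet - b = - (b - bet))%R; last by ring.
  by rewrite le_eqVlt; apply/orP; left; apply/eqP; ring.
rewrite -!EFinM lee_fin.
rewrite (_ : z `^ (- b) = z `^ (- bet) * z `^ (bet - b))%R.
  by rewrite le_eqVlt; apply/orP; left; apply/eqP; ring.
by rewrite -powRD ?(gt_eqF z0) ?implybT//; congr (_ `^ _)%R; ring.
Qed.

(** The interpolation: in [v ^ s = v ^ (s - p) v ^ p] the first factor takes the pointwise bound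
    [C z ^ (- b)], the second the bound [z ^ (k - b)] times the mean of dilates. The exponent of [z]
    is [k p - b s = 0]. *)
Lemma far_potential_pow : (b < k)%R -> exists2 C, (0 < C)%R & forall H, morrey n p k H ->
  forall z, (0 < z)%R -> far_potential H z `^ s <=
    C%:E * dilation_mean n (dilation_kernel n gam alp) H z `^ p.
Proof.
move=> bk'; have [C C0 far] := far_potential_le.
exists (C `^ (s - p))%R; first exact: powR_gt0.
move=> H mor z z0; have [mH H0 _] := mor.
have h1 := far H mor z z0.
have mP : measurable_fun setT (potential_density H z).
  exact: measurable_potential_section.
have P0 t := potential_density_ge0 z t H0.
have mnear : measurable_fun setT (fun t : R * R => near_diagonal z t.1).
  by rewrite /near_diagonal; meas.
have F0 : 0 <= far_potential H z.
  rewrite mule_ge0 ?lee_fin ?powR_ge0//; apply: integral_ge0 => t _.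
  by case: ifP.
have h2 : far_potential H z <=
    (z `^ (k - b))%:E * dilation_mean n (dilation_kernel n gam alp) H z.
  rewrite -weighted_potentialE//; apply: lee_wpmul2l; first by rewrite lee_fin powR_ge0.
  apply: integral_ge0_le => //.
  - by apply: measurable_fun_ifT => //; meas.
  - by move=> t; case: ifP.
  - by move=> t; case: ifP.
(* From [b < k] and [b s = k p]. *)
have sp : (p < s)%R.
  have : (b * p < b * s)%R by rewrite bs ltr_pM2r.
  by rewrite ltr_pM2l.
have M0 : 0 <= dilation_mean n (dilation_kernel n gam alp) H z.
  apply: integral_ge0 => l _; rewrite mule_ge0 ?lee_fin//.
  exact: dilation_kernel_ge0.
move: h2 M0; case: (dilation_mean _ _ _ _) => [m| |] //; last first.
  by move=> _ _; rewrite poweRyr ?gt_eqF// gt0_muley ?leey// lte_fin powR_gt0.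
move: F0 h1; case: (far_potential H z) => [v| |] //.
rewrite !poweR_EFin -!EFinM !lee_fin => v0 vC vm m0.
have [v1|v1] := leP v 0%R.
  have -> : v = 0%R by apply/eqP; rewrite eq_le v1.
  by rewrite powR0 ?gt_eqF// mulr_ge0 ?powR_ge0.
rewrite (_ : v `^ s = v `^ (s - p) * v `^ p)%R; last first.
  by rewrite -powRD ?(gt_eqF v1) ?implybT//; congr (_ `^ _)%R; ring.
have h3 : (v `^ (s - p) <= (C * z `^ (- b)) `^ (s - p))%R.
  by apply: ge0_ler_powR; rewrite ?nnegrE ?mulr_ge0 ?powR_ge0 ?subr_ge0 ?(ltW sp) ?(ltW C0).
have h4 : (v `^ p <= (z `^ (k - b) * m) `^ p)%R.
  by apply: ge0_ler_powR; rewrite ?nnegrE ?mulr_ge0 ?powR_ge0// ltW.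
apply: (le_trans (ler_pM (powR_ge0 _ _) (powR_ge0 _ _) h3 h4)).
rewrite !powRM ?powR_ge0 ?(ltW C0)// -!powRrM.
rewrite (_ : C `^ (s - p) * _ * _ = C `^ (s - p) * m `^ p *
  (z `^ (- b * (s - p)) * z `^ ((k - b) * p)))%R; last by ring.
rewrite -powRD ?(gt_eqF z0) ?implybT//.
rewrite (_ : - b * (s - p) + (k - b) * p = 0)%R ?powRr0 ?mulr1//.
have -> : (- b * (s - p) + (k - b) * p = k * p - b * s)%R by ring.
by rewrite bs subrr.
Qed.

(** The case [b = k] is separate because the near-diagonal kernel would be [rho ^ (- D)], which is
    not integrable; there [s = p] and the mean of dilates alone gives the bound. *)
Theorem weighted_potential_ball : exists2 C, (0 < C)%R & forall H, morrey n p k H ->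
  forall x r, (0 < x)%R -> (0 < r)%R ->
    \int[half n]_z (if (`|z - x| < r)%R then weighted_potential H z `^ s else 0) <=
    (C * r `^ (1 - k * p) * (x + r) `^ n)%:E.
Proof.
have [M M0 kerM] := @dilation_kernel_integrable R n gam alp bet k b n0 gam0 gamD kb alpk betb.
have mK := measurable_dilation_kernel n gam alp.
have K0 := dilation_kernel_ge0 n gam alp.
have mball x r : measurable_fun setT (fun y => (`|y - x| < r)%R).
  by apply: measurable_fun_ltr; meas.
have dil H x r := @dilation_mean_ball R n p k _ M p1 mK K0 M0 kerM H x r.
move: (bk); rewrite le_eqVlt => /predU1P[bkE|bk'].
  have sp : s = p by apply: (mulfI (lt0r_neq0 b0)); rewrite bs bkE.
  exists (2 `^ p * M `^ p)%R; first by rewrite mulr_gt0 ?powR_gt0.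
  move=> H mor x r x0 r0; have [mH H0 _] := mor.
  apply: le_trans (dil H x r mor x0 r0).
  apply: integral_half_le.
  - apply: measurable_fun_ifT; [by meas| |by meas].
    by apply: measurable_fun_poweR; exact: measurable_weighted_potential.
  - apply: measurable_fun_ifT; [by meas| |by meas].
    by apply: measurable_fun_poweR; exact: measurable_dilation_mean.
  - by move=> y; case: ifP => // _; exact: poweR_ge0.
  - by move=> y; case: ifP => // _; exact: poweR_ge0.
  - move=> y y0; case: ifP => // _.
    by rewrite weighted_potentialE// bkE subrr powRr0 mul1e sp.
have kbD : (k - b < D)%R by have := (kb, ab0, gamD) => -[[? ?] ?]; lra.
have [C1 C10 frac] := frac_integral_ball n0 p1 b0 bk' kbD s1 bs.
have [K1 K10 near] := weighted_potential_near bk'.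
have [C2 C20 far] := far_potential_pow bk'.
pose L1 := (2 `^ s * K1 `^ s)%R; pose L2 := (2 `^ s * C2)%R.
have L10 : (0 < L1)%R by rewrite mulr_gt0 ?powR_gt0.
have L20 : (0 < L2)%R by rewrite mulr_gt0 ?powR_gt0.
exists (L1 * C1 + L2 * (2 `^ p * M `^ p))%R.
  by rewrite addr_gt0 ?mulr_gt0 ?powR_gt0.
move=> H mor x r x0 r0; have [mH H0 _] := mor.
pose f1 z := if (`|z - x| < r)%R then frac_integral n k b H z `^ s else 0.
pose f2 z := if (`|z - x| < r)%R then
  dilation_mean n (dilation_kernel n gam alp) H z `^ p else 0.
have mf1 : measurable_fun setT f1.
  rewrite /f1; apply: measurable_fun_ifT; [by meas| |by meas].
  by apply: measurable_fun_poweR; exact: measurable_frac_integral.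
have mf2 : measurable_fun setT f2.
  rewrite /f2; apply: measurable_fun_ifT; [by meas| |by meas].
  by apply: measurable_fun_poweR; exact: measurable_dilation_mean.
have f10 y : 0 <= f1 y by rewrite /f1; case: ifP => // _; exact: poweR_ge0.
have f20 y : 0 <= f2 y by rewrite /f2; case: ifP => // _; exact: poweR_ge0.
have L1E : 0 <= L1%:E by rewrite lee_fin ltW.
have L2E : 0 <= L2%:E by rewrite lee_fin ltW.
have mLf1 : measurable_fun setT (fun z => L1%:E * f1 z) by apply: emeasurable_funM; meas.
have mLf2 : measurable_fun setT (fun z => L2%:E * f2 z) by apply: emeasurable_funM; meas.
apply: (@le_trans _ _ (\int[half n]_z (L1%:E * f1 z + L2%:E * f2 z))).
  apply: integral_half_le.
  - apply: measurable_fun_ifT; [by meas| |by meas].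
    by apply: measurable_fun_poweR; exact: measurable_weighted_potential.
  - exact: emeasurable_funD.
  - by move=> y; case: ifP => // _; exact: poweR_ge0.
  - by move=> y; rewrite adde_ge0// mule_ge0.
  move=> z z0; rewrite /f1 /f2; case: ifP => _; last by rewrite !mule0 adde0.
  have W0 := weighted_potential_ge0 z H0.
  have fr0 : 0 <= frac_integral n k b H z.
    by apply: integral_ge0 => t _; rewrite lee_fin mulr_ge0 ?powR_ge0.
  have far0 : 0 <= far_potential H z.
    rewrite mule_ge0 ?lee_fin ?powR_ge0//; apply: integral_ge0 => t _.
    by case: ifP => // _; exact: potential_density_ge0.
  have K1E : 0 <= K1%:E by rewrite lee_fin ltW.
  have S0 : 0 <= K1%:E * frac_integral n k b H z + far_potential H z.
    by rewrite adde_ge0// mule_ge0.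
  apply: (@le_trans _ _ ((K1%:E * frac_integral n k b H z + far_potential H z) `^ s)).
    apply: gt0_ler_poweR; [exact: ltW|by rewrite in_itv/= leey W0|by rewrite in_itv/= leey S0|].
    exact: near.
  apply: (le_trans (poweR_addr_le (ltW s0) _ far0)); first by rewrite mule_ge0.
  rewrite ge0_muleDr ?poweR_ge0// poweRM// poweR_EFin muleA -EFinM; apply: leeD => //.
  rewrite /L2 EFinM -muleA; apply: lee_wpmul2l; first by rewrite lee_fin powR_ge0.
  exact: far.
rewrite ge0_integralD//; last 2 first.
- by move=> y _; rewrite mule_ge0.
- by move=> y _; rewrite mule_ge0.
rewrite !ge0_integralZl//.
apply: (le_trans (leeD (lee_wpmul2l L1E (frac H mor x r x0 r0))
  (lee_wpmul2l L2E (dil H x r mor x0 r0)))).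
rewrite -(EFinM L1) -(EFinM L2) -EFinD lee_fin.
by rewrite le_eqVlt; apply/orP; left; apply/eqP; ring.
Qed.

End weighted_potential_bound.

(** * The Dunkl translation *)

Section signed_integrals.
Context {R : realType}.
Implicit Types (n x y z u r : R).
Local Open Scope ereal_scope.

(** Multiplication by [w >= 0] commutes with taking positive and negative parts, so no integrability
    is asked for. *)
Lemma integral_density_EFin d (T : measurableType d) (mu : {measure set T -> \bar R})
    (w : T -> R) (mw : measurable_fun setT w) (w0 : forall t, (0 <= w t)%R) (f : T -> R) :
  measurable_fun setT f ->
  \int[density mu mw w0]_t (f t)%:E = \int[mu]_t (f t * w t)%:E.
Proof.
move=> mf; rewrite [LHS]integralE [RHS]integralE.
have mfE : measurable_fun setT (EFin \o f) by exact/measurable_EFinP.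
rewrite -[fun t => (f t * w t)%:E]/(EFin \o (fun t => f t * w t)%R).
congr (_ - _).
  rewrite (integral_density mu mw w0 (measurable_funepos mfE)); last first.
    by move=> t; exact: funepos_ge0.
  apply: eq_integral => t _.
  by rewrite !funeposE/= EFinM maxe_pMl ?mul0e// lee_fin.
rewrite (integral_density mu mw w0 (measurable_funeneg mfE)); last first.
  by move=> t; exact: funeneg_ge0.
apply: eq_integral => t _.
by rewrite !funenegE/= -mulNr EFinM maxe_pMl ?mul0e// lee_fin.
Qed.

Lemma ang_weightN n u : ang_weight n (- u) = ang_weight n u.
Proof. by rewrite /ang_weight sqrrN. Qed.

Lemma integral_ang_opp n (f : R -> \bar R) : measurable_fun setT f ->
  (forall u, 0 <= f u) ->
  \int[ang n]_u f (- u)%R = \int[ang n]_u f u.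
Proof.
move=> mf f0; have mw := measurable_ang_weight n.
rewrite !integral_ang//; last by apply: measurable_fun_comp1 => //; meas.
rewrite -[RHS]integral_leb_opp; last 2 first.
- by meas.
- by move=> u; rewrite mule_ge0// lee_fin ang_weight_ge0.
by apply: eq_integral => u _; rewrite ang_weightN.
Qed.

Lemma integral_ang_opp_EFin n (f : R -> R) : measurable_fun setT f ->
  \int[ang n]_u (f (- u)%R)%:E = \int[ang n]_u (f u)%:E.
Proof.
move=> mf; rewrite [LHS]integralE [RHS]integralE.
have mfE : measurable_fun setT (EFin \o f) by exact/measurable_EFinP.
have p := integral_ang_opp n (measurable_funepos mfE) (fun u => funepos_ge0 _ u).
have q := integral_ang_opp n (measurable_funeneg mfE) (fun u => funeneg_ge0 _ u).
by congr (_ - _); rewrite -?p -?q; apply: eq_integral => u _;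
  rewrite ?funeposE ?funenegE.
Qed.

Lemma rhoNl x y u : rho (- x) y u = rho x y (- u).
Proof. by rewrite /rho; congr Num.sqrt; ring. Qed.

Lemma rhoNr x y u : rho x (- y) u = rho x y (- u).
Proof. by rewrite /rho; congr Num.sqrt; ring. Qed.

Lemma integral_ang_rho_norm n x y (f : R -> \bar R) : measurable_fun setT f ->
  (forall u, 0 <= f u) ->
  \int[ang n]_u f (rho x y u) = \int[ang n]_u f (rho `|x| `|y| u).
Proof.
move=> mf f0.
have mr a b : measurable_fun setT (fun u => f (rho a b u)).
  by apply: measurable_fun_comp1 => //; apply: measurable_rho; meas.
have opp a b := integral_ang_opp n (mr a b) (fun u => f0 _).
have [x0|x0] := ger0P x; have [y0|y0] := ger0P y => //.
- by rewrite -opp; apply: eq_integral => u _; rewrite rhoNr.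
- by rewrite -opp; apply: eq_integral => u _; rewrite rhoNl.
- by apply: eq_integral => u _; rewrite rhoNl rhoNr opprK.
Qed.

Section fubini_section.
Context d (T : measurableType d).

Lemma measurable_integral_EFin (m : {sigma_finite_measure set R -> \bar R})
    (f : T * R -> R) : measurable_fun setT f ->
  measurable_fun setT (fun t => \int[m]_u (f (t, u))%:E).
Proof.
move=> mf; have mfE : measurable_fun setT (EFin \o f) by exact/measurable_EFinP.
have p := @measurable_fun_fubini_tonelli_F _ _ _ _ R m _ (measurable_funepos mfE)
  (fun q => funepos_ge0 _ q).
have q := @measurable_fun_fubini_tonelli_F _ _ _ _ R m _ (measurable_funeneg mfE)
  (fun q => funeneg_ge0 _ q).
have := emeasurable_funB p q; congr (measurable_fun _ _); apply/funext => t.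
rewrite [RHS]integralE; congr (_ - _); apply: eq_integral => u _.
  by rewrite !funeposE.
by rewrite !funenegE.
Qed.

Lemma measurable_fun_fine (f : T -> \bar R) : measurable_fun setT f ->
  measurable_fun setT (fun t => fine (f t)).
Proof. by move=> mf; apply: (measurableT_comp _ mf); exact: fine_measurable. Qed.

End fubini_section.

End signed_integrals.

Section dunkl_translation_integral.
Context {R : realType}.
Variable nu : R.
Hypothesis nuN : nu != - (1 / 2).
Implicit Types (x y z u r : R) (f g : R -> R).
Local Notation n := (2 * nu + 1).

Definition translation_density x f y u : R :=
  (f (rho x y u) * (1 + (x + y) / rho x y u) +
   f (- rho x y u) * (1 - (x + y) / rho x y u)) * (1 + u).

Lemma measurable_translation_density d (T : measurableType d) f (a b c : T -> R) :
  measurable_fun setT f -> measurable_fun setT a -> measurable_fun setT b ->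
  measurable_fun setT c ->
  measurable_fun setT (fun t => translation_density (a t) f (b t) (c t)).
Proof.
move=> mf ma mb mc; pose r t := rho (a t) (b t) (c t).
have mr : measurable_fun setT r by exact: measurable_rho.
(* Division is rewritten as the power [-1], whose measurability is available; the two agree because
   [rho >= 0], including at [0]. *)
rewrite (_ : (fun t => _) = fun t => (f (r t) * (1 + (a t + b t) * r t `^ (-1)) +
    f (- r t) * (1 + - ((a t + b t) * r t `^ (-1)))) * (1 + c t)); first by meas.
by apply/funext => t; rewrite powR_inv1// rho_ge0.
Qed.

(** With [n = 2 nu + 1] the exponent [nu - 1 / 2] is [n / 2 - 1], so [(1 - u ^ 2) ^ (nu - 1 / 2)] is
    the weight of [ang n] and [1 + u] stays in the integrand. The endpoints are negligible. *)
Lemma dunkl_translationE x f y : measurable_fun setT f ->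
  dunkl_translation nu x f y =
  dunkl_const nu / 2 * fine (\int[ang n]_u (translation_density x f y u)%:E).
Proof.
move=> mf; rewrite /dunkl_translation (negbTE nuN); congr (_ * fine _).
have mt : measurable_fun setT (translation_density x f y).
  by apply: measurable_translation_density; meas.
have mw := measurable_ang_weight n.
rewrite integral_density_EFin// integral_leb; last by meas.
pose F u : R := translation_density x f y u * (1 - u ^+ 2) `^ (nu - 1 / 2).
have mF : measurable_fun setT F by rewrite /F; meas.
transitivity (\int[lebesgue_measure]_(u in `[(-1)%R, 1%R]) (F u)%:E)%E => //.
rewrite integral_itv_bndoo; last by apply/measurable_EFinP; exact: measurable_funTS.
rewrite integral_mkcond; apply: eq_integral => u _.
rewrite patchE; case: ifPn => [|h].
  rewrite inE/= in_itv/= => /andP[u1 u2]; rewrite /F /ang_weight ifT; last by nra.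
  by congr ((_ * _ `^ _)%:E); field.
rewrite ang_weight0 ?mulr0// leNgt; apply: contra h => h; rewrite inE/= in_itv/=.
by apply/andP; split; nra.
Qed.

End dunkl_translation_integral.

Section dunkl_measure_integral.
Context {R : realType}.
Variable nu : R.
Hypothesis nu_gt : - (1 / 2) < nu.
Local Notation n := (2 * nu + 1).
Local Open Scope ereal_scope.

Definition dunkl_norm : R := (2 `^ (nu + 1) * Gamma (nu + 1))^-1%R.

Lemma dunkl_norm_ge0 : (0 <= dunkl_norm)%R.
Proof. by rewrite invr_ge0 mulr_ge0 ?powR_ge0 ?Gamma_ge0. Qed.

Let n0 : (0 < n)%R. Proof. by have := nu_gt; lra. Qed.

Lemma dunkl_weight_half x :
  dunkl_weight nu x = (dunkl_norm * (half_weight n x + half_weight n (- x)))%R.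
Proof.
rewrite /dunkl_weight -/dunkl_norm; congr (_ * _)%R; rewrite /half_weight oppr_gt0.
have [x0|x0|->] := ltgtP x 0%R.
- by rewrite ltr0_norm// add0r.
- by rewrite gtr0_norm// addr0.
- by rewrite normr0 addr0 powR0// gt_eqF.
Qed.

Lemma integral_dunkl (f : R -> \bar R) : measurable_fun setT f ->
  (forall x, 0 <= f x) ->
  \int[dunkl_measure nu]_x f x =
  dunkl_norm%:E * \int[half n]_y (f y + f (- y)%R).
Proof.
move=> mf f0; have mw := @measurable_dunkl_weight R nu.
have mh := measurable_half_weight n.
have h0 := half_weight_ge0 n.
have c0 : 0 <= dunkl_norm%:E by rewrite lee_fin dunkl_norm_ge0.
have mfN : measurable_fun setT (fun y : R => f (- y)%R) by apply: measurable_fun_comp1 => //; meas.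
rewrite (@eq_measure_integral _ _ _ _ (density leb mw (dunkl_weight_ge0 nu))); last first.
  move=> A mA _; rewrite /dunkl_measure /density [LHS]integral_mkcond [RHS]integral_mkcond.
  rewrite integral_leb//; apply/(measurable_restrictT _ mA)/measurable_funTS.
  exact/measurable_EFinP.
rewrite (integral_density leb mw (dunkl_weight_ge0 nu))//.
have m1 : measurable_fun setT (fun y : R => f y * (half_weight n y)%:E) by meas.
have m2 : measurable_fun setT (fun y : R => f y * (half_weight n (- y))%:E).
  apply: emeasurable_funM => //; apply: measurable_fun_EFin.
  by apply: (measurable_fun_comp1 mh); meas.
have p1 y : 0 <= f y * (half_weight n y)%:E by rewrite mule_ge0// lee_fin.
have p2 y : 0 <= f y * (half_weight n (- y))%:E by rewrite mule_ge0// lee_fin.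
transitivity (dunkl_norm%:E * \int[leb]_y (f y * (half_weight n y)%:E + f y * (half_weight n (- y))%:E)).
  rewrite -ge0_integralZl//; last 2 first.
  - exact: emeasurable_funD.
  - by move=> y _; rewrite adde_ge0.
  apply: eq_integral => y _; rewrite dunkl_weight_half -ge0_muleDr ?lee_fin//.
  by rewrite EFinM EFinD muleCA.
congr (_ * _).
rewrite ge0_integralD// ge0_integralD//.
congr (_ + _); first exact (esym (integral_half n mf f0)).
apply: etrans (esym (integral_half n mfN (fun y => f0 _))).
rewrite -(integral_leb_opp m2 p2); apply: eq_integral => y _.
by rewrite opprK.
Qed.

End dunkl_measure_integral.

(** * Exchange of sides: from centred balls to balls around a point *)

Section discs.
Context {R : realType}.
Variable n : R.
Hypothesis n0 : 0 < n.
Implicit Types (x y z u r : R).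
Local Open Scope ereal_scope.

(** After the exchange of [y] and [rho] the condition [y < r] becomes [rho < r] and [g] no longer
    depends on the angle, so [integral_ang_ball_le] applies. At [x = 0] the triangle degenerates,
    [rho = y], and the total angular mass is enough. *)
Lemma disc_upper : exists2 C, (0 < C)%R & forall x r (g : R -> \bar R), (0 < r)%R ->
  measurable_fun setT g -> (forall z, 0 <= g z) ->
  \int[half n]_y (if (y < r)%R then \int[ang n]_u g (rho x y u) else 0) <=
  (C * (r / (`|x| + r)) `^ n)%:E *
    \int[half n]_z (if (`|z - `|x| | < r)%R then g z else 0).
Proof.
have [C1 C10 ballC] := integral_ang_ball_le n0.
have [C2 C20 tot] := integral_ang1 n0.
exists (C1 + C2)%R; first exact: addr_gt0.
move=> x r g r0 mg g0.
have mball c : measurable_fun setT (fun z => (`|z - c| < r)%R).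
  by apply: measurable_fun_ltr; meas.
have mgr a : measurable_fun setT (fun q : R * R => g (rho a q.1 q.2)).
  by apply: measurable_fun_comp1 => //; apply: measurable_rho; meas.
have mgF a := measurable_fun_ang n (mgr a) (fun q => g0 _).
have gF0 a y : 0 <= \int[ang n]_u g (rho a y u) by apply: integral_ge0.
have q0 : 0 <= (C1 + C2)%:E by rewrite lee_fin addr_ge0// ltW.
have E0 c : 0 <= \int[half n]_z (if (`|z - c| < r)%R then g z else 0).
  by apply: integral_ge0 => z _; case: ifP.
have w0 : (0 <= (r / (`|x| + r)) `^ n)%R by exact: powR_ge0.
have C1E : 0 <= (C1 * (r / (`|x| + r)) `^ n)%:E.
  by rewrite lee_fin mulr_ge0// ltW.
apply: (@le_trans _ _ (\int[half n]_y (if (y < r)%R then \int[ang n]_u g (rho `|x| y u) else 0))).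
  apply: integral_half_le.
  - by apply: measurable_fun_ifT; [by meas|exact: mgF|by meas].
  - by apply: measurable_fun_ifT; [by meas|exact: mgF|by meas].
  - by move=> y; case: ifP.
  - by move=> y; case: ifP.
  - move=> y y0; case: ifP => // _.
    have mu : measurable_fun setT g by [].
    by rewrite (integral_ang_rho_norm n x y mg g0) (gtr0_norm y0).
have [x0|x0] := eqVneq x 0%R.
  rewrite x0 normr0 add0r divff ?gt_eqF// powR1 mulr1.
  apply: (@le_trans _ _ (C2%:E * \int[half n]_z (if (`|z - 0| < r)%R then g z else 0))); last first.
    by apply: lee_wpmul2r; [exact: E0|rewrite lee_fin lerDr; exact: ltW].
  rewrite -ge0_integralZl//; last 3 first.
  - by meas.
  - by move=> z _; case: ifP.
  - by rewrite lee_fin ltW.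
  apply: integral_half_le.
  - by apply: measurable_fun_ifT; [by meas|exact: mgF|by meas].
  - by apply: emeasurable_funM; meas.
  - by move=> y; case: ifP.
  - by move=> y; rewrite mule_ge0 ?lee_fin ?(ltW C20)//; case: ifP.
  move=> y y0; rewrite subr0 (gtr0_norm y0); case: ifP => _; last by rewrite mule0.
  rewrite (eq_integral (fun=> g y * 1)).
    by rewrite ge0_integralZl// muleC lee_wpmul2r.
  move=> u _; rewrite mule1; congr g.
  by rewrite /rho expr0n add0r mulr0 mul0r mul0r addr0 sqrtr_sqr gtr0_norm.
have ax0 : (0 < `|x|)%R by rewrite normr_gt0.
pose Phi (q : R * R) : \bar R := if (q.1 < r)%R then g q.2 else 0.
have mPhi : measurable_fun setT Phi by rewrite /Phi; meas.
have Phi0 q : 0 <= Phi q by rewrite /Phi; case: ifP.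
rewrite (eq_integral (fun y => \int[ang n]_u Phi (y, rho `|x| y u))); last first.
  by move=> y _; rewrite /Phi/=; case: ifP => // _; rewrite integral0.
rewrite (integral_half_ang_swap n ax0 mPhi Phi0).
apply: (@le_trans _ _ ((C1 * (r / (`|x| + r)) `^ n)%:E *
    \int[half n]_z (if (`|z - `|x| | < r)%R then g z else 0))); last first.
  by apply: lee_wpmul2r; [exact: E0|rewrite lee_fin ler_wpM2r// lerDl; exact: ltW].
rewrite -ge0_integralZl//; last 2 first.
- by meas.
- by move=> z _; case: ifP.
have mrho2 : measurable_fun setT (fun q : R * R => Phi (rho `|x| q.1 q.2, q.1)).
  by apply: measurable_fun_comp2 => //; apply: measurable_rho; meas.
apply: integral_half_le.
- exact: (measurable_fun_ang n mrho2).
- by apply: emeasurable_funM; meas.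
- by move=> z; apply: integral_ge0.
- by move=> z; rewrite mule_ge0//; case: ifP.
move=> z z0; rewrite /Phi/=.
rewrite (eq_integral (fun v => g z * (if (rho `|x| z v < r)%R then 1 else 0))); last first.
  by move=> v _; case: ifP; rewrite ?mule1 ?mule0.
have mb := measurable_rho_lt `|x| z r.
rewrite ge0_integralZl//; last 2 first.
- by meas.
- by move=> v _; case: ifP.
apply: (le_trans (lee_wpmul2l (g0 z) (ballC _ _ _ ax0 z0 r0))).
by case: ifP => _; [rewrite muleC|rewrite !mule0].
Qed.

(** The angles are restricted to [0 <= x + y u] because only there does the paired density dominate
    [g rho]. By the law of cosines [2 x (x + y u) = x ^ 2 + rho ^ 2 - y ^ 2], so after the exchange
    the restriction reads [v <= 0]. *)
Lemma disc_lower : exists2 c, (0 < c)%R & forall x r (g : R -> \bar R),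
  (0 < x)%R -> (0 < r)%R -> measurable_fun setT g -> (forall z, 0 <= g z) ->
  (c * (r / (x + r)) `^ n)%:E *
    \int[half n]_z (if (`|z - x| < r)%R then g z else 0) <=
  \int[half n]_y (if (y < 2 * r)%R then
    \int[ang n]_u (if (0 <= x + y * u)%R then g (rho x y u) else 0) else 0).
Proof.
have [c c0 ballc] := integral_ang_ball_ge n0.
exists c => // x r g x0 r0 mg g0.
have mball : measurable_fun setT (fun z => (`|z - x| < r)%R).
  by apply: measurable_fun_ltr; meas.
(* The sign condition is expressed by the sides alone, since the exchange applies to functions of
   [y] and [rho]. *)
pose Phi (q : R * R) : \bar R :=
  if (q.1 < 2 * r)%R && (q.1 ^+ 2 <= x ^+ 2 + q.2 ^+ 2)%R then g q.2 else 0.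
have mPhi : measurable_fun setT Phi by rewrite /Phi; meas.
have Phi0 q : 0 <= Phi q by rewrite /Phi; case: ifP.
have rho_sq y u : (0 <= x ^+ 2 + y ^+ 2 + 2 * x * y * u)%R ->
    (rho x y u ^+ 2 = x ^+ 2 + y ^+ 2 + 2 * x * y * u)%R.
  by move=> h; rewrite /rho sqr_sqrtr.
have mrho2 : measurable_fun setT (fun q : R * R => Phi (rho x q.1 q.2, q.1)).
  by apply: measurable_fun_comp2 => //; apply: measurable_rho; meas.
have mrho1 : measurable_fun setT (fun q : R * R => Phi (q.1, rho x q.1 q.2)).
  by apply: measurable_fun_comp2 => //; apply: measurable_rho; meas.
have mrho3 : measurable_fun setT (fun q : R * R =>
    if (0 <= x + q.1 * q.2)%R then g (rho x q.1 q.2) else 0).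
  apply: measurable_fun_ifT; [by meas| |by meas].
  by apply: measurable_fun_comp1 => //; apply: measurable_rho; meas.
apply: (@le_trans _ _ (\int[half n]_y \int[ang n]_u Phi (y, rho x y u))); last first.
  apply: integral_half_le.
  - exact: (measurable_fun_ang n mrho1).
  - apply: measurable_fun_ifT; [by meas| |by meas].
    by apply: (measurable_fun_ang n mrho3) => q; case: ifP.
  - by move=> y; apply: integral_ge0.
  - by move=> y; case: ifP => // _; apply: integral_ge0 => u _; case: ifP.
  move=> y y0; rewrite /Phi/=; case: ifP => _ /=; last by rewrite integral0.
  apply: integral_ang_le.
  - apply: measurable_fun_ifT; [|apply: measurable_fun_comp1 => //|by meas].
      apply: measurable_fun_ler; first by meas.
      apply: measurable_funD; first by meas.
      by apply: measurable_funX; apply: measurable_rho; meas.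
    by apply: measurable_rho; meas.
  - apply: measurable_fun_ifT; [by meas| |by meas].
    by apply: measurable_fun_comp1 => //; apply: measurable_rho; meas.
  - by move=> u; case: ifP.
  - by move=> u; case: ifP.
  move=> u u1; case: ifPn => h; last by case: ifP.
  rewrite ifT//; move: h; rewrite rho_sq; last first.
    by have := sqr_ge0 (x + y * u)%R; nra.
  move=> h; rewrite -(pmulr_rge0 _ x0); lra.
rewrite (integral_half_ang_swap n x0 mPhi Phi0).
rewrite -ge0_integralZl//; last 3 first.
- by meas.
- by move=> z _; case: ifP.
- by rewrite lee_fin mulr_ge0 ?powR_ge0// ltW.
apply: integral_half_le.
- by apply: emeasurable_funM; meas.
- exact: (measurable_fun_ang n mrho2).
- move=> z; rewrite mule_ge0 ?lee_fin ?mulr_ge0 ?powR_ge0 ?(ltW c0)//.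
  by case: ifP.
- by move=> z; apply: integral_ge0.
move=> z z0; case: ifPn => zx; last first.
  by rewrite mule0; apply: integral_ge0.
rewrite muleC; apply: (le_trans (lee_wpmul2l (g0 z) (ballc x z r x0 z0 r0 zx))).
have mb := measurable_rho_lt x z (2 * r).
rewrite -ge0_integralZl//; last 2 first.
- by meas.
- by move=> v _; case: ifP.
apply: integral_ang_le.
- by apply: emeasurable_funM; meas.
- apply: (measurable_fun_comp2 mPhi); last by meas.
  by apply: measurable_rho; meas.
- by move=> v; rewrite mule_ge0//; case: ifP.
- by [].
move=> v v1; case: ifPn => [/andP[h1 h2]|_]; last by rewrite mule0.
rewrite mule1 /Phi/= h1/= ifT// rho_sq; last first.
  by have := sqr_ge0 (x + z * v)%R; nra.
have : (0 < x * z)%R by exact: mulr_gt0.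
by nra.
Qed.

End discs.

(** * Paired densities and means of translates over centred balls *)

Section paired_density.
Context {R : realType}.
Implicit Types (x y z u r : R) (f g : R -> R).

(** The cosine of the angle between the side [rho] and the direction of [x]. It is set to [0] off
    the angular support, so that its absolute value is at most [1] for every [u]. *)
Definition rho_cosine x y u : R :=
  if 0 < 1 - u ^+ 2 then (x + y * u) / rho x y u else 0.

Definition even_part g z : R := g z + g (- z).

Definition paired_density x g y u : R :=
  g (rho x y u) * (1 + rho_cosine x y u) + g (- rho x y u) * (1 - rho_cosine x y u).

Lemma sqr_rho x y u : 0 < 1 - u ^+ 2 ->
  rho x y u ^+ 2 = x ^+ 2 + y ^+ 2 + 2 * x * y * u.
Proof.
by move=> u1; rewrite /rho sqr_sqrtr//; have := sqr_ge0 (x + y * u); have := sqr_ge0 y; nra.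
Qed.

Lemma normr_div_le (a b c : R) : 0 <= b -> 0 <= c -> a ^+ 2 <= (c * b) ^+ 2 -> `|a / b| <= c.
Proof.
move=> b0 c0 abc; have {}abc : `|a| <= c * b.
  by rewrite -(@ler_pXn2r _ 2) ?nnegrE ?mulr_ge0// real_normK ?num_real.
have [->|bN] := eqVneq b 0; first by rewrite invr0 mulr0 normr0.
by rewrite normrM normfV (ger0_norm b0) ler_pdivrMr// lt_def bN.
Qed.

Lemma rho_cosine_norm x y u : `|rho_cosine x y u| <= 1.
Proof.
rewrite /rho_cosine; case: ifPn => u1; last by rewrite normr0.
apply: normr_div_le => //; first exact: rho_ge0.
by rewrite mul1r sqr_rho//; have := sqr_ge0 y; nra.
Qed.

Lemma rho_cosine_bounds x y u : 0 <= 1 + rho_cosine x y u /\ 0 <= 1 - rho_cosine x y u.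
Proof. by have := rho_cosine_norm x y u; rewrite ler_norml => /andP[]; lra. Qed.

Lemma even_part_ge0 g z : (forall z, 0 <= g z) -> 0 <= even_part g z.
Proof. by move=> g0; rewrite addr_ge0. Qed.

Lemma paired_density_ge0 x g y u : (forall z, 0 <= g z) -> 0 <= paired_density x g y u.
Proof.
by move=> g0; have [? ?] := rho_cosine_bounds x y u; rewrite addr_ge0// mulr_ge0.
Qed.

Lemma paired_density_le x g y u : (forall z, 0 <= g z) ->
  paired_density x g y u <= 2 * even_part g (rho x y u).
Proof.
move=> g0; have [? ?] := rho_cosine_bounds x y u; rewrite /paired_density /even_part.
by have := g0 (rho x y u); have := g0 (- rho x y u); nra.
Qed.

Lemma paired_density_ge x g y u : (forall z, 0 <= g z) ->
  0 <= x + y * u -> g (rho x y u) <= paired_density x g y u.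
Proof.
move=> g0 xyu; have [? h] := rho_cosine_bounds x y u; rewrite /paired_density.
have : 0 <= rho_cosine x y u.
  by rewrite /rho_cosine; case: ifP => // _; rewrite divr_ge0// rho_ge0.
by have := g0 (rho x y u); have := g0 (- rho x y u); nra.
Qed.

Lemma rhoNN x y u : rho x (- y) (- u) = rho x y u.
Proof. by rewrite rhoNr opprK. Qed.

(** The two factors [1 + u] and [1 - u] add up to [2], and [(x + y) (1 + u) + (x - y) (1 - u) = 2 (x
    + y u)]: the quotient [(x + y) / rho] becomes the cosine. *)
Lemma translation_density_pair x g y u : 0 < 1 - u ^+ 2 ->
  translation_density x g y u + translation_density x g (- y) (- u) =
  2 * paired_density x g y u.
Proof.
move=> u1; rewrite /translation_density /paired_density /rho_cosine u1 rhoNN.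
by set s := (rho x y u)^-1; ring.
Qed.

(** The quotient [(x + y) / rho] is unbounded, but [(x + y) ^ 2 (1 + u) <= 2 rho ^ 2] because the
    difference is [(1 - u) (x - y) ^ 2]; so its product with [1 + u] is at most [2]. This gives the
    absolute convergence needed before pairing. *)
Lemma translation_density_le x g y u : (forall z, 0 <= g z) -> 0 < 1 - u ^+ 2 ->
  `|translation_density x g y u| <= 4 * even_part g (rho x y u).
Proof.
move=> g0 u1; have [ul uu] : -1 <= u /\ u <= 1 by split; nra.
have : `|(x + y) * (1 + u) / rho x y u| <= 2.
  apply: normr_div_le => //; first exact: rho_ge0.
  rewrite exprMn exprMn sqr_rho//.
  have h1 : (x + y) ^+ 2 * (1 + u) <= 2 * (x ^+ 2 + y ^+ 2 + 2 * x * y * u).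
    have : 0 <= (1 - u) * (x - y) ^+ 2 by rewrite mulr_ge0 ?sqr_ge0// subr_ge0.
    lra.
  have h2 : 0 <= x ^+ 2 + y ^+ 2 + 2 * x * y * u.
    by have := sqr_ge0 (x + y * u); have := sqr_ge0 y; nra.
  by nra.
rewrite ler_norml => /andP[h1 h2].
rewrite /translation_density /even_part ler_norml.
set a := g _; set b := g (- rho x y u).
have -> : (a * (1 + (x + y) / rho x y u) + b * (1 - (x + y) / rho x y u)) * (1 + u) =
  a * (1 + u + (x + y) * (1 + u) / rho x y u) +
  b * (1 + u - (x + y) * (1 + u) / rho x y u) by ring.
have a0 : 0 <= a := g0 _. have b0 : 0 <= b := g0 _.
by apply/andP; split; nra.
Qed.

Lemma measurable_rho_cosine d (T : measurableType d) (a b c : T -> R) :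
  measurable_fun setT a -> measurable_fun setT b -> measurable_fun setT c ->
  measurable_fun setT (fun t => rho_cosine (a t) (b t) (c t)).
Proof.
move=> ma mb mc; pose r t := rho (a t) (b t) (c t).
have mr : measurable_fun setT r by exact: measurable_rho.
rewrite (_ : (fun t => _) = fun t => if 0 < 1 - c t ^+ 2 then
    (a t + b t * c t) * r t `^ (-1) else 0); first by meas.
by apply/funext => t; rewrite powR_inv1// rho_ge0.
Qed.

Lemma measurable_paired_density d (T : measurableType d) g (a b c : T -> R) :
  measurable_fun setT g -> measurable_fun setT a -> measurable_fun setT b ->
  measurable_fun setT c ->
  measurable_fun setT (fun t => paired_density (a t) g (b t) (c t)).
Proof.
move=> mg ma mb mc; pose r t := rho (a t) (b t) (c t).
have mr : measurable_fun setT r by exact: measurable_rho.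
pose k t := rho_cosine (a t) (b t) (c t).
have mk : measurable_fun setT k by exact: measurable_rho_cosine.
rewrite (_ : (fun t => _) = fun t => g (r t) * (1 + k t) + g (- r t) * (1 - k t)) //.
by meas.
Qed.

End paired_density.

Section ball_mean.
Context {R : realType}.
Variable nu : R.
Hypothesis nu_gt : - (1 / 2) < nu.
Implicit Types (x y z u r : R) (g h : R -> R).
Local Notation n := (2 * nu + 1).
Local Notation c0 := (dunkl_norm nu).
Local Notation C := (dunkl_const nu).
Local Open Scope ereal_scope.

Let nuN : (nu != - (1 / 2))%R. Proof. by rewrite gt_eqF. Qed.

Lemma dunkl_const_ge0 : (0 <= C)%R.
Proof. by rewrite divr_ge0 ?mulr_ge0 ?sqrtr_ge0 ?Gamma_ge0. Qed.

Lemma eq_integral_ang_EFin (f g : R -> R) : measurable_fun setT f ->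
  measurable_fun setT g -> (forall u, (0 < 1 - u ^+ 2)%R -> f u = g u) ->
  \int[ang n]_u (f u)%:E = \int[ang n]_u (g u)%:E.
Proof.
move=> mf mg fg; rewrite !integral_density_EFin//; apply: eq_integral => u _.
have [u1|u1] := ltP 0%R (1 - u ^+ 2)%R; first by rewrite fg.
by rewrite ang_weight0// !mulr0.
Qed.

Definition even_mean x g y : \bar R := \int[ang n]_u (even_part g (rho x y u))%:E.

Definition paired_mean x g y : \bar R := \int[ang n]_u (paired_density x g y u)%:E.

Lemma measurable_even_part g : measurable_fun setT g ->
  measurable_fun setT (even_part g).
Proof.
move=> mg; rewrite (_ : even_part g = fun z => (g z + g (- z))%R) //.
by meas.
Qed.

Section nonnegative.
Variable g : R -> R.
Hypotheses (mg : measurable_fun setT g) (g0 : forall z, (0 <= g z)%R).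

Let mgs := measurable_even_part mg.

Let m_even2 x : measurable_fun setT (fun q : R * R => (even_part g (rho x q.1 q.2))%:E).
Proof.
apply: measurable_fun_EFin; apply: measurable_fun_comp1 => //.
by apply: measurable_rho; meas.
Qed.

Lemma measurable_even_mean x : measurable_fun setT (even_mean x g).
Proof.
by apply: (measurable_fun_ang n (m_even2 x)) => q; rewrite lee_fin even_part_ge0.
Qed.

Lemma even_mean_ge0 x y : 0 <= even_mean x g y.
Proof. by apply: integral_ge0 => u _; rewrite lee_fin even_part_ge0. Qed.

Lemma measurable_paired_mean x : measurable_fun setT (paired_mean x g).
Proof.
apply: (@measurable_fun_ang _ n (fun q : R * R => (paired_density x g q.1 q.2)%:E)).
  by apply: measurable_fun_EFin; apply: measurable_paired_density; meas.
by move=> q; rewrite lee_fin paired_density_ge0.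
Qed.

Lemma paired_mean_ge0 x y : 0 <= paired_mean x g y.
Proof. by apply: integral_ge0 => u _; rewrite lee_fin paired_density_ge0. Qed.

Let m_even x y : measurable_fun setT (fun u => (even_part g (rho x y u))%:E).
Proof.
by apply: measurable_fun_EFin; apply: measurable_fun_comp1 => //; apply: measurable_rho; meas.
Qed.

Lemma paired_mean_le x y : paired_mean x g y <= 2%:E * even_mean x g y.
Proof.
rewrite -ge0_integralZl//; last by move=> u _; rewrite lee_fin even_part_ge0.
apply: integral_ang_le.
- by apply: measurable_fun_EFin; apply: measurable_paired_density; meas.
- exact: (emeasurable_funM (measurable_cst _) (m_even x y)).
- by move=> u; rewrite lee_fin paired_density_ge0.
- by move=> u; rewrite -EFinM lee_fin mulr_ge0// even_part_ge0.
- by move=> u _; rewrite -EFinM lee_fin paired_density_le.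
Qed.

Let m_td x y : measurable_fun setT (translation_density x g y).
Proof. by apply: measurable_translation_density; meas. Qed.

Lemma integral_translation_density_le x y :
  \int[ang n]_u `|(translation_density x g y u)%:E| <= 4%:E * even_mean x g y.
Proof.
rewrite -ge0_integralZl//; last by move=> u _; rewrite lee_fin even_part_ge0.
apply: integral_ang_le.
- by apply: measurableT_comp => //; apply: measurable_fun_EFin.
- exact: (emeasurable_funM (measurable_cst _) (m_even x y)).
- by [].
- by move=> u; rewrite -EFinM lee_fin mulr_ge0// even_part_ge0.
- by move=> u u1; rewrite -EFinM lee_fin translation_density_le.
Qed.

Lemma dunkl_translation_norm_le x y :
  `|dunkl_translation nu x g y|%:E <= (2 * C)%:E * even_mean x g y.
Proof.
have CE := dunkl_const_ge0.
rewrite dunkl_translationE// normrM (ger0_norm (divr_ge0 CE _))// EFinM.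
apply: (@le_trans _ _ ((C / 2)%:E * (4%:E * even_mean x g y))); last first.
  by rewrite muleA -EFinM; apply: lee_wpmul2r; [exact: even_mean_ge0|rewrite lee_fin; lra].
apply: lee_wpmul2l; first by rewrite lee_fin divr_ge0.
apply: le_trans (integral_translation_density_le x y).
apply: (@le_trans _ _ `|\int[ang n]_u (translation_density x g y u)%:E|).
  by case: (\int[ang n]_u _) => [a| |] /=; rewrite ?leey ?lexx.
exact: (le_abse_integral (ang n) measurableT (measurable_fun_EFin (m_td x y))).
Qed.

Lemma integrable_translation_density x y : even_mean x g y < +oo ->
  (ang n).-integrable setT (fun u => (translation_density x g y u)%:E).
Proof.
move=> fin; apply/integrableP; split; first exact: measurable_fun_EFin.
apply: (le_lt_trans (integral_translation_density_le x y)).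
by rewrite lte_mul_pinfty ?lee_fin.
Qed.

Lemma even_meanN x y : even_mean x g (- y) = even_mean x g y.
Proof.
rewrite -[RHS](integral_ang_opp n (m_even x y)); last first.
  by move=> u; rewrite lee_fin even_part_ge0.
by apply: eq_integral => u _; rewrite rhoNr.
Qed.

(** Finiteness of the even mean makes both translates genuine integrals, which may then be added; an
    infinite integral would be sent to [0] by [fine]. *)
Lemma dunkl_translation_pair x y : even_mean x g y < +oo ->
  (dunkl_translation nu x g y + dunkl_translation nu x g (- y))%:E =
  C%:E * paired_mean x g y.
Proof.
move=> fin; have finN : even_mean x g (- y) < +oo by rewrite even_meanN.
have i1 := integrable_translation_density fin.
have i2 := integrable_translation_density finN.
have mN : measurable_fun setT (fun u => translation_density x g (- y) (- u)).
  by apply: measurable_translation_density; meas.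
have mp : measurable_fun setT (paired_density x g y).
  by apply: measurable_paired_density; meas.
have f1 := integrable_fin_num measurableT i1.
have f2 := integrable_fin_num measurableT i2.
have sum : \int[ang n]_u (translation_density x g y u)%:E +
    \int[ang n]_u (translation_density x g (- y) u)%:E = 2%:E * paired_mean x g y.
  rewrite -(integral_ang_opp_EFin n (m_td x (- y))) -integralD//; last first.
    apply/integrableP; split; first exact: measurable_fun_EFin.
    have /integrableP[_] := i2; congr (_ < _).
    rewrite -[LHS](integral_ang_opp n) //; first by apply: measurableT_comp => //; apply: measurable_fun_EFin.
  rewrite -ge0_integralZl//; last 2 first.
  - exact: measurable_fun_EFin.
  - by move=> u _; rewrite lee_fin paired_density_ge0.
  transitivity (\int[ang n]_u (2 * paired_density x g y u)%:E) => //.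
  transitivity (\int[ang n]_u (translation_density x g y u + translation_density x g (- y) (- u))%:E) => //.
  apply: eq_integral_ang_EFin; [by meas|by meas|].
  by move=> u u1; exact: translation_density_pair.
rewrite !dunkl_translationE// -mulrDr -fineD// sum.
have pf : paired_mean x g y \is a fin_num.
  rewrite ge0_fin_numE ?paired_mean_ge0//; apply: (le_lt_trans (paired_mean_le x y)).
  by rewrite lte_mul_pinfty ?lee_fin.
by rewrite -(fineK pf) -EFinM/= -EFinM; congr EFin; field.
Qed.

Lemma measurable_dunkl_translation x : measurable_fun setT (dunkl_translation nu x g).
Proof.
rewrite (_ : dunkl_translation nu x g = fun y =>
  (C / 2 * fine (\int[ang n]_u (translation_density x g y u)%:E))%R); last first.
  by apply/funext => y; rewrite dunkl_translationE.
apply: measurable_funM => //; apply: measurable_fun_fine.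
apply: (@measurable_integral_EFin _ _ _ (ang n) (fun q : R * R => translation_density x g q.1 q.2)).
by apply: measurable_translation_density; meas.
Qed.

End nonnegative.

Lemma integral_dunkl_EFin h : measurable_fun setT h ->
  \int[half n]_y (`|h y| + `|h (- y)|)%:E < +oo ->
  \int[dunkl_measure nu]_x (h x)%:E =
  c0%:E * \int[half n]_y (h y + h (- y))%:E.
Proof.
move=> mh fin; pose hN y := h (- y)%R.
have mhN : measurable_fun setT hN by rewrite /hN; meas.
have m1 : measurable_fun setT (EFin \o h) by exact/measurable_EFinP.
have m2 : measurable_fun setT (EFin \o hN) by exact/measurable_EFinP.
have i1 : (half n).-integrable setT (EFin \o h).
  apply/integrableP; split => //; apply: le_lt_trans fin.
  apply: integral_ge0_le => //; [by apply: measurableT_comp|by meas|].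
  by move=> y /=; rewrite lee_fin lerDl.
have i2 : (half n).-integrable setT (EFin \o hN).
  apply/integrableP; split => //; apply: le_lt_trans fin.
  apply: integral_ge0_le => //; [by apply: measurableT_comp|by meas|].
  by move=> y /=; rewrite lee_fin lerDr.
have fpos f : (half n).-integrable setT f -> \int[half n]_y f^\+ y \is a fin_num.
  by move=> fi; apply: integrable_fin_num => //; exact: integrable_funepos.
have fneg f : (half n).-integrable setT f -> \int[half n]_y f^\- y \is a fin_num.
  by move=> fi; apply: integrable_fin_num => //; exact: integrable_funeneg.
transitivity (c0%:E * (\int[half n]_y (EFin \o h) y + \int[half n]_y (EFin \o hN) y)); last first.
  by rewrite -integralD.
rewrite [LHS]integralE.
rewrite (integral_dunkl nu_gt (measurable_funepos m1)) ?(integral_dunkl nu_gt (measurable_funeneg m1)) //.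
have -> : \int[half n]_y ((EFin \o h)^\+ y + (EFin \o h)^\+ (- y)%R) =
    \int[half n]_y (EFin \o h)^\+ y + \int[half n]_y (EFin \o hN)^\+ y.
  rewrite -ge0_integralD//; [|exact: measurable_funepos|exact: measurable_funepos].
  by apply: eq_integral => y _; rewrite !funeposE.
have -> : \int[half n]_y ((EFin \o h)^\- y + (EFin \o h)^\- (- y)%R) =
    \int[half n]_y (EFin \o h)^\- y + \int[half n]_y (EFin \o hN)^\- y.
  rewrite -ge0_integralD//; [|exact: measurable_funeneg|exact: measurable_funeneg].
  by apply: eq_integral => y _; rewrite !funenegE.
rewrite [in RHS]integralE [in X in _ = _ * (_ + X)]integralE.
rewrite -(fineK (fpos _ i1)) -(fineK (fneg _ i1)) -(fineK (fpos _ i2)) -(fineK (fneg _ i2)).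
by rewrite -!EFinD -!EFinM; congr EFin; ring.
Qed.

End ball_mean.

Section translation_ball.
Context {R : realType}.
Variable nu : R.
Hypothesis nu_gt : - (1 / 2) < nu.
Implicit Types (x y z u r : R) (g h : R -> R).
Local Notation n := (2 * nu + 1).
Local Notation c0 := (dunkl_norm nu).
Local Notation C := (dunkl_const nu).
Local Open Scope ereal_scope.

Let n0 : (0 < n)%R. Proof. by have := nu_gt; lra. Qed.

Lemma paired_densityN x g y u :
  paired_density (- x)%R g y u = paired_density x (fun z => g (- z)%R) y (- u)%R.
Proof.
rewrite /paired_density rhoNl.
have -> : rho_cosine (- x)%R y u = (- rho_cosine x y (- u)%R)%R.
  by rewrite /rho_cosine sqrrN; case: ifP => _; rewrite ?oppr0// rhoNl -mulNr; congr (_ / _)%R; ring.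
by rewrite !opprK addrC.
Qed.

Section nonnegative.
Variable g : R -> R.
Hypotheses (mg : measurable_fun setT g) (g0 : forall z, (0 <= g z)%R).

Let m_even_mean x : measurable_fun setT (even_mean nu x g) := measurable_even_mean nu mg g0 x.
Let m_paired_mean x : measurable_fun setT (paired_mean nu x g) := measurable_paired_mean nu mg g0 x.

Lemma paired_meanN x y : paired_mean nu (- x)%R g y = paired_mean nu x (fun z => g (- z)%R) y.
Proof.
have mgN : measurable_fun setT (fun z => g (- z)%R) by apply: measurable_fun_comp1 => //; meas.
rewrite /paired_mean -[RHS](integral_ang_opp n); last 2 first.
- by apply: measurable_fun_EFin; apply: measurable_paired_density; meas.
- by move=> u; rewrite lee_fin paired_density_ge0.
by apply: eq_integral => u _; rewrite paired_densityN.
Qed.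

Lemma even_meanNl x y : even_mean nu (- x)%R g y = even_mean nu x g y.
Proof.
rewrite -[RHS](even_meanN nu mg g0) /even_mean.
by apply: eq_integral => u _; rewrite rhoNl rhoNr.
Qed.

(** The right-hand side is an integral of a nonnegative function although the translate is signed.
    Pairing is legitimate where [even_mean] is finite, which by the hypothesis is almost everywhere
    in the ball. *)
Lemma integral_translation_ball x r :
  \int[half n]_y (if (y < r)%R then even_mean nu x g y else 0) < +oo ->
  \int[dunkl_measure nu]_(y in ball (0%R : R) r) (dunkl_translation nu x g y)%:E =
  (c0 * C)%:E * \int[half n]_y (if (y < r)%R then paired_mean nu x g y else 0).
Proof.
move=> fin; have CE := dunkl_const_ge0 nu.
have mt := measurable_dunkl_translation nu_gt mg x.
pose h y := if (`|y| < r)%R then dunkl_translation nu x g y else 0%R.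
have mh : measurable_fun setT h by rewrite /h; apply: measurable_fun_ifT; [by meas|exact: mt|by meas].
have mhN : measurable_fun setT (fun y => h (- y)%R) by apply: (measurable_fun_comp1 mh); meas.
pose F y := if (`|y| < r)%R then even_mean nu x g y else 0.
have mF : measurable_fun setT F.
  by rewrite /F; apply: measurable_fun_ifT; [by meas|exact: m_even_mean|by meas].
have F0 y : 0 <= F y by rewrite /F; case: ifP => // _; exact: even_mean_ge0.
have Ffin : \int[half n]_y F y < +oo.
  apply: le_lt_trans fin; apply: integral_half_le => //.
  - by apply: measurable_fun_ifT; [by meas|exact: m_even_mean|by meas].
  - by move=> y; case: ifP => // _; exact: even_mean_ge0.
  - by move=> y y0; rewrite /F gtr0_norm.
have Fint : (half n).-integrable setT F.
  apply/integrableP; split => //; rewrite (eq_integral F)// => y _.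
  by rewrite gee0_abs.
rewrite [LHS]integral_mkcond.
rewrite (eq_integral (fun y => (h y)%:E)); last first.
  move=> y _; rewrite patchE /h.
  have -> : (y \in (ball (0%R : R) r : set R)) = (`|y| < r)%R.
    by apply/idP/idP; rewrite inE -ball_normE/= sub0r normrN.
  by case: ifP.
have C4 : 0 <= (4 * C)%:E by rewrite lee_fin; lra.
have C2 : 0 <= (2 * C)%:E by rewrite lee_fin; lra.
rewrite (integral_dunkl_EFin nu_gt mh); last first.
  apply: (@le_lt_trans _ _ (\int[half n]_y ((4 * C)%:E * F y))); last first.
    by rewrite ge0_integralZl// lte_mul_pinfty.
  apply: integral_ge0_le.
  - exact: (measurable_fun_EFin (measurable_funD (measurable_fun_normr mh) (measurable_fun_normr mhN))).
  - exact: (emeasurable_funM (measurable_cst _) mF).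
  - by move=> y; rewrite lee_fin addr_ge0.
  - move=> y; rewrite /h /F normrN; case: ifP => _; last by rewrite normr0 addr0 mule0.
    rewrite EFinD; have := dunkl_translation_norm_le nu_gt mg g0 x y.
    have := dunkl_translation_norm_le nu_gt mg g0 x (- y); rewrite even_meanN//.
    move=> h1 h2; apply: (le_trans (leeD h2 h1)).
    rewrite -ge0_muleDl// -EFinD.
    by apply: lee_wpmul2r; [exact: even_mean_ge0|rewrite lee_fin; lra].
pose P y := if (`|y| < r)%R then paired_mean nu x g y else 0.
have mP : measurable_fun setT P.
  by rewrite /P; apply: measurable_fun_ifT; [by meas|exact: m_paired_mean|by meas].
have P0 y : 0 <= P y by rewrite /P; case: ifP => // _; exact: paired_mean_ge0.
transitivity (c0%:E * (C%:E * \int[half n]_y P y)); last first.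
  rewrite EFinM muleA; congr (_ * _); apply: eq_integral_half => //.
  - by apply: measurable_fun_ifT; [by meas|exact: m_paired_mean|by meas].
  - by move=> y; case: ifP => // _; exact: paired_mean_ge0.
  - by move=> y y0; rewrite /P gtr0_norm.
congr (_ * _); rewrite -ge0_integralZl//; apply: ae_eq_integral => //.
- exact: (measurable_fun_EFin (measurable_funD mh mhN)).
- exact: (emeasurable_funM (measurable_cst _) mP).
have := integrable_ae measurableT Fint; apply: filterS => y Fy _.
rewrite /h /P normrN; move: (Fy I); rewrite /F; case: ifP => _ Fy'; last first.
  by rewrite addr0 mule0.
have Fy2 : even_mean nu x g y < +oo by rewrite -ge0_fin_numE ?even_mean_ge0.
exact (dunkl_translation_pair nu_gt mg g0 Fy2).
Qed.

End nonnegative.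

Lemma translation_ball_upper : (0 < c0)%R ->
  exists2 K, (0 < K)%R & forall x r g, (0 < r)%R ->
  measurable_fun setT g -> (forall z, (0 <= g z)%R) ->
  \int[half n]_z (if (`|z - `|x| | < r)%R then (even_part g z)%:E else 0) < +oo ->
  0 <= \int[dunkl_measure nu]_(y in ball (0%R : R) r) (dunkl_translation nu x g y)%:E <=
  (K * (r / (`|x| + r)) `^ n)%:E *
    \int[half n]_z (if (`|z - `|x| | < r)%R then (even_part g z)%:E else 0).
Proof.
move=> c00; have CE := dunkl_const_ge0 nu.
have [K K0 up] := disc_upper n0.
(* The [+ 1] keeps the constant positive when only [C >= 0] is known. *)
exists (c0 * (C + 1) * 2 * K)%R; first by rewrite !mulr_gt0//; lra.
move=> x r g r0 mg g0 fin.
have mgs := measurable_even_part mg.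
have mgE : measurable_fun setT (fun z => (even_part g z)%:E) by meas.
have up1 := up x r _ r0 mgE (fun z => even_part_ge0 z g0).
pose I := \int[half n]_z (if (`|z - `|x| | < r)%R then (even_part g z)%:E else 0).
have I0 : 0 <= I by apply: integral_ge0 => z _; case: ifP => // _; rewrite lee_fin even_part_ge0.
have m1 := measurable_even_mean nu mg g0 x.
have m2 := measurable_paired_mean nu mg g0 x.
have p1 := even_mean_ge0 nu g0 x; have p2 := paired_mean_ge0 nu g0 x.
have fin2 : \int[half n]_y (if (y < r)%R then even_mean nu x g y else 0) < +oo.
  apply: (le_lt_trans up1); rewrite lte_mul_pinfty// lee_fin mulr_ge0 ?powR_ge0//.
  exact: ltW.
rewrite integral_translation_ball//.
have J0 : 0 <= \int[half n]_y (if (y < r)%R then paired_mean nu x g y else 0).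
  by apply: integral_ge0 => y _; case: ifP => _; [exact: p2|exact: lexx].
have cC : 0 <= (c0 * C)%:E by rewrite lee_fin; exact (mulr_ge0 (ltW c00) CE).
apply/andP; split; first exact: mule_ge0.
apply: (@le_trans _ _ ((c0 * C)%:E * (2%:E * ((K * (r / (`|x| + r)) `^ n)%:E * I)))).
  apply: lee_wpmul2l => //.
  apply: le_trans (lee_wpmul2l _ up1) => //.
  rewrite -ge0_integralZl//; last 2 first.
  - by apply: measurable_fun_ifT; [by meas|exact: m1|by meas].
  - by move=> y _; case: ifP => _; [exact: p1|exact: lexx].
  apply: integral_half_le.
  - by apply: measurable_fun_ifT; [by meas|exact: m2|by meas].
  - apply: emeasurable_funM => //.
    by apply: measurable_fun_ifT; [by meas|exact: m1|by meas].
  - by move=> y; case: ifP => _; [exact: p2|exact: lexx].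
  - by move=> y; apply: mule_ge0 => //; case: ifP => _; [exact: p1|exact: lexx].
  - by move=> y y0; case: ifP => _; [exact: paired_mean_le|rewrite mule0].
rewrite !muleA -!EFinM; apply: lee_wpmul2r => //; rewrite lee_fin.
have : (0 <= c0 * 2 * (K * (r / (`|x| + r)) `^ n))%R.
  by rewrite !mulr_ge0 ?powR_ge0//; apply: ltW.
by nra.
Qed.

(** The translate at [x] controls [g] on the positive side; the translate at [- x] has the paired
    mean of the reflected function, and so controls [g (- z)]. The sum recovers [even_part g]. *)
Lemma translation_ball_lower : (0 < c0)%R -> (0 < C)%R ->
  exists2 c, (0 < c)%R & forall x r g, (0 < x)%R -> (0 < r)%R ->
  measurable_fun setT g -> (forall z, (0 <= g z)%R) ->
  \int[half n]_y (if (y < 2 * r)%R then even_mean nu x g y else 0) < +oo ->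
  (c * (r / (x + r)) `^ n)%:E *
    \int[half n]_z (if (`|z - x| < r)%R then (even_part g z)%:E else 0) <=
  \int[dunkl_measure nu]_(y in ball (0%R : R) (2 * r)) (dunkl_translation nu x g y)%:E +
  \int[dunkl_measure nu]_(y in ball (0%R : R) (2 * r)) (dunkl_translation nu (- x)%R g y)%:E.
Proof.
move=> c00 CE; have [c c1 low] := disc_lower n0.
exists (c0 * C * c)%R; first exact (mulr_gt0 (mulr_gt0 c00 CE) c1).
move=> x r g x0 r0 mg g0 fin.
have cC : 0 <= (c0 * C)%:E by have /ltW := mulr_gt0 c00 CE; rewrite lee_fin.
have low1 (f : R -> R) : measurable_fun setT f -> (forall z, (0 <= f z)%R) ->
    (c0 * C * c * (r / (x + r)) `^ n)%:E *
      \int[half n]_z (if (`|z - x| < r)%R then (f z)%:E else 0) <=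
    (c0 * C)%:E * \int[half n]_y (if (y < 2 * r)%R then paired_mean nu x f y else 0).
  move=> mf f0; rewrite -2!mulrA mulrA EFinM -muleA; apply: lee_wpmul2l => //.
  have mfE : measurable_fun setT (fun z => (f z)%:E) by meas.
  apply: (le_trans (low x r _ x0 r0 mfE _)) => //.
  have mr3 : measurable_fun setT (fun q : R * R =>
      if (0 <= x + q.1 * q.2)%R then (f (rho x q.1 q.2))%:E else 0).
    apply: measurable_fun_ifT; [by meas| |by meas].
    by apply: measurable_fun_EFin; apply: measurable_fun_comp1 => //; apply: measurable_rho; meas.
  apply: integral_half_le.
  - apply: measurable_fun_ifT; [by meas| |by meas].
    by apply: (measurable_fun_ang n mr3) => q; case: ifP; rewrite ?lee_fin.
  - by apply: measurable_fun_ifT; [by meas|exact: measurable_paired_mean|by meas].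
  - by move=> y; case: ifP => // _; apply: integral_ge0 => u _; case: ifP; rewrite ?lee_fin.
  - by move=> y; case: ifP => _; [exact (paired_mean_ge0 nu f0 x y)|exact: lexx].
  move=> y y0; case: ifP => // _; apply: integral_ang_le.
  - apply: measurable_fun_ifT; [by meas| |by meas].
    by apply: measurable_fun_EFin; apply: measurable_fun_comp1 => //; apply: measurable_rho; meas.
  - by apply: measurable_fun_EFin; apply: measurable_paired_density; meas.
  - by move=> u; case: ifP; rewrite ?lee_fin.
  - by move=> u; rewrite lee_fin paired_density_ge0.
  move=> u _; case: ifP => h; rewrite lee_fin; first exact: paired_density_ge.
  exact: paired_density_ge0.
have mgN : measurable_fun setT (fun z => g (- z)%R) by apply: measurable_fun_comp1 => //; meas.
have finN : \int[half n]_y (if (y < 2 * r)%R then even_mean nu (- x)%R g y else 0) < +oo.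
  rewrite (eq_integral (fun y => if (y < 2 * r)%R then even_mean nu x g y else 0))//.
  by move=> y _; rewrite even_meanNl.
rewrite (integral_translation_ball mg g0 fin) (integral_translation_ball mg g0 finN).
have -> : \int[half n]_y (if (y < 2 * r)%R then paired_mean nu (- x)%R g y else 0) =
    \int[half n]_y (if (y < 2 * r)%R then paired_mean nu x (fun z => g (- z)%R) y else 0).
  by apply: eq_integral => y _; rewrite paired_meanN.
apply: le_trans (leeD (low1 _ mg g0) (low1 _ mgN (fun z => g0 _))).
rewrite -ge0_muleDr; last 2 first.
- by apply: integral_ge0 => z _; case: ifP; rewrite ?lee_fin.
- by apply: integral_ge0 => z _; case: ifP; rewrite ?lee_fin.
apply: lee_wpmul2l.
  by rewrite lee_fin; apply: mulr_ge0 (powR_ge0 _ _); have /ltW := mulr_gt0 (mulr_gt0 c00 CE) c1.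
have mb : measurable_fun setT (fun z => (`|z - x| < r)%R).
  by apply: measurable_fun_ltr; meas.
rewrite -ge0_integralD//; last 4 first.
- by move=> z _; case: ifP; rewrite ?lee_fin.
- by meas.
- by move=> z _; case: ifP; rewrite ?lee_fin.
- by meas.
rewrite le_eqVlt; apply/orP; left; apply/eqP; apply: eq_integral => z _.
by case: ifP => // _; rewrite adde0.
Qed.

(** The ball and its reflection lie in a compact interval. The integral over the half-line inherits
    finiteness because the factor [c0] is positive. *)
Lemma half_even_ball_lt g x r : (0 < c0)%R -> (forall z, (0 <= g z)%R) ->
  dunkl_locally_integrable nu g ->
  \int[half n]_z (if (`|z - x| < r)%R then (even_part g z)%:E else 0) < +oo.
Proof.
move=> c00 g0 [mg locg].
pose M := (`|x| + r)%R; have /integrableP[_] := locg _ (@segment_compact R (- M)%R M).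
rewrite integral_mkcond.
have mK : measurable (`[(- M)%R, M]%classic : set R) by exact: measurable_itv.
have mgE : measurable_fun setT (EFin \o g) by exact/measurable_EFinP.
have ma : measurable_fun setT (fun z => if (`|z| <= M)%R then (g z)%:E else 0).
  by meas.
rewrite (eq_integral (fun z => if (`|z| <= M)%R then (g z)%:E else 0)); last first.
  move=> z _; rewrite patchE mem_setE in_itv/= ler_norml.
  by case: ifP => // _; rewrite ger0_norm.
rewrite (integral_dunkl nu_gt)//; last by move=> z; case: ifP; rewrite ?lee_fin.
set I := \int[half n]_y _ => fin.
have : I < +oo.
  rewrite ltey; apply/eqP => Ioo; move: fin; rewrite Ioo gt0_muley ?lte_fin//.
apply: le_lt_trans; apply: integral_half_le.
- have me := measurable_even_part mg.
  apply: measurable_fun_ifT; [|by meas|by meas].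
  by apply: measurable_fun_ltr; meas.
- by apply: (emeasurable_funD ma); apply: (measurable_fun_comp1 ma); meas.
- by move=> z; case: ifP => // _; rewrite lee_fin even_part_ge0.
- by move=> z; rewrite adde_ge0//; case: ifP; rewrite ?lee_fin.
move=> z z0; case: ifPn => zx; last by rewrite adde_ge0//; case: ifP; rewrite ?lee_fin.
have zM : (`|z| <= M)%R.
  rewrite /M -[z in `|z|%R](subrK x) addrC.
  by apply: (le_trans (ler_normD _ _)); rewrite lerD2l ltW.
by rewrite normrN zM -EFinD.
Qed.

End translation_ball.

(** * Dunkl Morrey norms *)

Section morrey_translation.
Context {R : realType}.
Variable nu : R.
Hypothesis nu_gt : - (1 / 2) < nu.
Implicit Types (x y z u r A m : R) (g h : R -> R).
Local Notation n := (2 * nu + 1).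
Local Notation c0 := (dunkl_norm nu).
Local Notation C := (dunkl_const nu).
Local Notation trans g x r := (\int[dunkl_measure nu]_(y in ball (0%R : R) r)
  (dunkl_translation nu x g y)%:E)%E.
Local Open Scope ereal_scope.

Let n0 : (0 < n)%R. Proof. by have := nu_gt; lra. Qed.

Lemma even_mean_ball_lt g x r : (0 < c0)%R -> (0 < r)%R -> (forall z, (0 <= g z)%R) ->
  dunkl_locally_integrable nu g ->
  \int[half n]_y (if (y < r)%R then even_mean nu x g y else 0) < +oo.
Proof.
move=> c00 r0 g0 lg; have [mg _] := lg.
have [K K0 up] := disc_upper n0.
have mgs := measurable_even_part mg.
have mgE : measurable_fun setT (fun z => (even_part g z)%:E) by meas.
apply: (le_lt_trans (up x r _ r0 mgE (fun z => even_part_ge0 z g0))).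
rewrite lte_mul_pinfty// ?lee_fin ?mulr_ge0 ?powR_ge0 ?(ltW K0)//.
exact: half_even_ball_lt.
Qed.

(** The lower bound at radius [2 r] is divided by [(r / (x + r)) ^ n], which leaves
    [r ^ (1 - m) (x + r) ^ n]. The factor [2] accounts for the translates at [x] and [- x]. *)
Lemma morrey_density_translation m : (0 < c0)%R -> (0 < C)%R ->
  exists2 K, (0 < K)%R & forall g A, (forall z, (0 <= g z)%R) ->
  dunkl_locally_integrable nu g ->
  (forall x r, (0 < r)%R -> trans g x r <= (A * r `^ (n + 1 - m))%:E) ->
  morrey_density n (K * A) m (fun z => (even_part g z)%:E).
Proof.
move=> c00 CE; have [c c1 low] := translation_ball_lower nu_gt c00 CE.
exists (2 * 2 `^ (n + 1 - m) / c)%R; first by rewrite divr_gt0// mulr_gt0// powR_gt0.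
move=> g A g0 lg TA x r x0 r0; have [mg _] := lg.
have r2 : (0 < 2 * r)%R by rewrite mulr_gt0.
have fin := even_mean_ball_lt x c00 r2 g0 lg.
have := le_trans (low x r g x0 r0 mg g0 fin) (leeD (TA x _ r2) (TA (- x)%R _ r2)).
have := half_even_ball_lt nu_gt x r c00 g0 lg.
set I := \int[half n]_z _ => Ifin.
have I0 : 0 <= I.
  by apply: integral_ge0 => z _; case: ifP => _; [rewrite lee_fin; exact: even_part_ge0|exact: lexx].
have IF : I \is a fin_num by rewrite ge0_fin_numE.
rewrite -(fineK IF) -EFinD -EFinM !lee_fin.
have xr : (0 < x + r)%R by exact: addr_gt0.
set i := fine I; set w := ((r / (x + r)) `^ n)%R.
have wE : (w * (x + r) `^ n = r `^ n)%R.
  rewrite /w -powRM ?divr_ge0 ?(ltW r0) ?(ltW xr)//.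
  by congr (_ `^ _)%R; rewrite divfK// gt_eqF.
have w0 : (0 < w)%R by rewrite powR_gt0// divr_gt0.
have -> : ((2 * r) `^ (n + 1 - m) = 2 `^ (n + 1 - m) * (r `^ n * r `^ (1 - m)))%R.
  rewrite powRM ?(ltW r0)//; congr (_ * _)%R.
  rewrite -(@powRD _ r) ?(gt_eqF r0) ?implybT//.
  by congr (_ `^ _)%R; ring.
rewrite -wE => le.
rewrite -(ler_pM2l (mulr_gt0 c1 w0)); apply: (le_trans le).
rewrite le_eqVlt; apply/orP; left; apply/eqP; field.
by rewrite gt_eqF.
Qed.

(** Translations occur at every real point, the density only at positive ones: [|x|] replaces [x],
    and for [x = 0] the ball of centre and radius [r] is used. This costs the factor [2 ^ n]. *)
Lemma translation_morrey_density : (0 < c0)%R ->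
  exists2 K, (0 < K)%R & forall g A m, (forall z, (0 <= g z)%R) -> (0 <= A)%R ->
  measurable_fun setT g ->
  morrey_density n A m (fun z => (even_part g z)%:E) ->
  forall x r, (0 < r)%R -> 0 <= trans g x r <= (K * A * r `^ (n + 1 - m))%:E.
Proof.
move=> c00; have [K K0 up] := translation_ball_upper nu_gt c00.
exists (K * 2 `^ n)%R; first by rewrite mulr_gt0// powR_gt0.
move=> g A m g0 A0 mg mor x r r0.
have mgs := measurable_even_part mg.
have key : \int[half n]_z (if (`|z - `|x| | < r)%R then (even_part g z)%:E else 0) <=
    (A * r `^ (1 - m) * (2 * (`|x| + r)) `^ n)%:E.
  have [x0|x0] := eqVneq x 0%R.
    have le := mor r r r0 r0; rewrite x0 normr0.
    apply: (@le_trans _ _ (A * r `^ (1 - m) * (r + r) `^ n)%:E); last first.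
      by have -> : (2 * (0 + r) = r + r)%R by ring.
    apply: le_trans le; apply: integral_half_le.
    - apply: measurable_fun_ifT; [|by meas|by meas].
      by apply: measurable_fun_ltr; meas.
    - apply: measurable_fun_ifT; [|by meas|by meas].
      by apply: measurable_fun_ltr; meas.
    - by move=> z; case: ifP => _; [rewrite lee_fin; exact: even_part_ge0|exact: lexx].
    - by move=> z; case: ifP => _; [rewrite lee_fin; exact: even_part_ge0|exact: lexx].
    move=> z z0; rewrite subr0 (gtr0_norm z0); case: ifP => zr.
      by rewrite ifT// ltr_norml; apply/andP; split; lra.
    by case: ifP => _; [rewrite lee_fin; exact: even_part_ge0|exact: lexx].
  have ax : (0 < `|x|)%R by rewrite normr_gt0.
  apply: (le_trans (mor _ _ ax r0)); rewrite lee_fin.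
  apply: ler_wpM2l; first by rewrite mulr_ge0 ?powR_ge0.
  by apply: ge0_ler_powR; rewrite ?nnegrE ?(ltW n0)//; lra.
have fin := le_lt_trans key (ltry _).
have /andP[h1 h2] := up x r g r0 mg g0 fin.
rewrite h1/=; apply: (le_trans h2).
have K1 : 0 <= (K * (r / (`|x| + r)) `^ n)%:E.
  by rewrite lee_fin mulr_ge0 ?powR_ge0// ltW.
apply: (le_trans (lee_wpmul2l K1 key)).
have xr : (0 < `|x| + r)%R by have := normr_ge0 x; lra.
rewrite -EFinM lee_fin (powRM _ (ler0n _ 2) (ltW xr)).
have wE : ((r / (`|x| + r)) `^ n * (`|x| + r) `^ n = r `^ n)%R.
  rewrite -powRM ?divr_ge0 ?(ltW r0) ?(ltW xr)//.
  by congr (_ `^ _)%R; rewrite divfK// gt_eqF.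
have -> : (r `^ (n + 1 - m) = r `^ n * r `^ (1 - m))%R.
  rewrite -(@powRD _ r) ?(gt_eqF r0) ?implybT//.
  by congr (_ `^ _)%R; ring.
by rewrite -wE le_eqVlt; apply/orP; left; apply/eqP; ring.
Qed.

End morrey_translation.

Section morrey_norm.
Context {R : realType}.
Variable nu : R.
Hypothesis nu_gt : - (1 / 2) < nu.
Implicit Types (x y z u r A m p q : R) (g h : R -> R) (f : R -> R[i]).
Local Notation n := (2 * nu + 1).
Local Notation c0 := (dunkl_norm nu).
Local Notation C := (dunkl_const nu).
Local Notation trans g x r := (\int[dunkl_measure nu]_(y in ball (0%R : R) r)
  (dunkl_translation nu x g y)%:E)%E.
Local Open Scope ereal_scope.

Lemma translation_ball_ge0 g x r : (0 < c0)%R -> (forall z, (0 <= g z)%R) -> (0 < r)%R ->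
  dunkl_locally_integrable nu g -> 0 <= trans g x r.
Proof.
move=> c00 g0 r0 lg; have [mg _] := lg.
have [K K0 up] := translation_ball_upper nu_gt c00.
by have /andP[] := up x r g r0 mg g0 (half_even_ball_lt nu_gt `|x|%R r c00 g0 lg).
Qed.

(** A compact set lies in some [[- N, N]], which folds into the half-line ball of centre and radius
    [N + 1]. Without this the Morrey norm of the result would be [+oo] by definition. *)
Lemma morrey_density_locally_integrable g A m : (forall z, (0 <= g z)%R) ->
  measurable_fun setT g ->
  morrey_density n A m (fun z => (even_part g z)%:E) -> dunkl_locally_integrable nu g.
Proof.
move=> g0 mg mor; split => // K cK.
have [M [_ KM]] := compact_bounded cK.
pose N := (`|M| + 1)%R; have N0 : (0 < N)%R by rewrite /N; have := normr_ge0 M; lra.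
have {}KM z : K z -> (`|z| <= N)%R.
  by move=> Kz; apply: KM => //; rewrite /N; have := ler_norm M; lra.
have mK : measurable K by exact: compact_measurable.
have mgE : measurable_fun setT (EFin \o g) by exact/measurable_EFinP.
apply/integrableP; split; first exact: measurable_funTS.
have N1 : (0 < N + 1)%R by lra.
have ma : measurable_fun setT (fun z => if (`|z| <= N)%R then (g z)%:E else 0).
  by meas.
have a0 z : 0 <= (if (`|z| <= N)%R then (g z)%:E else 0).
  by case: ifP => _; [rewrite lee_fin|exact: lexx].
apply: (@le_lt_trans _ _ (\int[dunkl_measure nu]_z (if (`|z| <= N)%R then (g z)%:E else 0))).
  rewrite integral_mkcond; apply: ge0_le_integral => //.
  - by move=> z _; rewrite patchE; case: ifP.
  - by apply/(measurable_restrictT _ mK); apply: measurable_funTS; exact: measurableT_comp.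
  move=> z _; rewrite patchE; case: ifPn => // /set_mem Kz.
  by rewrite KM//= (ger0_norm (g0 z)).
rewrite (integral_dunkl nu_gt ma a0).
have le : \int[half n]_y ((if (`|y| <= N)%R then (g y)%:E else 0) +
    (if (`|- y| <= N)%R then (g (- y)%R)%:E else 0)) <=
    (A * (N + 1) `^ (1 - m) * ((N + 1) + (N + 1)) `^ n)%:E.
  apply: le_trans (mor _ _ N1 N1); apply: integral_half_le.
  - by apply: (emeasurable_funD ma); apply: (measurable_fun_comp1 ma); meas.
  - have me := measurable_even_part mg; apply: measurable_fun_ifT; [|by meas|by meas].
    by apply: measurable_fun_ltr; meas.
  - by move=> z; apply: adde_ge0 => //; exact: a0 (- z)%R.
  - by move=> z; case: ifP => _; [rewrite lee_fin even_part_ge0|exact: lexx].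
  move=> z z0; rewrite normrN (gtr0_norm z0).
  case: ifP => zN; last by rewrite adde0; case: ifP => _; [rewrite lee_fin even_part_ge0|exact: lexx].
  by rewrite ifT ?EFinD//; rewrite ltr_norml; apply/andP; split; lra.
apply: (le_lt_trans (lee_wpmul2l _ le)); first by rewrite lee_fin dunkl_norm_ge0.
by rewrite -EFinM ltry.
Qed.

Lemma dunkl_morrey_norm_le p q f B : (0 < p)%R -> (0 <= B)%R ->
  dunkl_locally_integrable nu (fun z => normc (f z) `^ p)%R ->
  (forall x r, (0 < r)%R ->
    0 <= trans (fun z => normc (f z) `^ p)%R x r <=
    (B * r `^ (n + 1 - (n + 1) / q * p))%:E) ->
  dunkl_morrey_norm nu p q f <= (B `^ p^-1)%:E.
Proof.
move=> p0 B0 lg TB; rewrite /dunkl_morrey_norm asboolT//.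
apply: ge_ereal_sup => _ [x [r [r0 ->]]].
have /andP[T0 T1] := TB x r r0.
apply: (@le_trans _ _ ((r `^ (dunkl_dim nu * (q^-1 - p^-1)))%R%:E *
  poweR (B * r `^ (n + 1 - (n + 1) / q * p))%:E p^-1)).
  apply: lee_wpmul2l; first by rewrite lee_fin powR_ge0.
  apply: gt0_ler_poweR T1 => //; rewrite ?invr_ge0 ?(ltW p0)//.
    by rewrite in_itv/= T0 leey.
  by rewrite in_itv/= leey lee_fin mulr_ge0 ?powR_ge0.
rewrite poweR_EFin powRM ?powR_ge0// -EFinM lee_fin mulrCA -powRrM.
rewrite -(@powRD _ r) ?(gt_eqF r0) ?implybT//.
have -> : (dunkl_dim nu * (q^-1 - p^-1) + (n + 1 - (n + 1) / q * p) / p = 0)%R.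
  rewrite /dunkl_dim; have pN : (p != 0)%R by rewrite gt_eqF.
  by move: (q^-1)%R => v; field.
by rewrite powRr0 mulr1.
Qed.

Lemma dunkl_morrey_norm_bound p q f A : (0 < p)%R -> (0 < c0)%R ->
  dunkl_morrey_norm nu p q f <= A%:E ->
  dunkl_locally_integrable nu (fun z => normc (f z) `^ p)%R /\
  forall x r, (0 < r)%R ->
    trans (fun z => normc (f z) `^ p)%R x r <=
    (A `^ p * r `^ (n + 1 - (n + 1) / q * p))%:E.
Proof.
move=> p0 c00; rewrite /dunkl_morrey_norm; case: asboolP => // lg le; split => // x r r0.
have g0 z : (0 <= normc (f z) `^ p)%R by exact: powR_ge0.
have T0 := translation_ball_ge0 x c00 g0 r0 lg.
set T := trans _ x r in T0 *; set w := (r `^ (dunkl_dim nu * (q^-1 - p^-1)))%R.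
have w0 : (0 < w)%R by rewrite powR_gt0.
have {le} : w%:E * poweR T p^-1 <= A%:E.
  by apply: le_trans le; apply: ereal_sup_ubound; exists x, r.
have wE : (w `^ p * r `^ (n + 1 - (n + 1) / q * p) = 1)%R.
  rewrite /w -powRrM -(@powRD _ r) ?(gt_eqF r0) ?implybT//.
  rewrite -[RHS](powRr0 r); congr (_ `^ _)%R.
  rewrite /dunkl_dim; have pN : (p != 0)%R by rewrite gt_eqF.
  by move: (q^-1)%R => v; field.
move: T0; case: T => [T T0|_|//]; last first.
  by rewrite poweRyr ?invr_eq0 ?gt_eqF// gt0_muley ?lte_fin// leye_eq.
rewrite poweR_EFin -EFinM !lee_fin => le.
have h : ((w * T `^ p^-1) `^ p <= A `^ p)%R.
  have l0 : (0 <= w * T `^ p^-1)%R by rewrite mulr_ge0 ?powR_ge0 ?(ltW w0).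
  by apply: ge0_ler_powR => //; rewrite ?nnegrE ?(ltW p0)//; exact: le_trans l0 le.
apply: (@le_trans _ _ (T * w `^ p * r `^ (n + 1 - (n + 1) / q * p))%R).
  by rewrite -mulrA wE mulr1.
apply: ler_wpM2r; first exact: powR_ge0.
clearbody w; apply: le_trans h; rewrite powRM ?powR_ge0 ?(ltW w0)// -powRrM mulVf ?gt_eqF// powRr1.
  by rewrite mulrC.
by rewrite -lee_fin.
Qed.

Lemma dunkl_morrey_norm_ge0 p q f : 0 <= dunkl_morrey_norm nu p q f.
Proof.
rewrite /dunkl_morrey_norm; case: asboolP => _; last exact: leey.
apply: le_trans (ereal_sup_ubound _); last first.
  by exists 0%R, 1%R; split => //; reflexivity.
by rewrite mule_ge0 ?lee_fin ?powR_ge0// poweR_ge0.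
Qed.

End morrey_norm.

Section complex_modulus.
Context {R : realType}.
Implicit Types (r : R) (f : R -> R[i]).
Local Open Scope complex_scope.

Lemma Re_mul_real (c : R[i]) r : complex.Re (c * r%:C) = (complex.Re c * r)%R.
Proof. by case: c => a b /=; rewrite mulr0 subr0. Qed.

Lemma Im_mul_real (c : R[i]) r : complex.Im (c * r%:C) = (complex.Im c * r)%R.
Proof. by case: c => a b /=; rewrite mulr0 add0r. Qed.

Lemma normc_le_ReIm (c : R[i]) : normc c <= `|complex.Re c| + `|complex.Im c|.
Proof.
case: c => a b /=; rewrite -[leRHS]ger0_norm ?addr_ge0// -sqrtr_sqr ler_wsqrtr//.
rewrite sqrrD !real_normK ?num_real//.
by have := mulr_ge0 (normr_ge0 a) (normr_ge0 b); lra.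
Qed.

Lemma normc_ge_Re (c : R[i]) : `|complex.Re c| <= normc c.
Proof. by case: c => a b /=; rewrite -sqrtr_sqr ler_wsqrtr// lerDl sqr_ge0. Qed.

Lemma normc_ge_Im (c : R[i]) : `|complex.Im c| <= normc c.
Proof. by case: c => a b /=; rewrite -sqrtr_sqr ler_wsqrtr// lerDr sqr_ge0. Qed.

Lemma measurable_normc f : cmeasurable_fun setT f -> measurable_fun setT (fun x => normc (f x)).
Proof.
move=> [mR mI].
rewrite (_ : (fun x => _) = fun x => Num.sqrt (complex.Re (f x) ^+ 2 + complex.Im (f x) ^+ 2)); last first.
  by apply/funext => x; case: (f x).
by meas.
Qed.

End complex_modulus.

(** * The Dunkl fractional integral *)

Section frac_integral_bound.
Context {R : realType}.
Variables nu gam alp : R.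
Hypothesis nu_gt : - (1 / 2) < nu.
Implicit Types (x y z u r : R) (phi m H : R -> R) (f : R -> R[i]).
Local Notation n := (2 * nu + 1).
Local Notation c0 := (dunkl_norm nu).
Local Notation C := (dunkl_const nu).
Local Notation K := (riesz_kernel nu gam).
Local Notation potential H x := (\int[pol n]_t potential_density n gam alp H x t)%E.
Local Open Scope ereal_scope.

Let nuN : (nu != - (1 / 2))%R. Proof. by rewrite gt_eqF. Qed.

Lemma riesz_kernel_ge0 z : (0 <= K z)%R. Proof. exact: powR_ge0. Qed.

Lemma measurable_riesz_kernel : measurable_fun setT K.
Proof.
by rewrite (_ : K = fun z => (`|z| `^ (gam - dunkl_dim nu))%R)//; meas.
Qed.

Let mK := measurable_riesz_kernel.

Lemma even_mean_riesz x y : even_mean nu y K x =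
  2%:E * \int[ang n]_u (rho `|x| `|y| u `^ (gam - (n + 1)))%:E.
Proof.
have mr : measurable_fun setT (rho `|x| `|y|) by apply: measurable_rho; meas.
have mrE : measurable_fun setT (fun u => (rho `|x| `|y| u `^ (gam - (n + 1)))%:E) by meas.
have two0 : 0 <= 2%:E :> \bar R by rewrite lee_fin.
rewrite -(ge0_integralZl (ang n) measurableT mrE (fun u _ => powR_ge0 _ _) two0).
have mG : measurable_fun setT (fun z => (even_part K z)%:E).
  by apply: measurable_fun_EFin; exact: measurable_even_part.
have G0 z : 0 <= (even_part K z)%:E by rewrite lee_fin even_part_ge0//; exact: riesz_kernel_ge0.
rewrite /even_mean (integral_ang_rho_norm n y x mG G0); apply: eq_integral => u _.
rewrite -EFinM rhoC /even_part /riesz_kernel normrN ger0_norm ?rho_ge0//.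
have -> : dunkl_dim nu = (n + 1)%R by rewrite /dunkl_dim; ring.
by congr EFin; ring.
Qed.

Lemma measurable_even_mean_riesz x : measurable_fun setT (fun y => even_mean nu y K x).
Proof.
rewrite (_ : (fun y => _) = fun y => \int[ang n]_u (even_part K (rho y x u))%:E) //.
have mG := measurable_even_part mK.
apply: (@measurable_fun_ang _ n (fun q : R * R => (even_part K (rho q.1 x q.2))%:E)).
  by apply: measurable_fun_EFin; apply: measurable_fun_comp1 => //; apply: measurable_rho; meas.
by move=> q; rewrite lee_fin even_part_ge0//; exact: riesz_kernel_ge0.
Qed.

Lemma measurable_riesz_translation d (T : measurableType d) (a b : T -> R) :
  measurable_fun setT a -> measurable_fun setT b ->
  measurable_fun setT (fun t => dunkl_translation nu (a t) K (b t)).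
Proof.
move=> ma mb.
rewrite (_ : (fun t => _) = fun t =>
  (C / 2 * fine (\int[ang n]_u (translation_density (a t) K (b t) u)%:E))%R); last first.
  by apply/funext => t; rewrite dunkl_translationE.
apply: measurable_funM => //; apply: measurable_fun_fine.
apply: (@measurable_integral_EFin _ _ _ (ang n)
  (fun q : T * R => translation_density (a q.1) K (b q.1) q.2)).
apply: measurable_translation_density => //; first exact: (measurableT_comp ma measurable_fst).
exact: (measurableT_comp mb measurable_fst).
Qed.

(** Meant for [phi] the real or imaginary part of [f] and [m] its modulus. The bound on the
    translated kernel depends only on [|x|] and [|y|], so [y] and [- y] combine into
    [m y + m (- y)]. The factor [4 C] is [2 C] from the translation times [2] from the even
    kernel. *)
Lemma integral_riesz_le phi m H L x : measurable_fun setT phi -> measurable_fun setT m ->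
  measurable_fun setT H -> (forall y, (0 <= H y)%R) -> (0 <= L)%R ->
  (forall y, (`|phi y| <= m y)%R) ->
  (forall y, (0 < y)%R -> (m y + m (- y) = L * (y `^ (- alp) * H y))%R) ->
  \int[dunkl_measure nu]_y `|(phi y * dunkl_translation nu y K x)%:E| <=
  (c0 * (4 * C) * L)%:E * potential H `|x|.
Proof.
move=> mphi mm mH H0 L0 phim mL; have CE := dunkl_const_ge0 nu.
have K0 := riesz_kernel_ge0.
have m0 y : (0 <= m y)%R by apply: le_trans (phim y).
have mt : measurable_fun setT (fun y => dunkl_translation nu y K x).
  by apply: (@measurable_riesz_translation _ _ (fun y => y) (fun=> x)); meas.
have me := measurable_even_mean_riesz x.
pose Phi y := (m y)%:E * ((2 * C)%:E * even_mean nu y K x).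
have C2 : 0 <= (2 * C)%:E by rewrite lee_fin; lra.
have e0 y : 0 <= even_mean nu y K x by exact: even_mean_ge0.
have mPhi : measurable_fun setT Phi.
  apply: emeasurable_funM; first by meas.
  exact: (emeasurable_funM (measurable_cst _) me).
have Phi0 y : 0 <= Phi y by rewrite /Phi; apply: mule_ge0; [rewrite lee_fin|exact: mule_ge0].
apply: (@le_trans _ _ (\int[dunkl_measure nu]_y Phi y)).
  apply: ge0_le_integral => //.
  - apply: measurableT_comp => //; apply: measurable_fun_EFin.
    exact: (measurable_funM mphi mt).
  - move=> y _; rewrite abse_EFin normrM EFinM; apply: lee_pmul; rewrite ?lee_fin//.
    exact: dunkl_translation_norm_le.
rewrite (integral_dunkl nu_gt mPhi Phi0) -mulrA EFinM -muleA.
apply: lee_wpmul2l; first by rewrite lee_fin dunkl_norm_ge0.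
have mP : measurable_fun setT (potential_density n gam alp H `|x|).
  exact: measurable_potential_section.
have P0 t := potential_density_ge0 n gam alp `|x|%R t H0.
rewrite (integral_pol n mP P0).
have mA : measurable_fun setT (fun y => \int[ang n]_u potential_density n gam alp H `|x| (y, u)).
  by apply: measurable_fun_ang.
have A0 y : 0 <= \int[ang n]_u potential_density n gam alp H `|x| (y, u) by apply: integral_ge0.
have LC : 0 <= (4 * C * L)%:E.
  by rewrite lee_fin; apply: mulr_ge0 => //; lra.
rewrite -ge0_integralZl//.
apply: integral_half_le.
- by apply: (emeasurable_funD mPhi); apply: (measurable_fun_comp1 mPhi); meas.
- exact: (emeasurable_funM (measurable_cst _) mA).
- by move=> y; apply: adde_ge0.
- by move=> y; apply: mule_ge0.
move=> y y0; rewrite /Phi even_meanNl//.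
set E := (2 * C)%:E * _; have E0 : 0 <= E by apply: mule_ge0.
have my : 0 <= (m y)%:E by rewrite lee_fin.
have mNy : 0 <= (m (- y)%R)%:E by rewrite lee_fin.
rewrite -(ge0_muleDl _ my mNy) -EFinD mL// /E even_mean_riesz (gtr0_norm y0).
have mr : measurable_fun setT (rho `|x| y) by apply: measurable_rho; meas.
have -> : \int[ang n]_u potential_density n gam alp H `|x| (y, u) =
    (y `^ (- alp) * H y)%:E * \int[ang n]_u (rho `|x| y u `^ (gam - (n + 1)))%:E.
  rewrite -ge0_integralZl//; last 3 first.
  - by meas.
  - by move=> u _; rewrite lee_fin powR_ge0.
  - by rewrite lee_fin mulr_ge0 ?powR_ge0.
rewrite !muleA -!EFinM le_eqVlt; apply/orP; left; apply/eqP; congr (_%:E * _); ring.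
Qed.

Section potential_bound.
Variables (f : R -> R[i]) (H : R -> R) (L : R).
Hypotheses (mf : cmeasurable_fun setT f) (mH : measurable_fun setT H).
Hypotheses (H0 : forall y, (0 <= H y)%R) (L0 : (0 <= L)%R).
Hypothesis fL : forall y, (0 < y)%R ->
  (normc (f y) + normc (f (- y)) = L * (y `^ (- alp) * H y))%R.

Let mn := measurable_normc mf.

Lemma frac_integrand_Re_le x :
  \int[dunkl_measure nu]_y `|(complex.Re (dunkl_frac_integrand nu gam f x y))%:E| <=
  (c0 * (4 * C) * L)%:E * potential H `|x|.
Proof.
have := @integral_riesz_le (fun y => complex.Re (f y)) _ H L x mf.1 mn mH H0 L0
  (fun y => normc_ge_Re (f y)) fL.
by congr (_ <= _); apply: eq_integral => y _; rewrite Re_mul_real.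
Qed.

Lemma frac_integrand_Im_le x :
  \int[dunkl_measure nu]_y `|(complex.Im (dunkl_frac_integrand nu gam f x y))%:E| <=
  (c0 * (4 * C) * L)%:E * potential H `|x|.
Proof.
have := @integral_riesz_le (fun y => complex.Im (f y)) _ H L x mf.2 mn mH H0 L0
  (fun y => normc_ge_Im (f y)) fL.
by congr (_ <= _); apply: eq_integral => y _; rewrite Im_mul_real.
Qed.

Let mRe d (T : measurableType d) (a b : T -> R) : measurable_fun setT a ->
  measurable_fun setT b ->
  measurable_fun setT (fun t => complex.Re (dunkl_frac_integrand nu gam f (a t) (b t))).
Proof.
move=> ma mb; rewrite (_ : (fun t => _) = fun t =>
  (complex.Re (f (b t)) * dunkl_translation nu (b t) K (a t))%R); last first.
  by apply/funext => t; rewrite Re_mul_real.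
apply: measurable_funM; last exact: measurable_riesz_translation.
exact: (measurableT_comp mf.1 mb).
Qed.

Let mIm d (T : measurableType d) (a b : T -> R) : measurable_fun setT a ->
  measurable_fun setT b ->
  measurable_fun setT (fun t => complex.Im (dunkl_frac_integrand nu gam f (a t) (b t))).
Proof.
move=> ma mb; rewrite (_ : (fun t => _) = fun t =>
  (complex.Im (f (b t)) * dunkl_translation nu (b t) K (a t))%R); last first.
  by apply/funext => t; rewrite Im_mul_real.
apply: measurable_funM; last exact: measurable_riesz_translation.
exact: (measurableT_comp mf.2 mb).
Qed.

Lemma cintegrable_frac x : potential H `|x| < +oo ->
  cintegrable (dunkl_measure nu) setT (dunkl_frac_integrand nu gam f x).
Proof.
move=> fin; have P0 : 0 <= potential H `|x|.
  by apply: integral_ge0 => t _; exact: potential_density_ge0.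
have bound : (c0 * (4 * C) * L)%:E * potential H `|x| < +oo.
  apply: lte_mul_pinfty => //; rewrite lee_fin; apply: mulr_ge0 => //.
  apply: mulr_ge0; first exact: dunkl_norm_ge0.
  by have := dunkl_const_ge0 nu; lra.
split; apply/integrableP; split.
- by apply: measurable_fun_EFin; apply: (mRe (measurable_cst x)); meas.
- exact: le_lt_trans (frac_integrand_Re_le x) bound.
- by apply: measurable_fun_EFin; apply: (mIm (measurable_cst x)); meas.
- exact: le_lt_trans (frac_integrand_Im_le x) bound.
Qed.

Lemma fine_integral_le d (T : measurableType d) (mu : {measure set T -> \bar R}) (g : T -> R) :
  measurable_fun setT g ->
  `|fine (\int[mu]_t (g t)%:E)|%:E <= \int[mu]_t `|(g t)%:E|.
Proof.
move=> mg; apply: (@le_trans _ _ `|\int[mu]_t (g t)%:E|).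
  by case: (\int[mu]_t _) => [a| |] /=; rewrite ?leey ?lexx.
exact: (le_abse_integral mu measurableT (measurable_fun_EFin mg)).
Qed.

(** Valid at every point, since [fine] sends an infinite integral to [0]. The factor [2] comes from
    the real and imaginary parts. *)
Lemma normc_frac_integral_le x :
  (normc (dunkl_frac_integral nu gam f x))%:E <=
  (2 * (c0 * (4 * C) * L))%:E * potential H `|x|.
Proof.
apply: (@le_trans _ _ (`|complex.Re (dunkl_frac_integral nu gam f x)|%:E +
    `|complex.Im (dunkl_frac_integral nu gam f x)|%:E)).
  by rewrite -EFinD lee_fin normc_le_ReIm.
have cL : (0 <= c0 * (4 * C) * L)%R.
  apply: mulr_ge0 => //; apply: mulr_ge0; first exact: dunkl_norm_ge0.
  by have := dunkl_const_ge0 nu; lra.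
rewrite mulr_natl mulr2n EFinD ge0_muleDl ?lee_fin//; apply: leeD.
  apply: le_trans (frac_integrand_Re_le x).
  by apply: fine_integral_le; apply: (mRe (measurable_cst x)); meas.
apply: le_trans (frac_integrand_Im_le x).
by apply: fine_integral_le; apply: (mIm (measurable_cst x)); meas.
Qed.

Lemma cmeasurable_frac_integral : cmeasurable_fun setT (dunkl_frac_integral nu gam f).
Proof.
have mw := @measurable_dunkl_weight R nu.
(* Measurability in [x] needs a sigma-finite measure; this density carries that structure and agrees
   with [dunkl_measure] on measurable sets. *)
have dens (F : R -> \bar R) : measurable_fun setT F ->
    \int[dunkl_measure nu]_y F y = \int[density leb mw (dunkl_weight_ge0 nu)]_y F y.
  move=> mF; apply: eq_measure_integral => A mA _.
  rewrite /dunkl_measure /density [LHS]integral_mkcond [RHS]integral_mkcond.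
  rewrite integral_leb//; apply/(measurable_restrictT _ mA)/measurable_funTS.
  exact/measurable_EFinP.
split.
  apply: measurable_fun_fine.
  rewrite (_ : (fun x => _) = fun x => \int[density leb mw (dunkl_weight_ge0 nu)]_y
    (complex.Re (dunkl_frac_integrand nu gam f x y))%:E); last first.
    by apply/funext => x; rewrite dens//; apply: measurable_fun_EFin; apply: (mRe (measurable_cst x)); meas.
  apply: (@measurable_integral_EFin _ _ _ (density leb mw (dunkl_weight_ge0 nu))
    (fun q : R * R => complex.Re (dunkl_frac_integrand nu gam f q.1 q.2))).
  by apply: mRe; meas.
apply: measurable_fun_fine.
rewrite (_ : (fun x => _) = fun x => \int[density leb mw (dunkl_weight_ge0 nu)]_y
  (complex.Im (dunkl_frac_integrand nu gam f x y))%:E); last first.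
  by apply/funext => x; rewrite dens//; apply: measurable_fun_EFin; apply: (mIm (measurable_cst x)); meas.
apply: (@measurable_integral_EFin _ _ _ (density leb mw (dunkl_weight_ge0 nu))
  (fun q : R * R => complex.Im (dunkl_frac_integrand nu gam f q.1 q.2))).
by apply: mIm; meas.
Qed.

End potential_bound.

End frac_integral_bound.

Section frac_integral_morrey.
Context {R : realType}.
Variables nu gam alp bet p q s t : R.
Local Notation n := (2 * nu + 1).
Local Notation c0 := (dunkl_norm nu).
Local Notation C := (dunkl_const nu).
Local Notation k := ((n + 1) / q).
Local Notation b := ((n + 1) / t).
Hypothesis nu_gt : - (1 / 2) < nu.
Hypothesis gam0 : 0 < gam.
Hypothesis gamD : gam < n + 1.
Hypothesis ab0 : 0 <= alp + bet.
Hypothesis kb : k - b = gam - alp - bet.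
Hypothesis bk : b <= k.
Hypothesis b0 : 0 < b.
Hypothesis p1 : 1 < p.
Hypothesis s1 : 1 < s.
Hypothesis bs : b * s = k * p.
Hypothesis alpk : alp < n + 1 - k.
Hypothesis betb : bet < b.
Implicit Types (x y z r A L : R) (g h H : R -> R) (f : R -> R[i]).
Local Open Scope ereal_scope.

Let n0 : (0 < n)%R. Proof. by have := nu_gt; lra. Qed.
Let p0 : (0 < p)%R. Proof. by have := p1; lra. Qed.
Let s0 : (0 < s)%R. Proof. by have := s1; lra. Qed.

Lemma normc_power_mul a f x : normc (power_mul a f x) = (`|x| `^ a * normc (f x))%R.
Proof.
rewrite /power_mul ComplexField.Normc.normcM; congr (_ * _)%R.
by rewrite /= expr0n/= addr0 sqrtr_sqr ger0_norm// powR_ge0.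
Qed.

Lemma cmeasurable_power_mul a f : cmeasurable_fun setT f ->
  cmeasurable_fun setT (power_mul a f).
Proof.
move=> [mR mI]; split.
  rewrite (_ : (fun x => _) = fun x => (`|x| `^ a * complex.Re (f x))%R); first by meas.
  by apply/funext => x; rewrite /power_mul mulrC Re_mul_real mulrC.
rewrite (_ : (fun x => _) = fun x => (`|x| `^ a * complex.Im (f x))%R); first by meas.
by apply/funext => x; rewrite /power_mul mulrC Im_mul_real mulrC.
Qed.

Lemma morrey_modulus : (0 < c0)%R -> (0 < C)%R ->
  exists2 K, (0 < K)%R & forall f A, (0 < A)%R -> cmeasurable_fun setT f ->
  dunkl_morrey_norm nu p q f <= A%:E ->
  morrey n p k (fun y => ((normc (f y) + normc (f (- y))) / (K * A))%R).
Proof.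
move=> c00 CE.
have [K1 K10 mor] := morrey_density_translation nu_gt (k * p) c00 CE.
(* Chosen so that [K ^ p = 2 ^ p K1]: the factor [2 ^ p] bounds the power of the sum of the two
   moduli, and [K1] comes from the passage to the half-line. *)
pose K := (2 * K1 `^ p^-1)%R; have K0 : (0 < K)%R by rewrite /K mulr_gt0 ?powR_gt0.
exists K => //.
have Kp : (K `^ p = 2 `^ p * K1)%R.
  by rewrite powRM ?powR_ge0// -powRrM mulVf ?gt_eqF// powRr1// ltW.
move=> f A A0 mf le; have mn := measurable_normc mf.
have [lg TB] := dunkl_morrey_norm_bound nu_gt p0 c00 le.
have nn z : (0 <= normc (f z))%R := le_trans (normr_ge0 _) (normc_ge_Re (f z)).
have g0 z : (0 <= normc (f z) `^ p)%R by exact: powR_ge0.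
have := mor _ _ g0 lg TB; set g := fun z => (normc (f z) `^ p)%R => morg.
have KA : (0 < K * A)%R by exact: mulr_gt0.
have mN : measurable_fun setT (fun y => normc (f (- y)%R)).
  by apply: (measurable_fun_comp1 mn); meas.
have mH : measurable_fun setT (fun y => ((normc (f y) + normc (f (- y))) / (K * A))%R).
  by meas.
have mg : measurable_fun setT g by rewrite /g; meas.
have me := measurable_even_part mg.
have Hg y : (((normc (f y) + normc (f (- y))) / (K * A)) `^ p <=
    2 `^ p / (K * A) `^ p * even_part g y)%R.
  have {KA} : (0 < K * A)%R := KA; move: (K * A)%R => M M0.
  rewrite powRM ?addr_ge0 ?invr_ge0 ?(ltW M0)//.
  have := poweR_addr_le (ltW p0) (nn y : 0 <= (normc (f y))%:E) (nn (- y)%R : 0 <= (normc (f (- y)))%:E).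
  rewrite -EFinD !poweR_EFin -EFinD -EFinM lee_fin => h.
  have -> : (M^-1 `^ p = (M `^ p)^-1)%R.
    by rewrite -powR_inv1 ?(ltW M0)// -powRrM mulN1r powRN.
  rewrite mulrAC; apply: ler_wpM2r => //.
  by rewrite invr_ge0 powR_ge0.
split => //.
  by move=> y; rewrite divr_ge0 ?addr_ge0// ltW.
move=> x r x0 r0; have := morg x r x0 r0.
set I := \int[half n]_y _ => le2.
have c0' : (0 <= 2 `^ p / (K * A) `^ p)%R by rewrite divr_ge0 ?powR_ge0.
have mball : measurable_fun setT (fun y => (`|y - x| < r)%R).
  by apply: measurable_fun_ltr; meas.
have mge : measurable_fun setT (fun y => if (`|y - x| < r)%R then (even_part g y)%:E else 0).
  by meas.
have ge0 y : 0 <= (if (`|y - x| < r)%R then (even_part g y)%:E else 0).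
  by case: ifP => _; [rewrite lee_fin even_part_ge0|exact: lexx].
apply: (@le_trans _ _ ((2 `^ p / (K * A) `^ p)%:E * I)).
  rewrite -ge0_integralZl//; apply: integral_half_le.
  - by apply: measurable_fun_ifT; [by []|by meas|by meas].
  - exact: (emeasurable_funM (measurable_cst _) mge).
  - by move=> y; case: ifP => _; [rewrite lee_fin powR_ge0|exact: lexx].
  - by move=> y; apply: mule_ge0.
  move=> y y0; case: ifP => _; last by rewrite mule0.
  by rewrite -EFinM lee_fin; exact: Hg.
apply: (le_trans (lee_wpmul2l _ le2)); first by rewrite lee_fin.
rewrite -EFinM lee_fin powRM ?(ltW K0) ?(ltW A0)// Kp le_eqVlt; apply/orP; left; apply/eqP.
have : (A `^ p != 0)%R by rewrite gt_eqF// powR_gt0.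
have : (2 `^ p != 0 :> R)%R by rewrite gt_eqF// powR_gt0.
have : (K1 != 0)%R by rewrite gt_eqF.
by move=> ? ? ?; field; apply/and3P; split.
Qed.

Local Notation WP H z := (weighted_potential n gam alp bet H z).

(** The power [s] of the weighted potential is integrable on every bounded set, hence finite almost
    everywhere, and its finiteness gives absolute convergence. *)
Lemma frac_integral_defined f H :
  (forall x, (WP H `|x| < +oo -> (0 < `|x|)%R ->
    cintegrable (dunkl_measure nu) setT (dunkl_frac_integrand nu gam f x))) ->
  measurable_fun setT H -> (forall y, 0 <= H y)%R ->
  (forall x r, (0 < x)%R -> (0 < r)%R ->
    \int[half n]_z (if (`|z - x| < r)%R then WP H z `^ s else 0) < +oo) ->
  dunkl_frac_integral_defined nu gam f.
Proof.
move=> cint mH H0 fin.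
have mW := measurable_weighted_potential n gam alp bet mH H0.
have W0 z : 0 <= WP H z by exact: weighted_potential_ge0.
(* The value [+oo] at [0] excludes that point from the set where [F N] is finite; it does not affect
   integrability, as [half n] does not charge [0]. *)
pose F (N : nat) x := if (`|x| < N.+1%:R)%R then
  (if (0 < `|x|)%R then WP H `|x| `^ s else +oo) else 0.
have mF N : measurable_fun setT (F N).
  rewrite /F; apply: measurable_fun_ifT; [by meas| |by meas].
  apply: measurable_fun_ifT; [by meas| |by meas].
  by apply: measurable_fun_poweR; apply: (measurable_fun_comp1 mW); meas.
have F0 N x : 0 <= F N x.
  by rewrite /F; case: ifP => // _; case: ifP => _; [exact: poweR_ge0|exact: leey].
have ae N : {ae dunkl_measure nu, forall x, setT x -> F N x \is a fin_num}.
  apply: integrable_ae => //; apply/integrableP; split => //.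
  rewrite (eq_integral (F N)); last by move=> x _; rewrite gee0_abs.
  rewrite (integral_dunkl nu_gt (mF N) (F0 N)).
  pose G z := if (`|z - N.+1%:R| < N.+1%:R)%R then WP H z `^ s else 0.
  have mG : measurable_fun setT G.
    rewrite /G; apply: measurable_fun_ifT; [|by meas|by meas].
    by apply: measurable_fun_ltr; meas.
  have G0 z : 0 <= G z by rewrite /G; case: ifP => // _; exact: poweR_ge0.
  have N0 : (0 < N.+1%:R :> R)%R by rewrite ltr0n.
  have le : \int[half n]_y (F N y + F N (- y)%R) <= 2%:E * \int[half n]_z G z.
    rewrite -ge0_integralZl//; apply: integral_half_le.
    - by apply: (emeasurable_funD (mF N)); apply: (measurable_fun_comp1 (mF N)); meas.
    - exact: (emeasurable_funM (measurable_cst _) mG).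
    - by move=> y; apply: adde_ge0.
    - by move=> y; apply: mule_ge0.
    move=> y y0; rewrite /F /G normrN (gtr0_norm y0) y0.
    case: ifP => yN; last by rewrite adde0; apply: mule_ge0 => //; exact: (G0 y).
    rewrite ifT; last by rewrite ltr_norml; apply/andP; split; lra.
    by rewrite mule_natl mule2n.
  apply: (le_lt_trans (lee_wpmul2l _ le)); first by rewrite lee_fin dunkl_norm_ge0.
  rewrite muleA -EFinM lte_mul_pinfty ?lee_fin ?mulr_ge0 ?dunkl_norm_ge0//.
  exact: fin.
have := ae_foralln ae; apply: filterS => x Fx.
have [N xN] : exists N : nat, (`|x| < N.+1%:R)%R.
  by exists (Num.truncn `|x|); exact: truncnS_gt.
move: (Fx N I); rewrite /F xN; case: ifP => // x0 Wfin; apply: cint => //.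
rewrite ltey; apply/eqP => W; move: Wfin.
by rewrite W poweRyr// gt_eqF.
Qed.

(** The bound is stated for any [A > 0] above the norm, rather than for the norm itself, because [H]
    is normalised through division by [K1 * A] and the norm may be [0]. *)
Lemma frac_integral_morrey_bounded : (0 < c0)%R -> (0 < C)%R ->
  exists2 K, (0 < K)%R & forall f A, (0 < A)%R -> cmeasurable_fun setT f ->
  dunkl_morrey_norm nu p q (power_mul alp f) <= A%:E ->
  dunkl_frac_integral_defined nu gam f /\
  dunkl_morrey_norm nu s t (power_mul (- bet) (dunkl_frac_integral nu gam f)) <= (K * A)%:E.
Proof.
move=> c00 CE.
have [K1 K10 mor] := morrey_modulus c00 CE.
have [K2 K20 wp] := weighted_potential_ball n0 gam0 gamD ab0 kb bk b0 p1 s1 bs alpk betb.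
have [K3 K30 tr] := translation_morrey_density nu_gt c00.
pose K4 := (2 * (c0 * (4 * C) * K1))%R.
have K40 : (0 < K4)%R.
  have C4 : (0 < 4 * C)%R by have := CE; lra.
  exact: (mulr_gt0 _ (mulr_gt0 (mulr_gt0 c00 C4) K10)).
exists ((K3 * (2 * K2)) `^ s^-1 * K4)%R.
  by rewrite mulr_gt0// powR_gt0// mulr_gt0// mulr_gt0.
move=> f A A0 mf le; pose H y := ((normc (power_mul alp f y) + normc (power_mul alp f (- y))) / (K1 * A))%R.
have KA : (0 < K1 * A)%R by exact: mulr_gt0.
have morH : morrey n p k H by apply: mor => //; exact: cmeasurable_power_mul.
have [mH H0 _] := morH.
have fL y : (0 < y)%R ->
    (normc (f y) + normc (f (- y)) = K1 * A * (y `^ (- alp) * H y))%R.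
  move=> y0; rewrite /H !normc_power_mul normrN (gtr0_norm y0) powRN.
  have ya : (y `^ alp != 0)%R by rewrite gt_eqF// powR_gt0.
  by field; rewrite ya !gt_eqF.
have W0 z : 0 <= WP H z by exact: weighted_potential_ge0.
have mW := measurable_weighted_potential n gam alp bet mH H0.
have Wball := wp H morH.
split.
  apply: (frac_integral_defined _ mH H0); last first.
    by move=> x r x0 r0; apply: (le_lt_trans (Wball x r x0 r0)); exact: ltry.
  move=> x Wx x0; apply: (cintegrable_frac nu_gt mf mH H0 (ltW KA) fL).
  rewrite ltey; apply/eqP => P; move: Wx.
  by rewrite /weighted_potential P gt0_muley// lte_fin powR_gt0.
have mIf := cmeasurable_frac_integral gam nu_gt mf.
have mJ := measurable_normc (cmeasurable_power_mul (- bet)%R mIf).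
set J := power_mul _ _ in mJ *.
pose g x := (normc (J x) `^ s)%R.
have mg : measurable_fun setT g by rewrite /g; meas.
have g0 x : (0 <= g x)%R by exact: powR_ge0.
have JW x : (normc (J x))%:E <= (K4 * A)%:E * WP H `|x|.
  rewrite normc_power_mul /weighted_potential muleCA EFinM; apply: lee_wpmul2l.
    by rewrite lee_fin powR_ge0.
  have := normc_frac_integral_le gam nu_gt mf mH H0 (ltW KA) fL x.
  by congr (_ <= _%:E * _); rewrite /K4; ring.
have J0 x : (0 <= normc (J x))%R := le_trans (normr_ge0 _) (normc_ge_Re (J x)).
have K4A : (0 <= K4 * A)%R by rewrite mulr_ge0// ltW.
have gW x : (g x)%:E <= ((K4 * A) `^ s)%:E * WP H `|x| `^ s.
  rewrite -poweR_EFin -poweRM ?lee_fin// -poweR_EFin; apply: gt0_ler_poweR => //.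
  - exact: ltW.
  - by rewrite in_itv/= leey andbT lee_fin.
  - by rewrite in_itv/= leey andbT mule_ge0.
pose B := (2 * (K4 * A) `^ s * K2)%R.
have B0 : (0 <= B)%R by rewrite /B !mulr_ge0 ?powR_ge0// ltW.
have morg : morrey_density n B (k * p) (fun z => (even_part g z)%:E).
  move=> x r x0 r0.
  have mball : measurable_fun setT (fun y => (`|y - x| < r)%R).
    by apply: measurable_fun_ltr; meas.
  have mWs : measurable_fun setT (fun z => if (`|z - x| < r)%R then WP H z `^ s else 0).
    apply: measurable_fun_ifT => //; exact: measurable_fun_poweR.
  have Ws0 z : 0 <= (if (`|z - x| < r)%R then WP H z `^ s else 0).
    by case: ifP => _; [exact: poweR_ge0|exact: lexx].
  have me := measurable_even_part mg.
  have cs : 0 <= (2 * (K4 * A) `^ s)%:E by rewrite lee_fin mulr_ge0 ?powR_ge0.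
  apply: (@le_trans _ _ ((2 * (K4 * A) `^ s)%:E *
    \int[half n]_z (if (`|z - x| < r)%R then WP H z `^ s else 0))).
    rewrite -ge0_integralZl//; apply: integral_half_le.
    - by apply: measurable_fun_ifT => //; meas.
    - exact: (emeasurable_funM (measurable_cst _) mWs).
    - by move=> z; case: ifP => _; [rewrite lee_fin even_part_ge0|exact: lexx].
    - by move=> z; apply: mule_ge0.
    move=> z z0; case: ifP => _; last by rewrite mule0.
    have := leeD (gW z) (gW (- z)%R); rewrite normrN (gtr0_norm z0) -EFinD => h.
    apply: (le_trans h); rewrite -ge0_muleDr ?poweR_ge0// -mule2n -mule_natl muleA -EFinM.
    by rewrite mulrC.
  apply: (le_trans (lee_wpmul2l cs (Wball x r x0 r0))).
  by rewrite -EFinM lee_fin /B !mulrA.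
have lg := morrey_density_locally_integrable nu_gt g0 mg morg.
have trB x r : (0 < r)%R ->
    0 <= \int[dunkl_measure nu]_(y in ball (0%R : R) r) (dunkl_translation nu x g y)%:E <=
    (K3 * B * r `^ (n + 1 - (n + 1) / t * s))%:E.
  by move=> r0; rewrite bs; apply: tr.
have K3B : (0 <= K3 * B)%R by rewrite mulr_ge0// ltW.
apply: (le_trans (dunkl_morrey_norm_le s0 K3B lg trB)).
rewrite lee_fin le_eqVlt; apply/orP; left; apply/eqP.
have -> : (K3 * B = K3 * (2 * K2) * (K4 * A) `^ s)%R by rewrite /B; ring.
have K32 : (0 <= K3 * (2 * K2))%R by rewrite mulr_ge0 ?(ltW K30)// mulr_ge0// ltW.
rewrite -[RHS]mulrA; move: (K3 * (2 * K2))%R (K4 * A)%R K32 K4A => c d cge0 dge0.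
by rewrite powRM ?powR_ge0// -powRrM mulfV ?gt_eqF// powRr1.
Qed.

End frac_integral_morrey.

(** * The case of vanishing translations, and the theorem *)

Section degenerate.
Context {R : realType}.
Variables nu gam bet s t : R.
Hypotheses (nuN : nu != - (1 / 2)) (C0 : dunkl_const nu = 0) (s1 : 1 < s).
Implicit Types (x y : R) (g : R -> R) (f : R -> R[i]).
Local Open Scope ereal_scope.

Lemma dunkl_translation_degenerate x g y : dunkl_translation nu x g y = 0%R.
Proof. by rewrite /dunkl_translation (negbTE nuN) C0 !mul0r. Qed.

Lemma frac_integrand_degenerate f x y : dunkl_frac_integrand nu gam f x y = 0%R.
Proof. by rewrite /dunkl_frac_integrand dunkl_translation_degenerate mulr0. Qed.

Lemma frac_integral_degenerate f : dunkl_frac_integral_defined nu gam f /\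
  dunkl_morrey_norm nu s t (power_mul bet (dunkl_frac_integral nu gam f)) <= 0.
Proof.
have int0 x : cintegrable (dunkl_measure nu) setT (dunkl_frac_integrand nu gam f x).
  have -> : dunkl_frac_integrand nu gam f x = fun=> 0%R.
    by apply/funext => y; exact: frac_integrand_degenerate.
  by split; exact: integrable0.
split; first exact: aeW.
have sN : (s != 0)%R by rewrite gt_eqF// (lt_trans ltr01).
have I0 : dunkl_frac_integral nu gam f = fun=> 0%R.
  apply/funext => x; rewrite /dunkl_frac_integral /cintegral.
  have -> : dunkl_frac_integrand nu gam f x = fun=> 0%R.
    by apply/funext => y; exact: frac_integrand_degenerate.
  by rewrite /Rintegral integral0.
rewrite /dunkl_morrey_norm.
have -> : (fun z => normc (power_mul bet (dunkl_frac_integral nu gam f) z) `^ s)%R = fun=> 0%R.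
  by apply/funext => z; rewrite I0 /power_mul mulr0 ComplexField.Normc.normc0 powR0.
rewrite asboolT; last first.
  by split => // K _; exact: integrable0.
apply: ge_ereal_sup => _ [x [r [r0 ->]]].
rewrite (eq_integral (fun=> 0)); last by move=> y _; rewrite dunkl_translation_degenerate.
by rewrite integral0 poweR0r ?invr_eq0// mule0.
Qed.

End degenerate.

Theorem theorem4p1 (R : realType) (nu gamma alpha beta p q q' s t : R) :
  - (1 / 2) <= nu ->
  0 < gamma -> gamma < dunkl_dim nu ->
  0 <= alpha + beta -> alpha + beta <= gamma ->
  1 < p -> p <= q ->
  (gamma != alpha + beta -> q < dunkl_dim nu / (gamma - alpha - beta)) ->
  1 < s -> s <= t ->
  1 / t = 1 / q - (gamma - alpha - beta) / dunkl_dim nu ->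
  s / t = p / q ->
  1 / q + 1 / q' = 1 ->
  alpha < dunkl_dim nu / q' ->
  beta < dunkl_dim nu / t ->
  t < dunkl_dim nu ->
  exists C : R, 0 < C /\
    forall f : R -> R[i],
      cmeasurable_fun setT f ->
      dunkl_morrey_space nu p q (power_mul alpha f) ->
      dunkl_frac_integral_defined nu gamma f /\
      (dunkl_morrey_norm nu s t (power_mul (- beta) (dunkl_frac_integral nu gamma f))
        <= C%:E * dunkl_morrey_norm nu p q (power_mul alpha f))%E.
Proof.
move=> nu_ge gam0 gamD ab0 abg p1 pq _ s1 st tE stE qq' alpq betat tD.
have DE : dunkl_dim nu = 2 * nu + 1 + 1 by rewrite /dunkl_dim; ring.
have t0 : 0 < t by lra.
have q0 : 0 < q by lra.
have nu_gt : - (1 / 2) < nu by move: tD; rewrite DE; lra.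
have nuN : nu != - (1 / 2) by rewrite gt_eqF.
have [C0|C0] := eqVneq (dunkl_const nu) 0.
  exists 1; split => // f mf _.
  have [def le] := frac_integral_degenerate gamma (- beta) t nuN C0 s1 f.
  by split => //; apply: (le_trans le); rewrite mul1e dunkl_morrey_norm_ge0.
have CE : 0 < dunkl_const nu by rewrite lt_def C0 dunkl_const_ge0.
have c00 : 0 < dunkl_norm nu.
  (* [Gamma (nu + 1)] is a factor of [dunkl_const nu], so it cannot vanish here. *)
  rewrite invr_gt0 mulr_gt0 ?powR_gt0// lt_def Gamma_ge0 andbT.
  by apply: contra C0 => /eqP; rewrite /dunkl_const => ->; rewrite mul0r.
rewrite DE in gamD tE alpq betat tD.
set n1 := 2 * nu + 1 + 1 in gamD tE alpq betat tD.
have n10 : 0 < n1 by lra.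
have tqE : n1 / t = n1 / q - (gamma - alpha - beta).
  have := congr1 ( *%R n1) tE; rewrite mulrBr !mul1r => ->.
  by congr (_ - _); rewrite mulrC divfK// gt_eqF.
have kb : n1 / q - n1 / t = gamma - alpha - beta by rewrite tqE; ring.
have bk : n1 / t <= n1 / q by rewrite -subr_ge0 kb; lra.
have b0 : 0 < n1 / t by exact: divr_gt0.
have bs : n1 / t * s = n1 / q * p.
  by rewrite mulrAC -mulrA stE mulrA mulrAC.
have alpk : alpha < n1 - n1 / q.
  have : n1 / q' = n1 - n1 / q by have := congr1 ( *%R n1) qq'; rewrite mulrDr !mul1r mulr1; lra.
  by move=> <-.
have [K K0 bound] := @frac_integral_morrey_bounded R nu gamma alpha beta p q s t
  nu_gt gam0 gamD ab0 kb bk b0 p1 s1 bs alpk betat c00 CE.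
exists K; split => // f mf [_ _ fin].
have N0 := dunkl_morrey_norm_ge0 nu p q (power_mul alpha f).
move: N0 fin bound; move N : (dunkl_morrey_norm nu p q _) => [a| |] // a0 _ bound.
(* The norm [a] may be [0], so the bound is used at [a + e / K]; multiplied by [K] the excess is
   [e], which then tends to [0]. *)
have a1 e : 0 < e -> 0 < a + e / K /\ (dunkl_morrey_norm nu p q (power_mul alpha f) <= (a + e / K)%:E)%E.
  move=> e0; have eK : 0 < e / K by exact: divr_gt0.
  by move: a0; rewrite N !lee_fin; split; lra.
split.
  by have [h1 h2] := a1 1 ltr01; have [] := bound f _ h1 mf h2.
apply/lee_addgt0Pr => e e0; have [h1 h2] := a1 e e0.
have [_ le] := bound f _ h1 mf h2; apply: (le_trans le).
by rewrite -EFinM -EFinD lee_fin mulrDr mulrCA divff ?gt_eqF// mulr1.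
Qed.
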